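(* Define $s(1)=1$, $s(2)=2/3$, $s(3)=1/2$, $s(4)=4/9$, $s(5)=3/8$, $s(6)=1/3$, $s(7)=3/10$, $s(8)=2/7$, $s(9)=1/4$. For every integer $1\le b\le 9$ and every finite weighted graph $(G,\lambda)$ with first Betti number $b$, the systole satisfies $\mathrm{sys}(G,\lambda)\le s(b)$. Moreover, these bounds are optimal: for every $1\le b\le 9$ there is a finite weighted graph $(G,\lambda)$ with first Betti number $b$ and $\mathrm{sys}(G,\lambda)=s(b)$.
   Context: Graphs may have loops and multiple edges. The first Betti number of a finite graph $G$ is the rank of $H_1(G;\mathbb{Z})$, with $G$ viewed as a $1$-dimensional CW complex. A weighted graph $(G,\lambda)$ is a finite graph $G$ together with a function $\lambda:E(G)\to\mathbb{R}_{\ge 0}$ on its edge set which is not identically zero. For a subgraph $H$ of $G$, $\lambda(H)=\sum_{e\in E(H)}\lambda(e)$. The systole is $$\mathrm{sys}(G,\lambda)=\min_C \frac{\lambda(C)}{\lambda(G)},$$ where the minimum runs over all (simple) cycles $C$ in $G$. *)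

(* Defs.v *)
From mathcomp Require Import all_boot all_order all_algebra.
From mathcomp Require Import boolp reals.

Set Implicit Arguments.
Unset Strict Implicit.
Unset Printing Implicit Defensive.

Import Order.TTheory GRing.Theory Num.Theory.
Local Open Scope ring_scope.

(* The orientation [src e -> tgt e] of an edge is an auxiliary choice; loops
   ([src e = tgt e]) and parallel edges are allowed. *)
Record multigraph := Multigraph {
  vertex : finType;
  edge : finType;
  src : edge -> vertex;
  tgt : edge -> vertex
}.

(* Rank of an abelian group, given as a subgroup [A] of [M]: the maximal
   number of Z-linearly independent elements. *)
Definition Z_independent (M : zmodType) (r : nat) (x : 'I_r -> M) : Prop :=
  forall a : 'I_r -> int, \sum_i x i *~ a i = 0 -> forall i, a i = 0.

Definition has_rank (M : zmodType) (A : {pred M}) (r : nat) : Prop :=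
  (exists x : 'I_r -> M, (forall i, x i \in A) /\ Z_independent x) /\
  (forall (k : nat) (x : 'I_k -> M),
     (forall i, x i \in A) -> Z_independent x -> (k <= r)%N).

Section Homology.
Variable G : multigraph.

Definition boundary (c : {ffun edge G -> int}) : {ffun vertex G -> int} :=
  [ffun v => \sum_(e | tgt e == v) c e - \sum_(e | src e == v) c e].

(* As there are no 2-cells, cellular H_1(G; Z) is the kernel of the boundary
   map Z^E -> Z^V. *)
Definition H1 : {pred {ffun edge G -> int}} := [pred c | boundary c == 0].

Definition first_betti (b : nat) : Prop := has_rank H1 b.

End Homology.

Section SimpleCycles.
Variable G : multigraph.

(* A dart [(e, d)] is the edge [e] traversed from [src e] to [tgt e] if [d] is
   true, and backwards otherwise. *)
Definition dart : Type := (edge G * bool)%type.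
Definition dart_start (d : dart) : vertex G :=
  if d.2 then src d.1 else tgt d.1.
Definition dart_end (d : dart) : vertex G :=
  if d.2 then tgt d.1 else src d.1.

(* Distinctness of the edges only matters for length 2, where it excludes
   going back and forth along one edge. Loops are cycles of length 1 and pairs
   of parallel edges are cycles of length 2. *)
Definition simple_closed_walk (w : seq dart) : bool :=
  [&& w != [::],
      cycle (fun d d' => dart_end d == dart_start d') w,
      uniq [seq dart_start d | d <- w]
    & uniq [seq d.1 | d <- w]].

(* A cycle, as a subgraph, is represented by its edge set. *)
Definition is_cycle (C : {set edge G}) : Prop :=
  exists2 w : seq dart,
    simple_closed_walk w & C = [set e | e \in [seq d.1 | d <- w]].

End SimpleCycles.

Record weighted_graph (R : realType) := WeightedGraph {
  graph :> multigraph;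
  weight : edge graph -> R;
  weight_ge0 : forall e, 0 <= weight e;
  weight_neq0 : exists e, weight e != 0
}.

Section Systole.
Variables (R : realType) (G : weighted_graph R).

Definition total_weight (H : {set edge G}) : R := \sum_(e in H) weight e.

(* Each ratio is at most 1, so the default value 1 does not affect the minimum
   as soon as G contains a cycle; see [systole_attained]. *)
Definition systole : R :=
  \big[Num.min/1]_(C : {set edge G} | `[< is_cycle C >])
    (total_weight C / total_weight [set: edge G]).

Lemma total_weight_gt0 : 0 < total_weight [set: edge G].
Proof.
have [e we] := weight_neq0 G.
rewrite /total_weight (bigD1 e) ?inE //=.
apply: ltr_wpDr; first by apply: sumr_ge0 => f _; exact: weight_ge0.
by rewrite lt0r we weight_ge0.
Qed.

Lemma total_weight_ratio_le1 (C : {set edge G}) :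
  total_weight C / total_weight [set: edge G] <= 1.
Proof.
rewrite ler_pdivrMr ?total_weight_gt0 // mul1r /total_weight.
rewrite [leRHS](big_setID C) /= setTI lerDl.
by apply: sumr_ge0 => f _; exact: weight_ge0.
Qed.

Lemma systole_le (C : {set edge G}) : is_cycle C ->
  systole <= total_weight C / total_weight [set: edge G].
Proof. by move=> cC; apply: bigmin_le_cond; exact/asboolP. Qed.

Lemma systole_attained : (exists C : {set edge G}, is_cycle C) ->
  exists2 C : {set edge G}, is_cycle C &
    systole = total_weight C / total_weight [set: edge G].
Proof.
move=> [C0 cC0]; rewrite /systole.
rewrite (bigmin_eq_arg _ C0); [| exact/asboolP |].
  by case: arg_minP => [|C /asboolP cC _]; [exact/asboolP | exists C].
by move=> C _; exact: total_weight_ratio_le1.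
Qed.

End Systole.

(* The value outside 1 <= b <= 9 is irrelevant. *)
Definition s (R : realType) (b : nat) : R :=
  match b with
  | 1%N => 1
  | 2%N => 2 / 3
  | 3%N => 1 / 2
  | 4%N => 4 / 9
  | 5%N => 3 / 8
  | 6%N => 1 / 3
  | 7%N => 3 / 10
  | 8%N => 2 / 7
  | 9%N => 1 / 4
  | _ => 0
  end.

(* Main.v *)
Require Import Defs.
From mathcomp Require Import all_boot all_order all_algebra.
From mathcomp Require Import boolp reals.
From mathcomp Require Import lra zify.
Import Order.TTheory GRing.Theory Num.Theory.
Set Implicit Arguments.
Unset Strict Implicit.
Unset Printing Implicit Defensive.
Local Open Scope ring_scope.

(** Let [rho b = 1 / s b]. The upper bound says that if every cycle weighs at
    least [k], then a set of edges of Betti number at least [b] weighs at least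
    [rho b * k]. Everything is done with chains modulo 2: the support of a
    nonzero closed chain contains a simple cycle, so closed chains and cycles
    have the same minimal weight, and Betti number at least [b] becomes the
    statement that fewer than [b] edges never meet all closed chains.

    Structure of the graphs ([grow]). Start with a cycle in the given set of
    edges and attach ears, that is, paths that meet the part already built in
    their ends only. If this stops at Betti number [j < b], the remaining edges
    alone have Betti number [b - j], and the bound follows by adding the bounds
    for [j] and [b - j]. Otherwise the set contains a model, in the sense of
    edge-disjoint trails that may be empty, of a loopless bridgeless cubic graph
    of Betti number [b], obtained from the theta graph by [b - 2] insertions of
    an edge between inner points of edges. Replacing each trail by one edge of
    the same weight reduces the problem to these cubic graphs.

    Heavy stars. A cubic graph of Betti number [b] has [2 (b - 1)] vertices and
    each edge lies in two vertex stars, so some star carries at least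
    [1 / (b - 1)] of the weight ([star]). Deleting it lowers the Betti number by
    2, hence a bound [c] for [b - 2] gives the bound [c (b - 1) / (b - 2)] for
    [b]. This proves the values for [b = 3, 4, 5]
    from the evident ones for [b = 1, 2], and the value for [b = 8] from that for
    [b = 6].

    For [b = 6, 7, 9] averaging is not enough, and the light remainder is
    analysed further. At Betti number 5 the bound [35/12] fails only for graphs
    that contain a model of one of two cubic graphs, [L5]; at Betti number 7 the
    bound [7/2] fails only for models of one of two graphs, [L7]. Such statements
    are proved by putting back what was deleted: when a star has been deleted
    from a cubic graph and the remainder contains a model of a listed graph, two
    further ears are attached to this model, first avoiding the heaviest edge of
    the star and then through it ([two_ears]). If an ear does not exist, there is
    a cycle disjoint from the model and the weight is large; if it exists, the
    model becomes a model of a graph with one more inserted edge. For each of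
    these graphs there is either a fractional packing of cycles, which bounds the
    weight below by duality ([check_certP]), or an isomorphism with a graph of the
    next list. The intermediate bounds come from the share of the heaviest
    edge of the star, at least [1 / (3 (b - 1))] of the weight:
    [385/144 = 35/12 * 11/12], [119/36 = 7/2 * 17/18], [23/6 = 4 * 23/24]. For
    [b = 9] no graph is left over. There are many insertions, so they are treated
    up to symmetry of the parent graph, and most packings are found by a search
    that runs inside the proof ([check_parentP]).

    Optimality. The bounds are attained by the loop, the theta graph, [K_4],
    [K_{3,3}], a weighted cubic graph on 8 vertices, the Petersen graph, a weighted
    cubic graph on 12 vertices, the Heawood graph and the Moebius-Kantor graph. A
    closed chain is determined by its values off a spanning tree, so that all
    [2 ^ b] closed chains can be listed and weighed ([completeP]). *)

(** * Walks and chains modulo 2 *)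

Notation F2 := 'F_2.

Lemma F2_dbl (x : F2) : x + x = 0.
Proof. by apply/eqP; case: x => [[|[|]]]. Qed.

Lemma F2_neq0 (x : F2) : x != 0 -> x = 1.
Proof. by case: x => [[|[|]]] //= i _; apply/eqP. Qed.

Lemma F2_addr0_eq (x y : F2) : x + y = 0 -> x = y.
Proof. by move=> xy; rewrite -[y]add0r -(F2_dbl x) -addrA xy addr0. Qed.

Lemma uniq_map_inj (T U : eqType) (f : T -> U) (t : seq T) :
  uniq (map f t) -> {in t &, injective f}.
Proof.
elim: t => //= a t IH /andP[nat ut] x y.
rewrite !inE => /predU1P[->|xt] /predU1P[->|yt] // fE; last exact: IH.
  by rewrite fE map_f in nat.
by rewrite -fE map_f in nat.
Qed.

(** Everything below concerns finitely many edges [pes] of an ambient graph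
    whose vertices and edges need not form finite types; this covers both the
    multigraphs of the theorem and graphs given by lists of pairs of numbers. *)
Record pgraph := PGraph {
  pV : eqType;
  pE : eqType;
  psrc : pE -> pV;
  ptgt : pE -> pV;
  pes : seq pE;
  pes_uniq : uniq pes
}.

Section Walks.
Variable Gm : pgraph.
Notation V := (pV Gm).
Notation E := (pE Gm).

Definition pdart : Type := (E * bool)%type.
Definition dstart (d : pdart) : V := if d.2 then psrc d.1 else ptgt d.1.
Definition dend (d : pdart) : V := if d.2 then ptgt d.1 else psrc d.1.
Definition ends (e : E) (x : V) : nat := (psrc e == x) + (ptgt e == x).
Definition edges (p : seq pdart) : seq E := [seq d.1 | d <- p].

Lemma ends_dart (d : pdart) x : ends d.1 x = ((dstart d == x) + (dend d == x))%N.
Proof. by case: d => e [] /=; rewrite /ends // addnC. Qed.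

Fixpoint walk (u : V) (p : seq pdart) (v : V) : bool :=
  if p is d :: p' then (dstart d == u) && walk (dend d) p' v else u == v.

Lemma walk_cat u p q v :
  walk u (p ++ q) v <-> exists x, walk u p x /\ walk x q v.
Proof.
elim: p u => [|d p IH] u /=.
  by split=> [wq|[x [/eqP-> ]]] //; exists u.
split=> [/andP[-> /IH [x [? ?]]]|[x [/andP[-> wp] wq]]]; first by exists x.
by apply/IH; exists x.
Qed.

Lemma walk_det u p v v' : walk u p v -> walk u p v' -> v = v'.
Proof.
by elim: p u => [|d p IH] u /=; [move=> /eqP<- /eqP|move=> /andP[_ /IH H] /andP[_ /H]].
Qed.

Definition dflip (d : pdart) : pdart := (d.1, ~~ d.2).
Definition wrev (p : seq pdart) : seq pdart := rev (map dflip p).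

Lemma dstart_flip d : dstart (dflip d) = dend d.
Proof. by case: d => e []. Qed.

Lemma dend_flip d : dend (dflip d) = dstart d.
Proof. by case: d => e []. Qed.

Lemma walk_rev u p v : walk u p v -> walk v (wrev p) u.
Proof.
elim: p u => [|d p IH] u /=; first by move/eqP->.
move=> /andP[/eqP<- /IH wp]; rewrite /wrev /= rev_cons -cats1.
apply/walk_cat; exists (dend d); split=> //=.
by rewrite dstart_flip dend_flip !eqxx.
Qed.

Lemma edges_rev p : edges (wrev p) = rev (edges p).
Proof. by rewrite /edges /wrev map_rev -map_comp. Qed.

Lemma edges_cat p q : edges (p ++ q) = edges p ++ edges q.
Proof. exact: map_cat. Qed.

Lemma count_edges_rev e p : count_mem e (edges (wrev p)) = count_mem e (edges p).
Proof. by rewrite edges_rev count_rev. Qed.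

(** Closed 1-chains modulo 2. A loop has both its ends at the same vertex, so
    it contributes twice there and is closed by itself. *)
Definition cyc (c : E -> F2) : Prop :=
  forall x, \sum_(e <- pes Gm) c e *+ ends e x = 0.

Definition nonzero (c : E -> F2) : Prop := exists2 e, e \in pes Gm & c e != 0.

Lemma cyc_add c c' : cyc c -> cyc c' -> cyc (fun e => c e + c' e).
Proof.
move=> cc cc' x; under eq_bigr do rewrite mulrnDl.
by rewrite big_split /= cc cc' addr0.
Qed.

Lemma walk_boundary u p v x : walk u p v ->
  \sum_(e <- edges p) (ends e x)%:R = (u == x)%:R + (v == x)%:R :> F2.
Proof.
elim: p u => [|d p IH] u /=.
  by move/eqP->; rewrite big_nil F2_dbl.
move=> /andP[/eqP<- /IH wp].
by rewrite big_cons wp ends_dart natrD -addrA [X in _ + X]addrA F2_dbl add0r.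
Qed.

Lemma sum_count (R : nmodType) (s t : seq E) (f : E -> R) : uniq s ->
  {subset t <= s} ->
  \sum_(e <- s) f e *+ count_mem e t = \sum_(e <- t) f e.
Proof.
move=> us; elim: t => [|y t IH] sub.
  by rewrite big_nil big1_seq // => e _; rewrite mulr0n.
rewrite big_cons /=; under eq_bigr do rewrite mulrnDr.
rewrite big_split /= IH; last by move=> z zt; apply: sub; rewrite inE zt orbT.
congr (_ + _).
rewrite (bigD1_seq y) ?sub ?inE ?eqxx //= mulr1n big1 ?addr0 // => e ney.
by rewrite eq_sym (negPf ney) mulr0n.
Qed.

Definition wchain (p : seq pdart) (e : E) : F2 := (count_mem e (edges p))%:R.

Lemma wchain_cyc u p : walk u p u -> {subset edges p <= pes Gm} ->
  cyc (wchain p).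
Proof.
move=> wp sub x.
have := walk_boundary x wp; rewrite F2_dbl; apply: etrans.
rewrite -(sum_count _ (pes_uniq Gm) sub); apply: eq_bigr => e _.
by rewrite /wchain -!mulrnA mulnC.
Qed.

(** The transposed form of closedness: the coboundary of any function of the
    vertices pairs to zero with a closed chain. Later lemmas use it with functions
    that single out or merge vertices. *)
Lemma cyc_test c (phi : V -> F2) : cyc c ->
  \sum_(e <- pes Gm) c e * (phi (psrc e) + phi (ptgt e)) = 0.
Proof.
move=> cc.
pose vs := undup (map (@psrc Gm) (pes Gm) ++ map (@ptgt Gm) (pes Gm)).
have src_in e : e \in pes Gm -> psrc e \in vs.
  by move=> ein; rewrite mem_undup mem_cat map_f.
have tgt_in e : e \in pes Gm -> ptgt e \in vs.
  by move=> ein; rewrite mem_undup mem_cat orbC map_f.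
have pick y : y \in vs -> phi y = \sum_(x <- vs) phi x *+ (y == x).
  move=> yin; rewrite (bigD1_seq y) ?undup_uniq //= eqxx big1 ?addr0 // => x.
  by rewrite eq_sym => /negPf->; rewrite mulr0n.
have E1 : \sum_(e <- pes Gm) c e * (phi (psrc e) + phi (ptgt e)) =
   \sum_(e <- pes Gm) \sum_(x <- vs) c e *+ ends e x * phi x.
  apply: eq_big_seq => e ein; rewrite (pick _ (src_in _ ein)) (pick _ (tgt_in _ ein)).
  rewrite -big_split /= mulr_sumr; apply: eq_bigr => x _.
  by rewrite -mulrnDr -/(ends e x) mulrnAl mulrnAr.
rewrite E1 exchange_big big1 // => x _.
by rewrite -mulr_suml cc mul0r.
Qed.

End Walks.

(** * Simple closed walks in the support of a chain *)

Section SimpleCycles.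
Variable Gm : pgraph.
Notation V := (pV Gm).
Notation E := (pE Gm).
Implicit Types (p w : seq (pdart Gm)) (u v x : V) (e : E).

(** Distinctness of the edges matters only for length 2, where it forbids to
    go back along the same edge. *)
Definition scw u w : bool :=
  [&& w != [::], walk u w u, uniq (map (@dstart Gm) w) & uniq (edges w)].

Lemma dend_inner u p d p' v : walk u (p ++ d :: p') v -> p' != [::] ->
  dend d \in map (@dstart Gm) p'.
Proof.
move=> /walk_cat[x [_ /= /andP[_]]].
by case: p' => //= d' p'; move=> /andP[/eqP-> _] _; rewrite inE eqxx.
Qed.

Lemma dart_at e x : ends e x != 0%N -> exists2 d : pdart Gm, d.1 = e & dstart d = x.
Proof.
rewrite /ends; case: (psrc e =P x) => [<- _|_ /=]; first by exists (e, true).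
by case: (ptgt e =P x) => // <- _; exists (e, false).
Qed.

(** Follow edges of [S] without ever going back. As no vertex is a dead end,
    the walk meets itself after at most as many steps as there are vertices.
    Supports of closed chains have no dead ends, with coefficients in F_2 and
    in the integers alike, which is why [S] is arbitrary. *)
Lemma leafless_cycle (S : pred E) e0 : e0 \in pes Gm -> S e0 ->
  (forall x e, e \in pes Gm -> S e -> ends e x = 1%N ->
     exists2 e', (e' \in pes Gm) && S e' & (e' != e) && (ends e' x != 0%N)) ->
  exists u w, scw u w /\ forall e, e \in edges w -> e \in pes Gm /\ S e.
Proof.
move=> e0in Se0 leafless.
have [/hasP[e ein /andP[Se /eqP le]]|/hasPn noloop] :=
    boolP (has (fun e => S e && (psrc e == ptgt e)) (pes Gm)).
  exists (psrc e), [:: (e, true)]; split.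
    by rewrite /scw /= /dstart /dend /= -le eqxx.
  by move=> e' /=; rewrite inE => /eqP->.
pose vs := undup (map (@psrc Gm) (pes Gm) ++ map (@ptgt Gm) (pes Gm)).
have start_in (d : pdart Gm) : d.1 \in pes Gm -> dstart d \in vs.
  by move=> din; rewrite mem_undup mem_cat /dstart; case: (d.2); rewrite map_f ?orbT.
have nl d : d.1 \in pes Gm -> S d.1 -> dstart d != dend d.
  move=> din Sd; have := noloop _ din; rewrite Sd /= /dstart /dend.
  by case: (d.2) => //; rewrite eq_sym.
(* A path without repeated vertices is extended until it meets itself. *)
suff ext n u p d : walk u (rcons p d) (dend d) ->
    uniq (dend d :: map (@dstart Gm) (rcons p d)) -> uniq (edges (rcons p d)) ->
    (forall e, e \in edges (rcons p d) -> e \in pes Gm /\ S e) ->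
    (size vs <= size p + n)%N ->
    exists u w, scw u w /\ forall e, e \in edges w -> e \in pes Gm /\ S e.
  apply: (ext (size vs) (psrc e0) [::] (e0, true)) => //=.
  - by rewrite /dstart /dend /= !eqxx.
  - by rewrite inE eq_sym (nl (e0, true)).
  - by move=> e; rewrite inE => /eqP->.
elim: n u p d => [|n IH] u p d wp un ue inS szn.
  have : (size (map (@dstart Gm) (rcons p d)) <= size vs)%N.
    apply: uniq_leq_size; first by case/andP: un.
    move=> x /mapP[d' d'in ->]; apply: start_in.
    by case: (inS d'.1) => //; apply: map_f.
  by rewrite size_map size_rcons; lia.
have [din Sd] : d.1 \in pes Gm /\ S d.1.
  by apply: inS; apply: map_f; rewrite mem_rcons inE eqxx.
set x := dend d in wp un *.
have endx : ends d.1 x = 1%N.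
  by rewrite ends_dart eqxx (negPf (nl _ din Sd)).
have [e' /andP[e'in Se'] /andP[ne' e'x]] := leafless _ _ din Sd endx.
have [d' Ed' sd'] := dart_at e'x.
rewrite -{}Ed' in e'in Se' ne' e'x.
(* The vertex [x] has just been reached for the first time, so [d] is the
   only dart of the path at [x]. *)
have fresh : d'.1 \notin edges (rcons p d).
  apply/negP => /mapP[d1 d1in Ed1]; move: un => /= /andP[/negP xn _]; apply: xn.
  have : ends d1.1 x != 0%N by rewrite -Ed1.
  rewrite ends_dart; have [E1 _|_ /=] := dstart d1 =P x.
    by rewrite -E1; apply: map_f.
  have [E1 _|//] := dend d1 =P x.
  move: d1in; rewrite mem_rcons inE => /orP[/eqP dd1|d1p].
    by rewrite Ed1 dd1 eqxx in ne'.
  have [p1 [p2 Ep]] : exists p1 p2, p = p1 ++ d1 :: p2.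
    by case/splitPr: d1p => p1 p2; exists p1, p2.
  move: wp; rewrite Ep rcons_cat => /dend_inner; rewrite E1 /= => H.
  by rewrite map_cat mem_cat orbC inE H ?orbT //; case: (p2).
have nl' := nl _ e'in Se'; rewrite sd' in nl'.
have [yin|yout] := boolP (dend d' \in map (@dstart Gm) (rcons p d)); last first.
  apply: (IH u (rcons p d) d').
  - rewrite -[rcons (rcons p d) d']cats1; apply/walk_cat; exists x; split=> //=.
    by rewrite sd' !eqxx.
  - rewrite map_rcons sd' cons_uniq rcons_uniq mem_rcons inE negb_or eq_sym nl' yout.
    exact: un.
  - by rewrite /edges map_rcons rcons_uniq fresh ue.
  - move=> e; rewrite /edges map_rcons mem_rcons inE => /orP[/eqP->//|].
    exact: inS.
  - by rewrite size_rcons addSnnS.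
have [d1 d1in Ed1] := mapP yin.
have [p1 [p2 Ep]] : exists p1 p2, rcons p d = p1 ++ d1 :: p2.
  by case/splitPr: d1in => p1 p2; exists p1, p2.
exists (dend d'), (rcons (d1 :: p2) d'); rewrite Ep in wp un ue inS fresh; split.
  apply/and4P; split=> //.
  - rewrite -cats1; apply/walk_cat; exists x; split.
      by case/walk_cat: wp => z [_ /=]; rewrite Ed1 eqxx => /andP[_ ->].
    by rewrite /= sd' !eqxx.
  - rewrite map_rcons sd' rcons_uniq; move: un.
    rewrite map_cat cons_uniq mem_cat negb_or cat_uniq.
    by move=> /andP[/andP[_ ->] /and3P[_ _ ->]].
  - rewrite /edges map_rcons rcons_uniq; move: ue fresh.
    rewrite edges_cat cat_uniq mem_cat negb_or.
    by move=> /and3P[_ _ ->] /andP[_ ->].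
move=> e; rewrite /edges map_rcons mem_rcons inE => /orP[/eqP->//|ein].
by apply: inS; rewrite edges_cat mem_cat ein orbT.
Qed.

Lemma scw_wchain u w : scw u w -> {subset edges w <= pes Gm} ->
  cyc (wchain w) /\ forall e, wchain w e = (e \in edges w)%:R.
Proof.
move=> /and4P[_ wu _ ue] sub; split; first exact: wchain_cyc wu sub.
by move=> e; rewrite /wchain count_uniq_mem.
Qed.

Lemma cyc_leafless (c : E -> F2) x e : cyc c -> e \in pes Gm -> c e != 0 ->
  ends e x = 1%N ->
  exists2 e', (e' \in pes Gm) && (c e' != 0) & (e' != e) && (ends e' x != 0%N).
Proof.
move=> cc ein ce ex.
have [/hasP[e' e'in /andP[H1 H2]]|/hasPn none] := boolP (has (fun e' =>
    (c e' != 0) && ((e' != e) && (ends e' x != 0%N))) (pes Gm)).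
  by exists e' => //; rewrite e'in.
case/eqP: ce; rewrite -(cc x) (bigD1_seq e) ?pes_uniq //= ex mulr1n.
rewrite big_seq_cond big1 ?addr0 // => e' /andP[e'in ne].
have := none _ e'in; rewrite ne andTb negb_and !negbK => /orP[/eqP->|/eqP->].
  by rewrite mul0rn.
by rewrite mulr0n.
Qed.

(** Some simple cycle lies in the support; subtracting it makes the support
    smaller, and one of the cycles removed in this way contains [e0]. *)
Lemma cyc_through (c : E -> F2) e0 : cyc c -> e0 \in pes Gm -> c e0 != 0 ->
  exists u w, [/\ scw u w, e0 \in edges w &
     forall e, e \in edges w -> e \in pes Gm /\ c e != 0].
Proof.
move=> + e0in; have [n] := ubnP (count (fun e => c e != 0) (pes Gm)).
elim: n c => // n IH c szn cc ce0.
have [u [w [sw inw]]] := leafless_cycle (S := fun e => c e != 0) e0in ce0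
   (fun x e ein ce ex => cyc_leafless cc ein ce ex).
have [?|e0w] := boolP (e0 \in edges w); first by exists u, w.
have sub : {subset edges w <= pes Gm} by move=> e /inw[].
have [wc wE] := scw_wchain sw sub.
pose c' e := c e + wchain w e.
have c'E e : e \in pes Gm -> (c' e != 0) = (c e != 0) && (e \notin edges w).
  rewrite /c' wE; case: (boolP (e \in edges w)) => ew; rewrite /= ?addr0 ?andbT //.
  by have [_ /F2_neq0->] := inw _ ew; rewrite F2_dbl eqxx andbF.
have cnt : count (fun e => c e != 0) (pes Gm) =
    (count (fun e => c' e != 0%R) (pes Gm) + count (mem (edges w)) (pes Gm))%N.
  have disj : count (predI (fun e => c' e != 0%R) (mem (edges w))) (pes Gm) = 0%N.
    apply/eqP; rewrite -leqn0 leqNgt -has_count; apply/hasPn => e ein /=.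
    by rewrite c'E // -andbA andNb andbF.
  rewrite -count_predUI disj addn0.
  apply: eq_in_count => e ein /=; rewrite c'E //.
  case: (boolP (e \in edges w)) => ew; rewrite /= ?andbT ?orbF ?orbT //.
  by have [_ ->] := inw _ ew.
have wpos : (0 < count (mem (edges w)) (pes Gm))%N.
  rewrite -has_count; apply/hasP; case/and4P: (sw); case: (w) inw => // d p inw _ _ _ _.
  by exists d.1; [case: (inw d.1); rewrite ?inE ?eqxx|rewrite !inE eqxx].
have [||u' [w' [sw' ew' inw']]] := IH c' _ (cyc_add cc wc).
- by rewrite cnt ltnS in szn; apply: leq_trans szn; rewrite -addn1 leq_add2l.
- by rewrite c'E // ce0.
exists u', w'; split=> // e /inw'[ein]; rewrite c'E // => /andP[-> _]; by [].
Qed.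

End SimpleCycles.

(** * Betti number, weights and models *)

Section Weights.
Variables (R : realFieldType) (Gm : pgraph).
Notation E := (pE Gm).

(** Betti number at least [b], in a form that refers to closed chains only:
    vanishing on fewer than [b] edges cannot force a chain to vanish. *)
Definition betti_ge (A : pred E) (b : nat) : Prop :=
  forall F : seq E, (size F < b)%N -> exists c : E -> F2,
    [/\ cyc c, nonzero c &
        forall e, e \in pes Gm -> c e != 0 -> A e && (e \notin F)].

Definition wt (w : E -> R) (A : pred E) : R := \sum_(e <- pes Gm | A e) w e.

Definition normed (w : E -> R) (m : R) : Prop :=
  [/\ forall e, 0 <= w e, 0 <= m &
      forall c, cyc c -> nonzero c -> m <= wt w (fun e => c e != 0)].

Lemma wt_le w (A B : pred E) : (forall e, 0 <= w e) ->
  (forall e, e \in pes Gm -> A e -> B e) -> wt w A <= wt w B.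
Proof.
move=> w0 AB; rewrite /wt [leLHS]big_mkcond [leRHS]big_mkcond /=.
rewrite big_seq [leRHS]big_seq; apply: ler_sum => e ein.
by case: ifP => [/(AB _ ein) -> //|_]; case: ifP.
Qed.

Lemma wt_ge0 w (A : pred E) : (forall e, 0 <= w e) -> 0 <= wt w A.
Proof. by move=> w0; apply: sumr_ge0. Qed.

Lemma wt_count w (A : pred E) : wt w A = \sum_(e <- pes Gm) w e *+ A e.
Proof. by rewrite /wt big_mkcond; apply: eq_bigr => e _; case: (A e). Qed.

End Weights.

(** A finite graph in computational form: vertices are the numbers below [nv],
    and the [i]-th edge is the [i]-th pair of the list. *)
Record lgraph := LGraph { nv : nat; le : seq (nat * nat) }.

Definition lsrc H i := (nth (0, 0)%N (le H) i).1.
Definition ltgt H i := (nth (0, 0)%N (le H) i).2.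

Definition pg (H : lgraph) : pgraph :=
  PGraph (lsrc H) (ltgt H) (iota_uniq 0 (size (le H))).

Lemma in_iota0 n i : (i \in iota 0 n) = (i < n)%N.
Proof. by rewrite mem_iota. Qed.

Lemma count_mem_gt0 (T : eqType) (e : T) s : (0 < count_mem e s)%N = (e \in s).
Proof. by rewrite -has_pred1 has_count. Qed.

Section Models.
Variable Gm : pgraph.
Notation V := (pV Gm).
Notation E := (pE Gm).

Definition occ (H : lgraph) (P : nat -> seq (pdart Gm)) (e : E) : nat :=
  \sum_(i <- iota 0 (size (le H))) count_mem e (edges (P i)).

(** The graph [H] drawn inside [A]: vertices go to vertices and edges to
    trails that are pairwise edge-disjoint. Trails may be empty, because a
    graph with vertices of large degree is a degeneration of a cubic one; the
    last condition only asks that no closed chain of [H] is lost. It is what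
    makes the image of a closed chain nonzero, hence at least as heavy as the
    lightest cycle. *)
Record model (A : pred E) (H : lgraph) (h : nat -> V) (P : nat -> seq (pdart Gm))
    : Prop := Model {
  model_walk : forall i, (i < size (le H))%N ->
    walk (h (lsrc H i)) (P i) (h (ltgt H i));
  model_occ : forall e, (occ H P e <= (e \in pes Gm) && A e)%N;
  model_nondeg : forall c : nat -> F2, @cyc (pg H) c -> @nonzero (pg H) c ->
    exists i, [/\ (i < size (le H))%N, c i != 0 & P i != [::]] }.

Definition has_model A H := exists h P, model A H h P.

Definition push (H : lgraph) (P : nat -> seq (pdart Gm)) (c : nat -> F2) (e : E)
  : F2 := \sum_(i <- iota 0 (size (le H))) c i *+ count_mem e (edges (P i)).

Section OneModel.
Variables (A : pred E) (H : lgraph) (h : nat -> V) (P : nat -> seq (pdart Gm)).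
Hypothesis M : model A H h P.
Notation m := (size (le H)).

Lemma model_in i e : (i < m)%N -> e \in edges (P i) -> e \in pes Gm /\ A e.
Proof.
move=> im ei; suff: (0 < (e \in pes Gm) && A e)%N by rewrite lt0b => /andP.
apply: leq_trans (model_occ M e).
by rewrite /occ (bigD1_seq i) ?in_iota0 ?iota_uniq //= ltn_addr // count_mem_gt0.
Qed.

Lemma model_count i j e : (i < m)%N -> (j < m)%N -> e \in edges (P i) ->
  count_mem e (edges (P j)) = (i == j).
Proof.
move=> im jm ei; have := leq_trans (model_occ M e) (leq_b1 _).
have ci : (0 < count_mem e (edges (P i)))%N by rewrite count_mem_gt0.
rewrite /occ (bigD1_seq i) ?in_iota0 ?iota_uniq //=.
case: (i =P j) => [<-|/eqP ne]; first by lia.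
rewrite big_mkcond (bigD1_seq j) ?in_iota0 ?iota_uniq //= eq_sym ne; lia.
Qed.

Lemma push_trail c i e : (i < m)%N -> e \in edges (P i) -> push H P c e = c i.
Proof.
move=> im ei; rewrite /push (bigD1_seq i) ?in_iota0 ?iota_uniq //=.
rewrite (model_count im im ei) eqxx mulr1n big_seq_cond big1 ?addr0 // => j.
rewrite in_iota0 => /andP[jm ne].
by rewrite (model_count im jm ei) eq_sym (negPf ne) mulr0n.
Qed.

Lemma push_supp c e : push H P c e != 0 ->
  exists i, [/\ (i < m)%N, c i != 0 & e \in edges (P i)].
Proof.
move=> ne; have [/hasP[i]|/hasPn none] :=
    boolP (has (fun i => (c i != 0) && (e \in edges (P i))) (iota 0 m)).
  by rewrite in_iota0 => im /andP[? ?]; exists i.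
case/eqP: ne; rewrite /push big_seq big1 // => i /none; rewrite negb_and negbK.
case/orP=> [/eqP->|ni]; first by rewrite mul0rn.
by rewrite (count_memPn ni) mulr0n.
Qed.

(** The boundary of the image at [x] is the closed chain tested against the
    function that marks the vertices mapped to [x]. *)
Lemma push_cyc c : @cyc (pg H) c -> cyc (push H P c).
Proof.
move=> cc x; under eq_bigr do rewrite /push -sumrMnl.
rewrite exchange_big /=.
have := @cyc_test (pg H) c (fun v => (h v == x)%:R) cc; apply: etrans.
apply: eq_big_seq => i; rewrite in_iota0 => im.
have sub : {subset edges (P i) <= pes Gm} by move=> e /(model_in im)[].
rewrite -(walk_boundary x (model_walk M im)) -(sum_count _ (pes_uniq Gm) sub).
by rewrite mulr_sumr; apply: eq_bigr => e _; rewrite -!mulrnA mulr_natr mulnC.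
Qed.

Lemma push_nonzero c : @cyc (pg H) c -> @nonzero (pg H) c -> nonzero (push H P c).
Proof.
move=> cc nc; have [i [im ci]] := model_nondeg M cc nc.
case Pi : (P i) => [//|d p] _.
have di : d.1 \in edges (P i) by rewrite Pi inE eqxx.
by exists d.1; [case: (model_in im di)|rewrite (push_trail c im di)].
Qed.

Section Mu.
Variable (R : realFieldType) (w : E -> R).

Definition mu (Q : nat -> seq (pdart Gm)) (i : nat) : R :=
  \sum_(e <- edges (Q i)) w e.

Lemma wt_mu (S : pred nat) : @wt R (pg H) (mu P) S =
  \sum_(e <- pes Gm) w e *+ \sum_(i <- iota 0 m | S i) count_mem e (edges (P i)).
Proof.
under eq_bigr do rewrite -sumrMnr.
rewrite exchange_big /= /wt [LHS]big_seq_cond [RHS]big_seq_cond; apply: eq_bigr => i.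
rewrite in_iota0 => /andP[im _]; rewrite /mu sum_count ?pes_uniq //.
by move=> e /(model_in im)[].
Qed.

Lemma wt_mu_le : (forall e, 0 <= w e) -> @wt R (pg H) (mu P) predT <= wt w A.
Proof.
move=> w0; rewrite wt_mu wt_count big_seq [leRHS]big_seq; apply: ler_sum => e ein.
apply: ler_wpMn2l => //; have := model_occ M e; rewrite ein; exact.
Qed.

(** Giving each edge of [H] the weight of its trail preserves the lower bound
    for closed chains; by [wt_mu_le] the total weight does not increase. Lower
    bounds for the weight of [H] therefore transfer to [A]. *)
Lemma model_normed k : normed w k -> @normed R (pg H) (mu P) k.
Proof.
case=> w0 k0 wk; split=> // [i|c cc nc]; first by apply: sumr_ge0.
apply: le_trans (wk _ (push_cyc cc) (push_nonzero cc nc)) _.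
rewrite wt_mu wt_count; apply: ler_sum => e _; apply: ler_wpMn2l => //.
case: (boolP (push _ _ _ _ != 0)) => //= /push_supp[i [im ci ei]].
rewrite big_mkcond (bigD1_seq i) ?in_iota0 ?iota_uniq //= ci.
by rewrite ltn_addr // count_mem_gt0.
Qed.

End Mu.

Lemma model_sub (B : pred E) : (forall e, e \in pes Gm -> A e -> B e) -> model B H h P.
Proof.
move=> AB; case: M => Mw Mo Mn; split=> // e; apply: leq_trans (Mo e) _.
by case: (boolP (e \in pes Gm)) => //= ein; case: (boolP (A e)) => // /(AB _ ein)->.
Qed.

End OneModel.

End Models.

Section Composition.
Variable Gm : pgraph.
Notation V := (pV Gm).
Notation E := (pE Gm).

Definition compose (P : nat -> seq (pdart Gm)) (Q : seq (nat * bool)) :=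
  flatten [seq (if d.2 then P d.1 else wrev (P d.1)) | d <- Q].

Lemma count_compose P Q e : count_mem e (edges (compose P Q)) =
  \sum_(k <- map fst Q) count_mem e (edges (P k)).
Proof.
elim: Q => [|d Q IH] /=; first by rewrite big_nil.
rewrite /compose /= edges_cat count_cat -/(compose P Q) IH big_cons; congr addn.
by case: (d.2); rewrite ?count_edges_rev.
Qed.

(** Models compose, so an isomorphic copy or a minor of a modelled graph is
    modelled as well. Nondegeneracy passes through [push]: a closed chain of
    [H] becomes one of [K], which some nonempty trail of [K] carries. *)
Lemma model_comp A K h P B H h' P' : model A K h P -> @model (pg K) B H h' P' ->
  model A H (h \o h') (fun i => compose P (P' i)).
Proof.
move=> MK MH.
have lt_in i d : (i < size (le H))%N -> d \in P' i -> (d.1 < size (le K))%N.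
  move=> im din; have /(model_in MH im)[] : d.1 \in edges (P' i) by apply: map_f.
  by rewrite in_iota0.
split=> [i im|e|c cc nc].
- have := @model_walk _ _ _ _ _ MH i im; rewrite /=.
  move: (h' (lsrc H i)) (h' (ltgt H i)) => u v.
  have : all (fun d => d.1 < size (le K))%N (P' i).
    by apply/allP => d /(lt_in _ _ im).
  elim: (P' i) u => [|d Q IH] u /=; first by move=> _ /eqP->.
  case/andP=> dm Qm /andP[/eqP<- wQ].
  apply/walk_cat; exists (h (dend d)); split; last exact: IH.
  have wd := model_walk MK dm; rewrite /dstart /dend /=.
  by case: (d.2) => //; apply: walk_rev.
- apply: leq_trans (model_occ MK e); rewrite /occ.
  under eq_bigr do rewrite count_compose.
  have step : \sum_(i <- iota 0 (size (le H))) \sum_(k <- map fst (P' i))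
      count_mem e (edges (P k)) = \sum_(k <- iota 0 (size (le K)))
      count_mem e (edges (P k)) * @occ (pg K) H P' k.
    rewrite /occ; under [RHS]eq_bigr do rewrite big_distrr.
    rewrite [RHS]exchange_big; apply: eq_big_seq => i; rewrite in_iota0 => im.
    rewrite -(@sum_count (pg K) nat (iota 0 (size (le K)))) ?iota_uniq //.
      by apply: eq_bigr => k _; rewrite -mulr_natr natn.
    by move=> k /mapP[d din ->]; rewrite in_iota0 (lt_in _ _ im).
  rewrite step; apply: leq_sum => k _.
  rewrite -[leqRHS]muln1 leq_mul //; apply: leq_trans (@model_occ _ _ _ _ _ MH k) _.
  exact: leq_b1.
- have [k [km ck nk]] := model_nondeg MK (push_cyc MH cc) (push_nonzero MH cc nc).
  have [i [im ci /mapP[d din kd]]] := push_supp ck.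
  exists i; split=> //; apply: contra nk => /eqP Q0.
  have : size (compose P (P' i)) = 0%N by rewrite Q0.
  rewrite /compose; elim: (P' i) din => //= d' Q IH; rewrite inE size_cat.
  case/orP=> [/eqP<-|din']; last first.
    by move/eqP; rewrite addn_eq0 => /andP[_ /eqP]; apply: IH.
  move/eqP; rewrite addn_eq0 => /andP[+ _]; rewrite kd.
  by case: (d.2); rewrite ?size_rev ?size_map => /nilP->.
Qed.

Lemma has_model_comp (A : pred E) K B H : has_model A K -> @has_model (pg K) B H -> has_model A H.
Proof.
by move=> [h [P MK]] [h' [P' MH]]; eexists; eexists; apply: model_comp MK MH.
Qed.

End Composition.

(** * Subdividing an edge and adding an edge *)

Definition wf (H : lgraph) : bool :=
  all (fun e => (e.1 < nv H)%N && (e.2 < nv H)%N) (le H).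

(** The first half of the edge [i] keeps the index [i], the second half and
    the new vertex get the first free numbers. Thus subdividing again does not
    disturb the numbering, and an index always means the first half. *)
Definition subdiv (i : nat) (H : lgraph) : lgraph :=
  LGraph (nv H).+1
    (rcons (set_nth (0, 0)%N (le H) i (lsrc H i, nv H)) (nv H, ltgt H i)).

Definition add_edge (p q : nat) (H : lgraph) : lgraph :=
  LGraph (nv H) (rcons (le H) (p, q)).

(** The new edge joins a new vertex on [f] to a new vertex on [g]. If [f = g],
    the second point lies on the second half of the edge, which has the index
    [size (le H)]. *)
Definition insert (f g : nat) (H : lgraph) : lgraph :=
  add_edge (nv H) (nv H).+1
    (subdiv (if f == g then size (le H) else g) (subdiv f H)).

Lemma big_iotaS (T : Type) (idx : T) (op : Monoid.law idx) m (F : nat -> T) :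
  \big[op/idx]_(j <- iota 0 m.+1) F j = op (\big[op/idx]_(j <- iota 0 m) F j) (F m).
Proof. by rewrite -addn1 iotaD big_cat big_seq1. Qed.

Section ListOps.
Variables (H : lgraph).
Notation m := (size (le H)).

Lemma size_subdiv i : (i < m)%N -> size (le (subdiv i H)) = m.+1.
Proof. by move=> im; rewrite size_rcons size_set_nth (maxn_idPr im). Qed.

Lemma nth_subdiv i j : (i < m)%N -> nth (0, 0)%N (le (subdiv i H)) j =
  if j == i then (lsrc H i, nv H) else
  if j == m then (nv H, ltgt H i) else nth (0, 0)%N (le H) j.
Proof.
move=> im; rewrite /= nth_rcons size_set_nth (maxn_idPr im) nth_set_nth /=.
case: (j =P i) => [->|_]; first by rewrite im.
by case: ltngtP => // jm; rewrite nth_default // ltnW.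
Qed.

Lemma lsrc_subdiv i j : (i < m)%N -> lsrc (subdiv i H) j =
  if j == m then nv H else lsrc H j.
Proof.
move=> im; rewrite /lsrc nth_subdiv //; case: (j =P i) => [->|_].
  by rewrite (ltn_eqF im).
by case: (j =P m).
Qed.

Lemma ltgt_subdiv i j : (i < m)%N -> ltgt (subdiv i H) j =
  if j == i then nv H else if j == m then ltgt H i else ltgt H j.
Proof. by move=> im; rewrite /ltgt nth_subdiv //; do 2?case: (_ =P _). Qed.

Lemma wf_lt i : wf H -> (i < m)%N -> (lsrc H i < nv H)%N /\ (ltgt H i < nv H)%N.
Proof. by move=> /allP wH im; apply/andP; apply: wH; apply: mem_nth. Qed.

Lemma wfP : reflect (forall i, (i < m)%N -> (lsrc H i < nv H)%N /\ (ltgt H i < nv H)%N)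
  (wf H).
Proof.
apply: (iffP idP) => [wH i|wH]; first exact: wf_lt.
by apply/(all_nthP (0, 0)%N) => i im; apply/andP; apply: wH.
Qed.

Lemma lsrc_add p q j : lsrc (add_edge p q H) j =
  if (j < m)%N then lsrc H j else if j == m then p else 0%N.
Proof. by rewrite /lsrc nth_rcons; case: ltngtP. Qed.

Lemma ltgt_add p q j : ltgt (add_edge p q H) j =
  if (j < m)%N then ltgt H j else if j == m then q else 0%N.
Proof. by rewrite /ltgt nth_rcons; case: ltngtP. Qed.

End ListOps.

Lemma wf_subdiv H i : wf H -> (i < size (le H))%N -> wf (subdiv i H).
Proof.
move=> wH im; apply/wfP => j; rewrite size_subdiv // ltnS => jm.
have [ai bi] := wf_lt wH im.
rewrite lsrc_subdiv // ltgt_subdiv //=.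
case: (j =P size (le H)) => [->|/eqP ne].
  by rewrite eq_sym (ltn_eqF im); split=> //; apply: ltnW.
have jm' : (j < size (le H))%N by rewrite ltn_neqAle ne.
have [aj bj] := wf_lt wH jm'.
by case: (j == i); split=> //; apply: ltnW.
Qed.

Lemma wf_add H p q : wf H -> (p < nv H)%N -> (q < nv H)%N -> wf (add_edge p q H).
Proof. by move=> wH pH qH; rewrite /wf /= all_rcons /= pH qH. Qed.

Lemma wf_insert H f g : wf H -> (f < size (le H))%N -> (g < size (le H))%N ->
  wf (insert f g H).
Proof.
move=> wH fm gm; apply: wf_add => //=; rewrite ?ltnS //.
apply: wf_subdiv; first exact: wf_subdiv.
by rewrite size_subdiv //; case: eqP => // _; apply: ltnW.
Qed.

Lemma size_insert H f g : (f < size (le H))%N -> (g < size (le H))%N ->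
  size (le (insert f g H)) = (size (le H) + 3)%N.
Proof.
move=> fm gm; rewrite size_rcons size_subdiv size_subdiv ?addn3 //.
by case: eqP => // _; apply: ltnW.
Qed.

Section SubdivModel.
Variable Gm : pgraph.
Notation V := (pV Gm).
Notation E := (pE Gm).
Variables (A : pred E) (H : lgraph) (h : nat -> V) (P : nat -> seq (pdart Gm)).
Hypotheses (M : model A H h P) (wH : wf H).
Notation m := (size (le H)).

Definition h_subdiv (v : V) (x : nat) : V := if x == nv H then v else h x.
Definition P_subdiv i (X Y : seq (pdart Gm)) (j : nat) :=
  if j == i then X else if j == m then Y else P j.

Lemma occ_subdiv i X Y e : (i < m)%N -> P i = X ++ Y ->
  occ (subdiv i H) (P_subdiv i X Y) e = occ H P e.
Proof.
move=> im PXY; rewrite /occ size_subdiv // big_iotaS /= {2}/P_subdiv.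
rewrite (gtn_eqF im) eqxx (bigD1_seq i) ?in_iota0 ?iota_uniq //=.
rewrite [RHS](bigD1_seq i) ?in_iota0 ?iota_uniq //= /P_subdiv eqxx PXY.
rewrite edges_cat count_cat addnAC; congr addn.
rewrite big_seq_cond [RHS]big_seq_cond; apply: eq_bigr => j.
by rewrite in_iota0 => /andP[jm /negPf->]; rewrite (ltn_eqF jm).
Qed.

(** Tested at the new vertex, a closed chain has equal values on the two
    halves; identifying the new vertex with the end of the edge shows that the
    rest is closed in [H]. *)
Lemma cyc_subdiv i (c : nat -> F2) : (i < m)%N ->
  @cyc (pg (subdiv i H)) c -> @cyc (pg H) c /\ c m = c i.
Proof.
move=> im cc; have [ai bi] := wf_lt wH im.
have test (phi : nat -> F2) :
    \sum_(j <- iota 0 m) c j * (phi (lsrc H j) + phi (if j == i then nv H else ltgt H j))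
    + c m * (phi (nv H) + phi (ltgt H i)) = 0.
  rewrite -[RHS](@cyc_test (pg (subdiv i H)) c phi cc) /= size_subdiv // big_iotaS /=.
  rewrite lsrc_subdiv // ltgt_subdiv // eqxx (gtn_eqF im); congr (_ + _).
  apply: eq_big_seq => j; rewrite in_iota0 => jm.
  by rewrite lsrc_subdiv // ltgt_subdiv // (ltn_eqF jm).
split=> [x|].
  pose phi y : F2 := if y == nv H then (ltgt H i == x)%:R else (y == x)%:R.
  rewrite -[RHS](test phi) /= {3}/phi eqxx {3}/phi (ltn_eqF bi) F2_dbl mulr0 addr0.
  apply: eq_big_seq => j; rewrite in_iota0 => jm; have [aj bj] := wf_lt wH jm.
  rewrite /phi (ltn_eqF aj) /ends /= -[LHS]mulr_natr natrD; congr (_ * (_ + _)).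
  by case: (j =P i) => [->|_]; rewrite ?eqxx ?(ltn_eqF bj).
have := test (fun y => (y == nv H)%:R); rewrite eqxx (ltn_eqF bi) addr0 mulr1.
rewrite (bigD1_seq i) ?in_iota0 ?iota_uniq //= eqxx eqxx (ltn_eqF ai) add0r mulr1.
rewrite big_seq_cond big1 ?addr0 => [/F2_addr0_eq->//|j].
rewrite in_iota0 => /andP[jm /negPf->]; have [aj bj] := wf_lt wH jm.
by rewrite (ltn_eqF aj) (ltn_eqF bj) addr0 mulr0.
Qed.

(** Cut the trail of [i] at a vertex [v] on it. Either half may be empty, for
    [v] may be an end of the trail, but not both if the trail was nonempty: a
    chain through [i] still sees a nonempty trail. *)
Lemma model_subdiv i v X Y : (i < m)%N -> P i = X ++ Y ->
  walk (h (lsrc H i)) X v -> walk v Y (h (ltgt H i)) ->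
  model A (subdiv i H) (h_subdiv v) (P_subdiv i X Y).
Proof.
move=> im PXY wX wY; have [ai bi] := wf_lt wH im; split.
- move=> j; rewrite size_subdiv // ltnS => jm.
  rewrite lsrc_subdiv // ltgt_subdiv // /P_subdiv /h_subdiv.
  case: (j =P i) => [->|/eqP ji].
    by rewrite eqxx (ltn_eqF im) (ltn_eqF ai).
  case: (j =P m) => [_|/eqP jm']; first by rewrite eqxx (ltn_eqF bi).
  have {jm'}jm : (j < m)%N by rewrite ltn_neqAle jm' jm.
  have [aj bj] := wf_lt wH jm.
  by rewrite (ltn_eqF aj) (ltn_eqF bj); apply: (model_walk M).
- by move=> e; rewrite (occ_subdiv e im PXY); apply: (model_occ M).
- move=> c cc [j]; rewrite /= size_subdiv // in_iota0 => jm cj.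
  have [cH cmi] := cyc_subdiv im cc.
  have nH : @nonzero (pg H) c.
    move: jm cj; rewrite ltnS leq_eqVlt => /orP[/eqP->|jm] cj.
      by exists i; [rewrite in_iota0|rewrite -cmi].
    by exists j => //; rewrite in_iota0.
  have [k [km ck Pk]] := model_nondeg M cH nH.
  have [ki|/eqP ki] := k =P i; last first.
    by exists k; split; [exact: ltnW|by []|rewrite /P_subdiv (negPf ki) (ltn_eqF km)].
  move: Pk; rewrite ki PXY; case EX: X => [|d X'] /= Pk; last first.
    by exists i; split; [exact: ltnW|rewrite -ki|rewrite /P_subdiv eqxx].
  exists m; split; [by []|by rewrite cmi -ki|].
  by rewrite /P_subdiv (gtn_eqF im) eqxx.
Qed.

Definition P_add (W : seq (pdart Gm)) (j : nat) := if j == m then W else P j.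

Lemma occ_add p q W e : occ (add_edge p q H) (P_add W) e =
  (occ H P e + count_mem e (edges W))%N.
Proof.
rewrite /occ size_rcons big_iotaS /= {2}/P_add eqxx; congr addn.
apply: eq_big_seq => j; rewrite in_iota0 => jm.
by rewrite /P_add (ltn_eqF jm).
Qed.

Lemma cyc_add_edge p q c : c m = 0 -> @cyc (pg (add_edge p q H)) c -> @cyc (pg H) c.
Proof.
move=> cm cc x; rewrite -[RHS](cc x) /= size_rcons big_iotaS /= cm mul0rn addr0.
apply: eq_big_seq => j; rewrite in_iota0 => jm.
by rewrite /ends /= lsrc_add ltgt_add jm.
Qed.

(** A closed chain that vanishes on the new edge is closed in [H]; on any
    other the new, nonempty, trail is seen. *)
Lemma model_add p q W : W != [::] -> walk (h p) W (h q) ->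
  (forall e, (occ H P e + count_mem e (edges W) <= (e \in pes Gm) && A e)%N) ->
  model A (add_edge p q H) h (P_add W).
Proof.
move=> W0 wW oW; split.
- move=> j; rewrite size_rcons ltnS leq_eqVlt lsrc_add ltgt_add /P_add.
  case: (j =P m) => [-> _|_ /= jm]; first by rewrite ltnn.
  by rewrite jm; apply: (model_walk M).
- by move=> e; rewrite occ_add.
- move=> c cc [j]; rewrite /= size_rcons in_iota0 => jm cj.
  have [cm0|cm0] := eqVneq (c m) 0; last first.
    by exists m; split; rewrite // /P_add eqxx.
  have nH : @nonzero (pg H) c.
    exists j => //; rewrite in_iota0.
    by move: jm; rewrite ltnS leq_eqVlt => /orP[/eqP jm|//]; rewrite jm cm0 eqxx in cj.
  have [k [km ck Pk]] := model_nondeg M (cyc_add_edge cm0 cc) nH.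
  by exists k; split; [exact: ltnW|by []|rewrite /P_add (ltn_eqF km)].
Qed.

End SubdivModel.

(** * Ears *)

Section Ears.
Variable Gm : pgraph.
Notation V := (pV Gm).
Notation E := (pE Gm).

Lemma walk_split u (p : seq (pdart Gm)) v x : walk u p v ->
  x \in u :: map (@dend Gm) p ->
  exists X Y, [/\ p = X ++ Y, walk u X x & walk x Y v].
Proof.
elim: p u => [|d p IH] u /=.
  by move=> /eqP<-; rewrite inE => /eqP->; exists [::], [::]; rewrite /= eqxx.
move=> /andP[/eqP du wp]; rewrite inE => /orP[/eqP->|xp].
  by exists [::], (d :: p); rewrite /= du eqxx wp.
have [X [Y [-> wX wY]]] := IH _ wp xp.
by exists (d :: X), Y; rewrite /= du eqxx wX.
Qed.

Lemma walk_last u (p : seq (pdart Gm)) v : walk u p v -> v \in u :: map (@dend Gm) p.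
Proof.
elim: p u => [|d p IH] u /=; first by move/eqP->; rewrite inE.
by move=> /andP[_ /IH vp]; rewrite inE vp orbT.
Qed.

(** Cut the walk at its last visit to [Z] before [e0] and at its first visit
    after it. *)
Lemma sub_ear (Z : pred V) e0 p W q : walk p W q -> Z p -> Z q -> e0 \in edges W ->
  exists W1 W2 W3 p' q', [/\ W = W1 ++ W2 ++ W3, walk p' W2 q', Z p' && Z q',
    e0 \in edges W2 & forall d : pdart Gm, d \in behead W2 -> ~~ Z (dstart d)].
Proof.
have [n] := ubnP (size W); elim: n W p q => // n IH W p q szW wW Zp Zq eW.
have [/hasP[d dW Zd]|/hasPn none] := boolP (has (fun d => Z (dstart d)) (behead W));
    last by exists [::], W, [::], p, q; rewrite cats0 Zp Zq.
have [d0 [B1 [B2 EW]]] : exists d0 B1 B2, W = (d0 :: B1) ++ (d :: B2).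
  case: (W) dW => //= d0 W' /splitPr[B1 B2].
  by exists d0, B1, B2.
move: wW eW szW; rewrite EW edges_cat size_cat mem_cat => /walk_cat[x [wX wY]].
have dx : dstart d = x by case/andP: wY => /eqP.
move=> /orP[eX|eY] szW; rewrite ltnS in szW.
  have [||W1 [W2 [W3 [p' [q' [E1 ? ? ? ?]]]]]] := IH _ _ _ _ wX Zp _ eX.
  - by apply: leq_trans szW; rewrite /= addnS ltnS leq_addr.
  - by rewrite -dx.
  by exists W1, W2, (W3 ++ d :: B2), p', q'; rewrite E1 -!catA.
have [||W1 [W2 [W3 [p' [q' [E1 ? ? ? ?]]]]]] := IH _ _ _ _ wY _ Zq eY.
- by apply: leq_trans szW; rewrite addSn ltnS leq_addl.
- by rewrite -dx.
by exists ((d0 :: B1) ++ W1), W2, W3, p', q'; rewrite E1 -!catA.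
Qed.

Variables (A : pred E) (H : lgraph) (h : nat -> V) (P : nat -> seq (pdart Gm)).
Hypotheses (M : model A H h P) (wH : wf H).
Notation m := (size (le H)).

Definition on_model (x : V) : bool :=
  has (fun i => x \in h (lsrc H i) :: map (@dend Gm) (P i)) (iota 0 m).

Lemma occ_on_model (d : pdart Gm) : occ H P d.1 != 0%N ->
  on_model (dstart d) /\ on_model (dend d).
Proof.
move=> od; have [/hasP[i]|/hasPn none] :=
    boolP (has (fun i => d.1 \in edges (P i)) (iota 0 m)); last first.
  case/eqP: od; rewrite /occ big_seq big1 // => i /none ni.
  by rewrite (count_memPn ni).
rewrite in_iota0 => im /mapP[d' d'in Ed].
suff : on_model (dstart d') /\ on_model (dend d').
  rewrite /dstart /dend -Ed; case: (d.2); case: (d'.2) => -[? ?]; split=> //.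
have [X [Y PE]] : exists X Y, P i = X ++ d' :: Y.
  by case/splitPr: d'in => X Y; exists X, Y.
have := model_walk M im; rewrite PE => /walk_cat[x [wX /= /andP[/eqP dx _]]].
split; apply/hasP; exists i; rewrite ?in_iota0 // PE map_cat inE mem_cat.
  by move: (walk_last wX); rewrite -dx inE => /orP[->//|->]; rewrite orbT.
by rewrite inE eqxx !orbT.
Qed.

(** The ends may coincide and may lie anywhere on the model, at a vertex or
    inside a trail. Inner vertices avoid the model, and all starting points of
    the darts differ. *)
Definition ear (W : seq (pdart Gm)) (p q : V) : Prop :=
  [/\ [/\ W != [::], walk p W q, on_model p & on_model q],
      uniq (edges W), uniq (map (@dstart Gm) W),
      forall d, d \in behead W -> ~~ on_model (dstart d) &
      forall e, e \in edges W -> occ H P e = 0%N].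

(** A cycle that touches the model can be cut at a vertex of the model, and
    then the part around [e0] is an ear. The ear uses no edge of the model,
    for both ends of such an edge are on the model, which leaves only [e0]
    itself. *)
Lemma scw_ear u w e0 : scw u w -> e0 \in edges w -> occ H P e0 = 0%N ->
  (forall e, e \in edges w -> occ H P e = 0%N) \/
  exists W p q, [/\ ear W p q, {subset edges W <= edges w} & e0 \in edges W].
Proof.
move=> /and4P[w0 wu us ue] e0w oe0.
have [/hasP[d dw Zd]|/hasPn none] := boolP (has (fun d => on_model (dstart d)) w);
    [right|left]; last first.
  move=> e /mapP[d dw Ee]; apply/eqP/negPn/negP; rewrite Ee => /occ_on_model[Zd _].
  by have := none _ dw; rewrite Zd.
have [B1 [B2 Ew]] : exists B1 B2, w = B1 ++ d :: B2.
  by case/splitPr: dw => X Y; exists X, Y.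
have [wr pr] : walk (dstart d) ((d :: B2) ++ B1) (dstart d) /\
    perm_eq ((d :: B2) ++ B1) w.
  split; last by rewrite Ew perm_catC.
  move: wu; rewrite Ew => /walk_cat[x [wX wY]]; apply/walk_cat; exists u.
  by have dx : dstart d = x by [case/andP: wY => /eqP]; rewrite dx.
have e0r : e0 \in edges ((d :: B2) ++ B1) by rewrite (perm_mem (perm_map _ pr)).
have [W1 [W2 [W3 [p [q [EW wW /andP[Zp Zq] e0W inner]]]]]] := sub_ear wr Zd Zd e0r.
rewrite EW in pr; exists W2, p, q; split=> //; last first.
  move=> e eW; rewrite -(perm_mem (perm_map _ pr)) -/(edges _) !edges_cat !mem_cat.
  by rewrite eW orbT.
have W20 : W2 != [::] by case: (W2) e0W.
split=> //.
- move: ue; rewrite -(perm_uniq (perm_map _ pr)) -/(edges _) !edges_cat !cat_uniq.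
  by move=> /and3P[_ _ /and3P[]].
- move: us; rewrite -(perm_uniq (perm_map _ pr)) !map_cat !cat_uniq.
  by move=> /and3P[_ _ /and3P[]].
move=> e /mapP[d1 d1W ->]; apply/eqP/negPn/negP => od.
have [Z1 Z2] := occ_on_model od.
case: W2 W20 wW e0W inner d1W {EW pr} => // d2 W2 _ wW e0W inner.
have notin : d1 \notin W2 by apply/negP => d1W; have := inner d1 d1W; rewrite Z1.
rewrite inE (negPf notin) orbF => /eqP d12.
case: W2 wW e0W inner notin => [|d3 W2] wW e0W inner _.
  by move: e0W od; rewrite inE => /eqP e02; rewrite d12 -e02 oe0.
by have := inner d3 (mem_head _ _); case/and3P: wW => _ /eqP-> _; rewrite -d12 Z2.
Qed.

End Ears.

(** * Inserting an ear *)

Section EarInsertion.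
Variable Gm : pgraph.
Notation V := (pV Gm).
Notation E := (pE Gm).
Variables (A : pred E) (H : lgraph) (h : nat -> V) (P : nat -> seq (pdart Gm)).
Hypotheses (M : model A H h P) (wH : wf H).
Notation m := (size (le H)).

Definition split_at (i : nat) (x : V) X Y :=
  [/\ (i < m)%N, P i = X ++ Y, walk (h (lsrc H i)) X x & walk x Y (h (ltgt H i))].

Definition extends (W : seq (pdart Gm)) (K : lgraph) : Prop :=
  exists h' P', model A K h' P' /\
    forall e, occ K P' e = (occ H P e + count_mem e (edges W))%N.

(** Cut the trails at the two attaching points and add the ear. When both
    points lie on the same trail, they have to come in the order of the trail,
    as the second cut is made in the second half. *)
Lemma insert_ordered f g p q X1 Y1 X2 Y2 W :
  W != [::] -> walk p W q ->
  (forall e, (occ H P e + count_mem e (edges W) <= (e \in pes Gm) && A e)%N) ->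
  split_at f p X1 Y1 -> split_at g q X2 Y2 ->
  (f < g)%N || (f == g) && (size X1 <= size X2)%N ->
  extends W (insert f g H).
Proof.
move=> W0 wW oW [fm Pf wX1 wY1] [gm Pg wX2 wY2] fg.
have M1 := model_subdiv M wH fm Pf wX1 wY1.
have wf1 := wf_subdiv wH fm.
pose g' := if f == g then m else g.
have g'm : (g' < size (le (subdiv f H)))%N.
  by rewrite size_subdiv // /g'; case: ifP => // _; apply: ltnW.
have [X2' [Pg' wX2' wY2']] : exists X2',
   [/\ P_subdiv H P f X1 Y1 g' = X2' ++ Y2,
       walk (h_subdiv H h p (lsrc (subdiv f H) g')) X2' q &
       walk q Y2 (h_subdiv H h p (ltgt (subdiv f H) g'))].
  rewrite lsrc_subdiv // ltgt_subdiv // /P_subdiv /h_subdiv /g'.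
  case: eqP fg => [efg|/eqP nfg] /=.
    rewrite efg ltnn eqxx /= (gtn_eqF gm) => sX; subst g.
    have [af bf] := wf_lt wH fm.
    have EX : X2 = X1 ++ drop (size X1) X2.
      rewrite -{1}(cat_take_drop (size X1) X2); congr (_ ++ _).
      have := congr1 (take (size X1)) (etrans (esym Pf) Pg).
      by rewrite take_size_cat // takel_cat.
    (* The second cut of the same trail cuts its second half [Y1], and the part
       of [X2] beyond [X1] is what lies before it. *)
    exists (drop (size X1) X2); rewrite ?eqxx (ltn_eqF bf); split=> //.
      have := etrans (esym Pf) Pg; rewrite {1}EX -catA => /eqP.
      by rewrite eqseq_cat // eqxx /= => /eqP.
    move: wX2; rewrite {1}EX => /walk_cat[x [w1 w2]].
    by rewrite (walk_det wX1 w1).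
  rewrite orbF => _; rewrite eq_sym (negPf nfg) (ltn_eqF gm).
  have [ag bg] := wf_lt wH gm.
  by rewrite (ltn_eqF ag) (ltn_eqF bg); exists X2.
have M2 := model_subdiv M1 wf1 g'm Pg' wX2' wY2'.
have o2 e : occ (subdiv g' (subdiv f H))
    (P_subdiv (subdiv f H) (P_subdiv H P f X1 Y1) g' X2' Y2) e = occ H P e.
  by rewrite (occ_subdiv e g'm Pg') (occ_subdiv e fm Pf).
do 2!eexists; split; first apply: (model_add M2 (W := W) (p := nv H) (q := (nv H).+1) W0).
- by rewrite /h_subdiv /= (ltn_eqF (ltnSn _)) !eqxx.
- by move=> e; rewrite o2.
by move=> e; rewrite occ_add o2.
Qed.

Lemma on_model_split x : on_model H h P x -> exists i X Y, split_at i x X Y.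
Proof.
move=> /hasP[i]; rewrite in_iota0 => im /(walk_split (model_walk M im)).
by move=> [X [Y [? ? ?]]]; exists i, X, Y.
Qed.

(** If the attaching points are in the wrong order, reverse the ear. *)
Lemma ear_insert W p q : ear H h P W p q ->
  (forall e, e \in edges W -> e \in pes Gm /\ A e) ->
  exists f g, [/\ (f <= g)%N, (g < m)%N & extends W (insert f g H)].
Proof.
move=> [[W0 wW Zp Zq] uW _ _ oW] inA.
have oA e : (occ H P e + count_mem e (edges W) <= (e \in pes Gm) && A e)%N.
  rewrite count_uniq_mem //; case: (boolP (e \in edges W)) => [eW|_].
    by rewrite oW //; case: (inA e eW) => -> ->.
  by rewrite addn0; apply: (model_occ M).
have [f [X1 [Y1 Sf]]] := on_model_split Zp.
have [g [X2 [Y2 Sg]]] := on_model_split Zq.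
have [fg|gf] := boolP ((f < g)%N || (f == g) && (size X1 <= size X2)%N).
  exists f, g; split; first by case/orP: fg => [/ltnW//|/andP[/eqP->]].
    by case: Sg.
  exact: insert_ordered Sf Sg fg.
have [gf1 gf2] : (g <= f)%N /\ (g < f)%N || (g == f) && (size X2 <= size X1)%N.
  move: gf; rewrite negb_or -leqNgt negb_and => /andP[gf].
  rewrite gf eq_sym; case: eqP => [->|/eqP ne] /=.
    by rewrite ltnn -ltnNge => /ltnW ->.
  by rewrite orbF ltn_neqAle ne gf.
exists g, f; split=> //; first by case: Sf.
have [||h' [P' [M' o']]] := @insert_ordered _ _ _ _ _ _ _ _ (wrev W) _ (walk_rev wW) _ Sg Sf gf2.
- by rewrite -size_eq0 size_rev size_map size_eq0.
- by move=> e; rewrite count_edges_rev.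
by exists h', P'; split=> // e; rewrite o' count_edges_rev.
Qed.

End EarInsertion.

(** The inner vertices of an ear meet no other edge of the support, so a closed
    chain is constant along the ear: one coordinate determines it there. *)
Lemma ear_const (Gm : pgraph) (Z : pred (pV Gm)) p (W : seq (pdart Gm)) q d0 W'
    (c : pE Gm -> F2) :
  walk p W q -> Z q -> uniq (edges W) -> uniq (map (@dstart Gm) W) ->
  (forall d, d \in behead W -> ~~ Z (dstart d)) -> W = d0 :: W' ->
  {subset edges W <= pes Gm} -> cyc c ->
  (forall e, e \in pes Gm -> c e != 0 -> e \notin edges W ->
     Z (psrc e) /\ Z (ptgt e)) ->
  c d0.1 = 0 -> forall e, e \in edges W -> c e = 0.
Proof.
move=> wW Zq uE uS inner EW sub cc supp c0.
suff claim W1 d1 d2 W2 : W = W1 ++ d1 :: d2 :: W2 -> c d1.1 = c d2.1.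
  suff H1 n W1 d W2 : size W1 = n -> W = W1 ++ d :: W2 -> c d.1 = 0.
    move=> e /mapP[d dW ->].
    by case/splitPr: dW H1 => W1 W2 H1; apply: (H1 _ W1 d W2).
  elim: n W1 d W2 => [|n IH] W1 d W2.
    by case: W1 => // _; rewrite EW => -[<-].
  case/lastP: W1 => // W1 d1; rewrite size_rcons => -[sz].
  rewrite cat_rcons => EW1; rewrite -(claim _ _ _ _ EW1); exact: IH sz EW1.
move=> E12; pose x := dstart d2.
have d1x : dend d1 = x.
  by move: wW; rewrite E12 => /walk_cat[z [_ /= /and3P[_ /eqP<- _]]].
have xinner : ~~ Z x.
  by apply: inner; rewrite E12; case: (W1) => [|a B] /=;
    rewrite ?mem_cat !inE eqxx ?orbT.
(* At an inner vertex the boundary of [c] only sees the ear, on which exactly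
   one dart starts there and one ends there. *)
have key : \sum_(e <- pes Gm) c e *+ ends e x =
    \sum_(d <- W) c d.1 *+ ((dstart d == x) + (dend d == x)).
  under [RHS]eq_bigr do rewrite -ends_dart.
  rewrite -[RHS](big_map fst predT (fun e => c e *+ ends e x)) -/(edges W).
  rewrite -(sum_count _ (pes_uniq Gm) sub); apply: eq_big_seq => e ein.
  rewrite count_uniq_mem //; case: (boolP (e \in edges W)) => eW; first by [].
  rewrite mulr0n; have [->|ce] := eqVneq (c e) 0; first by rewrite mul0rn.
  have [Z1 Z2] := supp e ein ce eW.
  rewrite /ends; case: (psrc e =P x) => [Ex|_].
    by rewrite -Ex Z1 in xinner.
  by case: (ptgt e =P x) => [Ex|_]; rewrite ?mulr0n // -Ex Z2 in xinner.
have := cc x; rewrite key; under eq_bigr do rewrite mulrnDr.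
rewrite big_split /=.
have starts : \sum_(d <- W) c d.1 *+ (dstart d == x) = c d2.1.
  have d2W : d2 \in W by rewrite E12 mem_cat !inE eqxx !orbT.
  rewrite (bigD1_seq d2) ?(map_uniq uS) //= eqxx mulr1n big_seq_cond big1 ?addr0 //.
  move=> d /andP[dW ne]; case: eqP => [dx|_]; last by rewrite mulr0n.
  by case/eqP: ne; apply: (uniq_map_inj uS).
have stops : \sum_(d <- W) c d.1 *+ (dend d == x) = c d1.1.
  have d1W : d1 \in W by rewrite E12 mem_cat !inE eqxx !orbT.
  rewrite (bigD1_seq d1) ?(map_uniq uS) //= d1x eqxx mulr1n big_seq_cond big1 ?addr0 //.
  move=> d /andP[dW ne]; case: eqP => [dx|_]; last by rewrite mulr0n.
  exfalso; case/splitPr: dW wW E12 uS => B1 B2 wW E12 uS.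
  case: B2 wW E12 uS => [|d3 B2] wW E12 uS.
    move: wW => /walk_cat[z [_ /= /andP[_ /eqP Eq]]].
    by rewrite -dx Eq Zq in xinner.
  have d3x : dstart d3 = x.
    by move: wW => /walk_cat[z [_ /= /and3P[_ /eqP-> _]]].
  have d32 : d3 = d2.
    apply: (uniq_map_inj uS) => //; first by rewrite mem_cat !inE eqxx !orbT.
    by rewrite E12 mem_cat !inE eqxx !orbT.
  have uW := map_uniq uS.
  have idx : index d2 (rcons B1 d ++ d2 :: B2) = index d2 (rcons W1 d1 ++ d2 :: W2).
    by rewrite !cat_rcons -E12 d32.
  have notin s t : uniq (s ++ d2 :: t) -> d2 \notin s.
    by rewrite cat_uniq /= negb_or => /and3P[_ /andP[]].
  move: idx; rewrite !index_cat (negPf (notin _ B2 _)); last first.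
    by rewrite cat_rcons -d32.
  rewrite (negPf (notin _ W2 _)); last by rewrite cat_rcons -E12.
  rewrite /= eqxx !addn0 => sz.
  have : rcons B1 d ++ d2 :: B2 = rcons W1 d1 ++ d2 :: W2.
    by rewrite !cat_rcons -E12 d32.
  by move/eqP; rewrite eqseq_cat // => /andP[/eqP/rcons_inj[_ dd1] _]; case/eqP: ne.
by rewrite starts stops => /F2_addr0_eq.
Qed.

(** * Counting closed chains *)

Lemma big_iota_ord (T : Type) (idx : T) (op : Monoid.law idx) n (F : nat -> T) :
  \big[op/idx]_(i <- iota 0 n) F i = \big[op/idx]_(i < n) F i.
Proof. by rewrite -(big_mkord xpredT) /index_iota subn0. Qed.

(** The boundary conditions at the vertices add up to zero, because each edge has
    two ends. So closedness and vanishing on [F] together have rank at most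
    [nv H - 1 + size F], which is less than the number of edges. *)
Lemma betti_ge_euler H k : wf H -> (0 < nv H)%N -> (nv H + k <= (size (le H)).+1)%N ->
  betti_ge (Gm := pg H) predT k.
Proof.
move=> wH n0 szH F szF; set n := nv H in n0 szH *; set m := size (le H) in szH *.
pose B1 : 'M[F2]_(m, n) := \matrix_(i < m, v < n) (@ends (pg H) i v)%:R.
pose B2 : 'M[F2]_(m, size F) := \matrix_(i < m, j < size F) (i == nth m F j :> nat)%:R.
pose B := row_mx B1 B2.
pose z : 'cV[F2]_(n + size F) := col_mx (const_mx 1) 0.
have Bz : B *m z = 0.
  rewrite mul_row_col mulmx0 addr0; apply/matrixP => i j; rewrite !mxE.
  have [ai bi] := wf_lt wH (ltn_ord i).
  under eq_bigr do rewrite !mxE mulr1 natrD.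
  rewrite big_split /= (bigD1 (Ordinal ai)) //= eqxx big1 ?addr0; last first.
    by move=> v; rewrite -val_eqE eq_sym /= => /negPf->.
  rewrite (bigD1 (Ordinal bi)) //= eqxx big1 ?addr0 ?F2_dbl //.
  by move=> v; rewrite -val_eqE eq_sym /= => /negPf->.
have nfull : ~~ row_full B.
  apply/negP => /row_fullP[B' B'B].
  have : z = 0 by rewrite -[z]mul1mx -B'B -mulmxA Bz mulmx0.
  by move/matrixP/(_ (lshift _ (Ordinal n0)) 0); rewrite col_mxEu !mxE => /eqP.
have nfree : ~~ row_free B.
  rewrite /row_free neq_ltn; apply/orP; left.
  have : (\rank B < n + size F)%N by rewrite ltn_neqAle -/(row_full B) nfull rank_leq_col.
  by move=> H1; lia.
have /rowV0Pn[u /sub_kermxP uB u0] : kermx B != 0 by rewrite kermx_eq0.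
pose c i : F2 := if insub i is Some j then u 0 j else 0.
have cE (i : 'I_m) : c i = u 0 i by rewrite /c valK.
have uB1 : u *m B1 = 0 by have := uB; rewrite mul_mx_row -[0]row_mx0 => /eq_row_mx[].
have uB2 : u *m B2 = 0 by have := uB; rewrite mul_mx_row -[0]row_mx0 => /eq_row_mx[].
exists c; split.
- move=> x; rewrite /= big_iota_ord /=; under eq_bigr do rewrite cE.
  have [xn|nx] := ltnP x n.
    have /matrixP/(_ 0 (Ordinal xn)) := uB1; rewrite !mxE => e0; apply: etrans e0.
    by apply: eq_bigr => i _; rewrite mxE mulr_natr.
  rewrite big1 // => i _; have [ai bi] := wf_lt wH (ltn_ord i).
  by rewrite /ends /= !ltn_eqF ?mulr0n //; apply: leq_trans nx.
- have /rV0Pn[i ui] := u0; exists (i : nat); first by rewrite in_iota0.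
  by rewrite cE.
- move=> i; rewrite in_iota0 => im ci; apply/negP => iF.
  case/eqP: ci; rewrite (cE (Ordinal im)).
  have jF : (index i F < size F)%N by rewrite index_mem.
  have /matrixP/(_ 0 (Ordinal jF)) := uB2; rewrite !mxE => e0; rewrite -[RHS]e0.
  rewrite (bigD1 (Ordinal im)) //= mxE /= nth_index // eqxx mulr1 big1 ?addr0 //.
  by move=> j; rewrite -val_eqE mxE /= nth_index // => /negPf->; rewrite mulr0.
Qed.

(** Each edge of [F] lies on at most one trail, so that avoiding [F] amounts
    to avoiding that many edges of [H]. *)
Lemma betti_ge_model (Gm : pgraph) (A : pred (pE Gm)) H h P k : model A H h P ->
  betti_ge (Gm := pg H) predT k -> betti_ge (fun e => occ H P e != 0%N) k.
Proof.
move=> M bH F szF; set m := size (le H).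
pose S i := has (fun e => e \in F) (edges (P i)).
have szS : (size [seq i <- iota 0 m | S i] <= size F)%N.
  apply: leq_trans (size_undup F).
  have : (\sum_(e <- undup F) occ H P e <= size (undup F))%N.
    rewrite -sum1_size; apply: leq_sum => e _.
    by apply: leq_trans (model_occ M e) (leq_b1 _).
  apply: leq_trans; rewrite /occ exchange_big /= -sum1_size big_filter big_mkcond /=.
  apply: leq_sum => i _; case: ifP => // /hasP[e ei eF].
  rewrite (bigD1_seq e) ?undup_uniq ?mem_undup //= ltn_addr //.
  by rewrite count_mem_gt0.
have [c [cc nc cF]] := bH _ (leq_ltn_trans szS szF).
exists (push H P c); split; [exact: push_cyc M _ cc|exact: push_nonzero M _ cc nc|].
move=> e _ /push_supp[i [im ci ei]]; apply/andP; split.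
  rewrite -lt0n /occ (bigD1_seq i) ?in_iota0 ?iota_uniq //= ltn_addr //.
  by rewrite count_mem_gt0.
have := cF i; rewrite in_iota0 => /(_ im ci); rewrite mem_filter in_iota0 im andbT.
by move=> /hasPn/(_ _ ei).
Qed.

(** The upper counterpart of [betti_ge]: the closed chains supported in [U] are
    determined by [k] coordinates, so their space has dimension at most [k]. *)
Definition determined (Gm : pgraph) (U : pred (pE Gm)) (k : nat) : Prop :=
  exists2 F : seq (pE Gm), (size F <= k)%N &
  forall c, cyc c -> (forall e, e \in pes Gm -> c e != 0 -> U e) ->
    (forall e, e \in pes Gm -> e \in F -> c e = 0) ->
    forall e, e \in pes Gm -> c e = 0.

Section EarStep.
Variables (Gm : pgraph) (A B : pred (pE Gm)) (H : lgraph).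
Variables (h : nat -> pV Gm) (P : nat -> seq (pdart Gm)).
Hypotheses (M : model B H h P) (wH : wf H).
Hypothesis BA : forall e, e \in pes Gm -> B e -> A e.
Notation m := (size (le H)).

(** The chain [c] yields a cycle in [A] through [e0], an edge outside the
    model. If the cycle misses the model, its weight comes on top of that of
    the model; if not, it contains an ear. *)
Lemma ear_step (R : realFieldType) (w : pE Gm -> R) (k : R) c e0 :
  normed w k -> cyc c -> e0 \in pes Gm -> c e0 != 0 -> ~~ B e0 ->
  (forall e, e \in pes Gm -> c e != 0 -> A e) ->
  @wt R (pg H) (mu w P) predT + k <= wt w A \/
  exists f g, [/\ (f <= g)%N, (g < m)%N & has_model A (insert f g H)].
Proof.
move=> wk cc e0in ce0 nB cA.
have MA := model_sub M BA.
have [u [W [sW e0W inW]]] := cyc_through cc e0in ce0.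
have o0 : occ H P e0 = 0%N.
  by apply/eqP; rewrite -leqn0; apply: leq_trans (model_occ M e0) _; rewrite (negPf nB) andbF.
have subW : {subset edges W <= pes Gm} by move=> e /inW[].
case: (scw_ear M sW e0W o0) => [disj|[Y [p [q [eY sub _]]]]]; last first.
  have [|f [g [fg gm [h' [P' [M' _]]]]]] := @ear_insert _ A H h P MA wH Y p q eY.
    by move=> e /sub/inW[ein ce]; split=> //; apply: cA.
  by right; exists f, g; split=> //; exists h', P'.
left; have [wc wE] := scw_wchain sW subW; case: wk => w0 k0 wk.
have kW : k <= \sum_(e <- pes Gm) w e *+ (e \in edges W).
  have nW : nonzero (wchain W) by exists e0 => //; rewrite wE e0W.
  apply: le_trans (wk _ wc nW) _; rewrite wt_count.
  by apply: ler_sum => e _; rewrite wE; case: (e \in edges W).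
rewrite (wt_mu M) wt_count; apply: le_trans (lerD (lexx _) kW) _.
rewrite -big_split /= big_seq [leRHS]big_seq; apply: ler_sum => e ein.
rewrite -mulrnDr; apply: ler_wpMn2l => //.
have [eW|_] := boolP (e \in edges W).
  rewrite -/(occ H P e) (disj e eW); have [_ ce] := inW e eW.
  by rewrite (cA e ein ce).
by rewrite addn0; have := model_occ MA e; rewrite ein.
Qed.

End EarStep.

(** * Models between explicit graphs, and the generated cubic graphs *)

(** All trails are required to be nonempty, which is enough for an isomorphism and
    makes nondegeneracy trivial. *)
Definition check_model (K H : lgraph) (hs : seq nat) (Ps : seq (seq (nat * bool))) :=
  [&& size Ps == size (le H),
      all (fun i => let p := nth [::] Ps i in (p != [::]) &&
        @walk (pg K) (nth 0%N hs (lsrc H i)) p (nth 0%N hs (ltgt H i)))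
        (iota 0 (size (le H))),
      uniq (map fst (flatten Ps)) &
      all (fun d => d.1 < size (le K))%N (flatten Ps)].

Lemma occ_flatten (K H : lgraph) (Ps : seq (seq (nat * bool))) k :
  size Ps = size (le H) ->
  @occ (pg K) H (nth [::] Ps) k = count_mem k (map fst (flatten Ps)).
Proof.
move=> sz; rewrite /occ -sz; elim: Ps {sz} => [|p Ps IH] /=; first by rewrite big_nil.
rewrite map_cat count_cat -IH big_cons; congr addn.
by rewrite -[iota 1 _]/(iota (1 + 0) _) iotaDl big_map; apply: eq_bigr.
Qed.

Lemma check_modelP K H hs Ps : check_model K H hs Ps ->
  @model (pg K) predT H (nth 0%N hs) (nth [::] Ps).
Proof.
case/and4P=> /eqP szP /allP wP uP /allP inP; split.
- by move=> i im; have := wP i; rewrite in_iota0 => /(_ im)/andP[].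
- move=> k; rewrite occ_flatten // count_uniq_mem // andbT.
  case: (boolP (k \in map fst _)) => // /mapP[d din ->].
  by rewrite in_iota0; have := inP d din; case: (_ < _)%N.
- move=> c _ [i]; rewrite in_iota0 => im ci; exists i; split=> //.
  by have := wP i; rewrite in_iota0 => /(_ im)/andP[].
Qed.

Definition loop1 := LGraph 1 [:: (0, 0)%N].
Definition theta := LGraph 2 [:: (0, 1)%N; (0, 1)%N; (0, 1)%N].

(** The cubic graphs that the growth by ears produces; [f <= g] because an ear can
    be reversed. *)
Inductive reach : nat -> lgraph -> Prop :=
| reach_theta : reach 2 theta
| reach_insert k H f g : reach k H -> (f <= g)%N -> (g < size (le H))%N ->
    reach k.+1 (insert f g H).

Definition deg (H : lgraph) (v : nat) : nat :=
  \sum_(i <- iota 0 (size (le H))) @ends (pg H) i v.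

Lemma deg_subdiv H i v : wf H -> (i < size (le H))%N ->
  deg (subdiv i H) v = (deg H v + 2 * (v == nv H))%N.
Proof.
move=> wH im; rewrite /deg size_subdiv // big_iotaS /=.
rewrite (bigD1_seq i) ?in_iota0 ?iota_uniq //=.
rewrite [in RHS](bigD1_seq i) ?in_iota0 ?iota_uniq //= /ends /=.
rewrite !lsrc_subdiv // !ltgt_subdiv // !eqxx (ltn_eqF im) (gtn_eqF im).
set S1 := (\sum_(j <- _ | _) _)%N; set S2 := (\sum_(j <- _ | _) _)%N.
have -> : S1 = S2.
  rewrite /S1 /S2 big_seq_cond [RHS]big_seq_cond; apply: eq_bigr => j.
  rewrite in_iota0 => /andP[jm /negPf ji].
  by rewrite lsrc_subdiv // ltgt_subdiv // ji (ltn_eqF jm).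
by rewrite (eq_sym v); lia.
Qed.

Lemma deg_add H p q v : deg (add_edge p q H) v = (deg H v + ((p == v) + (q == v)))%N.
Proof.
rewrite /deg size_rcons big_iotaS /= /ends /= lsrc_add ltgt_add ltnn eqxx; congr addn.
by apply: eq_big_seq => j; rewrite in_iota0 lsrc_add ltgt_add => ->.
Qed.

Lemma deg_fresh H v : wf H -> (nv H <= v)%N -> deg H v = 0%N.
Proof.
move=> wH nv_v; rewrite /deg big_seq big1 // => i; rewrite in_iota0 => im.
have [ai bi] := wf_lt wH im.
by rewrite /ends /= !ltn_eqF //; apply: leq_trans nv_v.
Qed.

(** The converse of [cyc_subdiv]: the second half takes the value of the edge. *)
Lemma cyc_subdivI H i c : wf H -> (i < size (le H))%N -> @cyc (pg H) c ->
  @cyc (pg (subdiv i H)) (fun j => if j == size (le H) then c i else c j).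
Proof.
move=> wH im cc x; have [ai bi] := wf_lt wH im.
rewrite /= size_subdiv // big_iotaS /= eqxx.
have E1 := cc x; rewrite /= (bigD1_seq i) ?in_iota0 ?iota_uniq //= in E1.
rewrite (bigD1_seq i) ?in_iota0 ?iota_uniq //= (ltn_eqF im) addrAC -[RHS]E1.
congr (_ + _); last first.
  rewrite big_seq_cond [RHS]big_seq_cond; apply: eq_bigr => j.
  rewrite in_iota0 => /andP[jm /negPf ji].
  by rewrite /ends /= lsrc_subdiv // ltgt_subdiv // ji (ltn_eqF jm).
rewrite /ends /= !lsrc_subdiv // !ltgt_subdiv // !eqxx (ltn_eqF im) (gtn_eqF im).
rewrite -mulrnDr -![c i *+ _]mulr_natr !natrD; congr (_ * _).
by rewrite -addrA [X in _ + X]addrA F2_dbl add0r.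
Qed.

(** * Invariants of the generated cubic graphs *)

Section ReachInvariants.

Definition loopless (H : lgraph) := forall i, (i < size (le H))%N -> lsrc H i != ltgt H i.

Definition bridgeless (H : lgraph) := forall i, (i < size (le H))%N ->
  exists2 c : nat -> F2, @cyc (pg H) c & c i != 0.

Lemma loopless_subdiv H i : wf H -> (i < size (le H))%N -> loopless H ->
  loopless (subdiv i H).
Proof.
move=> wH im lH j; rewrite size_subdiv // ltnS => jm.
have [ai bi] := wf_lt wH im.
rewrite lsrc_subdiv // ltgt_subdiv //.
case: (j =P size (le H)) => [->|/eqP ne].
  by rewrite (gtn_eqF im) gtn_eqF.
have jm' : (j < size (le H))%N by rewrite ltn_neqAle ne.
have [aj bj] := wf_lt wH jm'.
by case: (j == i); [rewrite ltn_eqF|apply: lH].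
Qed.

Lemma loopless_add H p q : p != q -> loopless H -> loopless (add_edge p q H).
Proof.
move=> pq lH j; rewrite size_rcons ltnS leq_eqVlt lsrc_add ltgt_add.
by case: (j =P _) => [-> _|_ /= jm]; [rewrite ltnn|rewrite jm; apply: lH].
Qed.

Lemma bridgeless_subdiv H i : wf H -> (i < size (le H))%N -> bridgeless H ->
  bridgeless (subdiv i H).
Proof.
move=> wH im bH j; rewrite size_subdiv // ltnS leq_eqVlt => /orP[/eqP->|jm].
  have [c cc ci] := bH i im; eexists; first exact: cyc_subdivI wH im cc.
  by rewrite /= eqxx.
have [c cc cj] := bH j jm; eexists; first exact: cyc_subdivI wH im cc.
by rewrite /= (ltn_eqF jm).
Qed.

Lemma cyc_addI H p q c : c (size (le H)) = 0 -> @cyc (pg H) c ->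
  @cyc (pg (add_edge p q H)) c.
Proof.
move=> cm cc x; rewrite -[RHS](cc x) /= size_rcons big_iotaS /= cm mul0rn addr0.
apply: eq_big_seq => j; rewrite in_iota0 => jm.
by rewrite /ends /= lsrc_add ltgt_add jm.
Qed.

Lemma determined_subdiv H i k : wf H -> (i < size (le H))%N ->
  determined (Gm := pg H) predT k -> determined (Gm := pg (subdiv i H)) predT k.
Proof.
move=> wH im [F szF dF]; exists F => // c cc _ cF j.
have [cH cmi] := cyc_subdiv wH im cc.
have c0 l : (l < size (le H))%N -> c l = 0.
  move=> lm; apply: (dF c) => //; last by rewrite in_iota0.
  move=> e; rewrite in_iota0 => em eF; apply: cF => //.
  by rewrite /= size_subdiv // in_iota0 ltnW.
rewrite /= size_subdiv // in_iota0 ltnS leq_eqVlt => /orP[/eqP->|]; last exact: c0.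
by rewrite cmi c0.
Qed.

Lemma determined_add H p q k :
  determined (Gm := pg H) predT k ->
  determined (Gm := pg (add_edge p q H)) predT k.+1.
Proof.
move=> [F szF dF]; exists (size (le H) :: F) => // c cc _ cF j.
have cm : c (size (le H)) = 0.
  by apply: cF; rewrite ?inE ?eqxx // /= size_rcons in_iota0.
have cH := cyc_add_edge cm cc.
rewrite /= size_rcons in_iota0 ltnS leq_eqVlt => /orP[/eqP->//|jm].
apply: (dF c) => //; last by rewrite in_iota0.
move=> e; rewrite in_iota0 => em eF; apply: cF; last by rewrite inE eF orbT.
by rewrite /= size_rcons in_iota0 ltnW.
Qed.

(** With the Betti number pinned from both sides (by the counts of vertices
    and edges from below, by [cubic_determined] from above), bridgelessness is
    inherited by insertions: if no chain passed through the new edge, the old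
    graph would have too many independent chains. *)
Record cubic (k : nat) (H : lgraph) : Prop := Cubic {
  cubic_wf : wf H;
  cubic_nv : (nv H + 2 = 2 * k)%N;
  cubic_size : (size (le H) + 3 = 3 * k)%N;
  cubic_k : (2 <= k)%N;
  cubic_deg : forall v, (v < nv H)%N -> deg H v = 3%N;
  cubic_loopless : loopless H;
  cubic_bridgeless : bridgeless H;
  cubic_determined : determined (Gm := pg H) predT k }.

Lemma cubic_betti_ge k H : cubic k H -> betti_ge (Gm := pg H) predT k.
Proof. by case=> wH nH sH k2 _ _ _ _; apply: betti_ge_euler; lia. Qed.

Lemma cubic_theta : cubic 2 theta.
Proof.
split=> //.
- by case=> [|[|]] // _; rewrite /deg /= !big_cons big_nil.
- by case=> [|[|[|]]].
- case=> [|[|[|]]] // _.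
  + exists (fun j => (j != 2)%:R) => // x.
    rewrite /= !big_cons big_nil /= /ends /lsrc /ltgt /=.
    by rewrite addrA F2_dbl mul0rn !addr0.
  + exists (fun j => (j != 0%N)%:R) => // x.
    rewrite /= !big_cons big_nil /= /ends /lsrc /ltgt /=.
    by rewrite mul0rn add0r addr0 F2_dbl.
  + exists (fun j => (j != 0%N)%:R) => // x.
    rewrite /= !big_cons big_nil /= /ends /lsrc /ltgt /=.
    by rewrite mul0rn add0r addr0 F2_dbl.
exists [:: 0%N; 1%N] => // c cc _ cF.
have c0 : c 0%N = 0 by apply: cF.
have c1 : c 1%N = 0 by apply: cF.
have := cc 0%N; rewrite /= !big_cons big_nil /ends /lsrc /ltgt /=.
rewrite c0 c1 !mul0rn !add0r addr0 mulr1n => c2.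
by case=> [|[|[|]]].
Qed.

Lemma cubic_insert k H f g : cubic k H -> (f < size (le H))%N ->
  (g < size (le H))%N -> cubic k.+1 (insert f g H).
Proof.
case=> wH nH sH k2 dH lH bH detH fm gm.
have w1 := wf_subdiv wH fm.
set g' := if f == g then size (le H) else g.
have g'm : (g' < size (le (subdiv f H)))%N.
  by rewrite size_subdiv // /g'; case: eqP => // _; apply: ltnW.
have w2 := wf_subdiv w1 g'm.
have b2 := bridgeless_subdiv w1 g'm (bridgeless_subdiv wH fm bH).
have d2 := determined_subdiv w1 g'm (determined_subdiv wH fm detH).
have s3 := size_insert fm gm; rewrite /insert -/g' in s3 *.
have w3 : wf (insert f g H) by apply: wf_insert.
rewrite /insert -/g' in w3.
split=> //; rewrite ?s3 /=; try lia.
- move=> v vn; rewrite deg_add !deg_subdiv //=.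
  move: vn; rewrite ltnS leq_eqVlt => /orP[/eqP->|].
    rewrite (deg_fresh wH) ?leqnSn // (gtn_eqF (ltnSn _)) eqxx.
    by rewrite (ltn_eqF (ltnSn _)).
  rewrite ltnS leq_eqVlt => /orP[/eqP->|vn].
    by rewrite (deg_fresh wH) // eqxx (ltn_eqF (ltnSn _)) (gtn_eqF (ltnSn _)).
  have vn' : (v < (nv H).+1)%N by apply: ltnW.
  by rewrite dH // (ltn_eqF vn) (ltn_eqF vn') (gtn_eqF vn) (gtn_eqF vn').
- apply: loopless_add; first by rewrite (ltn_eqF (ltnSn _)).
  by apply: loopless_subdiv => //; apply: loopless_subdiv.
- move=> j; rewrite size_rcons ltnS leq_eqVlt => /orP[/eqP->|jm]; last first.
    have [c cc cj] := b2 j jm.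
    exists (fun l => if l == size (le (subdiv g' (subdiv f H))) then 0 else c l).
      apply: cyc_addI; first by rewrite eqxx.
      move=> x; rewrite -[RHS](cc x); apply: eq_big_seq => l; rewrite in_iota0 => lm.
      by rewrite (ltn_eqF lm).
    by rewrite (ltn_eqF jm).
  (* The new edge lies on a cycle, for otherwise the [k + 1] dimensions of
     closed chains would live in the old graph, where [k] coordinates determine
     a chain. *)
  have b3 : betti_ge (Gm := pg (insert f g H)) predT k.+1.
    by apply: betti_ge_euler; rewrite ?(size_insert fm gm) //=; lia.
  have [F szF dF] := d2.
  have [c [cc [l ln cl] cF]] := b3 F szF.
  exists c => //; apply/eqP => cm; case/eqP: cl.
  have sz3 : size (le (insert f g H)) = (size (le (subdiv g' (subdiv f H)))).+1.
    by rewrite size_rcons.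
  move: ln; rewrite in_iota0 sz3 ltnS leq_eqVlt => /orP[/eqP->|lm]; first exact: cm.
  apply: (dF c (cyc_add_edge cm cc)) => //; last by rewrite in_iota0.
  move=> i; rewrite in_iota0 => im iF; apply/eqP/negPn/negP => ci.
  by have := cF i; rewrite in_iota0 sz3 iF => /(_ (ltnW im) ci).
- exact: determined_add.
Qed.

Lemma reach_cubic k H : reach k H -> cubic k H.
Proof.
elim=> [|{}k {}H f g _ cH fg gm]; first exact: cubic_theta.
exact: cubic_insert cH (leq_ltn_trans fg gm) gm.
Qed.

End ReachInvariants.

(** * Heavy vertex stars *)

Section Star.
Variables (R : realFieldType) (k : nat) (H : lgraph).
Hypothesis cH : cubic k H.
Notation m := (size (le H)).

(** The edges at a vertex, named so that [z] is the heaviest. The inequality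
    records that the star is heavy, and the last condition that it is a cut: a
    closed chain passes through a vertex an even number of times. *)
Definition star_at (w : nat -> R) (x y z : nat) : Prop :=
  [/\ [&& x != y, x != z & y != z], [&& (x < m)%N, (y < m)%N & (z < m)%N],
      (w x <= w z) && (w y <= w z),
      @wt R (pg H) w predT <= (w x + w y + w z) *+ k.-1 &
      forall c, @cyc (pg H) c -> c x + c y + c z = 0].

(** By averaging, since every edge lies in two of the [2 (k - 1)] stars. *)
Lemma star (w : nat -> R) : (forall i, 0 <= w i) -> exists x y z, star_at w x y z.
Proof.
move=> w0; case: (cH) => wH nH sH k2 dH lH _ _.
pose S v := \sum_(i <- iota 0 m) w i *+ @ends (pg H) i v.
set W := @wt R (pg H) w predT.
have sumS : \sum_(v <- iota 0 (nv H)) S v = W *+ 2.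
  rewrite exchange_big /= /W /wt -sumrMnl; apply: eq_big_seq => i; rewrite in_iota0 => im.
  rewrite sumrMnr; congr (_ *+ _); have [ai bi] := wf_lt wH im.
  rewrite big_split /= (bigD1_seq (lsrc H i)) ?iota_uniq ?in_iota0 //= eqxx.
  rewrite big1 => [|v]; last by rewrite eq_sym => /negPf->.
  rewrite (bigD1_seq (ltgt H i)) ?iota_uniq ?in_iota0 //= eqxx.
  by rewrite big1 // => v; rewrite eq_sym => /negPf->.
have [v vn WS] : exists2 v, (v < nv H)%N & W <= S v *+ k.-1.
  have [/hasP[v]|/hasPn none] := boolP (has (fun v => W <= S v *+ k.-1) (iota 0 (nv H))).
    by rewrite in_iota0; exists v.
  exfalso.
  have : \sum_(v <- iota 0 (nv H)) S v *+ k.-1 < \sum_(v <- iota 0 (nv H)) W.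
    rewrite !big_iota_ord; apply: ltr_sum => [|v _].
      have n0 : (0 < nv H)%N by lia.
      by apply/hasP; exists (Ordinal n0) => //; rewrite mem_index_enum.
    by rewrite ltNge; apply: none; rewrite in_iota0.
  rewrite sumrMnl sumS big_iota_ord sumr_const card_ord -mulrnA.
  by rewrite (_ : nv H = (2 * k.-1)%N) ?ltxx //; lia.
pose s := [seq i <- iota 0 m | @ends (pg H) i v != 0%N].
have e1 i : (i < m)%N -> @ends (pg H) i v = (@ends (pg H) i v != 0%N).
  move=> im; rewrite /ends /=; have := lH i im.
  by case: (lsrc H i =P v) => [->|_]; case: (ltgt H i =P v) => [->|_] //; rewrite eqxx.
have Es (V : nmodType) (F : nat -> V) :
    \sum_(i <- iota 0 m) F i *+ @ends (pg H) i v = \sum_(i <- s) F i.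
  rewrite big_filter [RHS]big_mkcond; apply: eq_big_seq => i; rewrite in_iota0 => im.
  by rewrite e1 //; case: (_ != _).
have szs : size s = 3%N.
  rewrite -(dH v vn) /deg -sum1_size -(Es nat (fun=> 1%N)); apply: eq_bigr => i _.
  by rewrite -mulr_natr natn mul1r.
have us : uniq s by rewrite filter_uniq ?iota_uniq.
have ins i : i \in s -> (i < m)%N by rewrite mem_filter in_iota0 => /andP[].
case Ess : s szs => [|a [|b [|c [|]]]] // _.
have [ab ac bc] : [/\ a != b, a != c & b != c].
  by move: us; rewrite Ess /= !inE negb_or andbT => /andP[/andP[-> ->] ->].
have [am bm cm] : [/\ (a < m)%N, (b < m)%N & (c < m)%N].
  by split; apply: ins; rewrite Ess !inE eqxx ?orbT.
have wabc : W <= (w a + w b + w c) *+ k.-1.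
  by apply: le_trans WS _; rewrite /S Es Ess !big_cons big_nil addr0 addrA.
have cabc d : @cyc (pg H) d -> d a + d b + d c = 0.
  by move=> /(_ v); rewrite /= Es Ess !big_cons big_nil addr0 addrA.
have [wac|wca] := leP (w a) (w c); have [wbc|wcb] := leP (w b) (w c).
- by exists a, b, c; split; rewrite ?ab ?ac ?bc ?am ?bm ?cm ?wac ?wbc.
- exists a, c, b; split; rewrite ?ab ?ac ?[c == b]eq_sym ?bc ?am ?bm ?cm //.
  + by rewrite (ltW wcb) (le_trans wac) // ltW.
  + by rewrite addrAC.
  + by move=> d /cabc; rewrite addrAC.
- exists b, c, a; split; rewrite ?[b == a]eq_sym ?[c == a]eq_sym ?ab ?ac ?bc ?am ?bm ?cm //.
  + by rewrite (ltW wca) (le_trans wbc) // ltW.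
  + by move: wabc; rewrite -addrA addrC.
  + by move=> d /cabc; rewrite -addrA addrC.
have [wab|wba] := leP (w a) (w b).
- exists a, c, b; split; rewrite ?ab ?ac ?[c == b]eq_sym ?bc ?am ?bm ?cm //.
  + by rewrite (ltW wcb) wab.
  + by rewrite addrAC.
  + by move=> d /cabc; rewrite addrAC.
exists b, c, a; split; rewrite ?[b == a]eq_sym ?[c == a]eq_sym ?ab ?ac ?bc ?am ?bm ?cm //.
+ by rewrite (ltW wca) ltW.
+ by move: wabc; rewrite -addrA addrC.
+ by move=> d /cabc; rewrite -addrA addrC.
Qed.

Lemma betti_ge_drop z : betti_ge (Gm := pg H) (predC1 z) k.-1.
Proof.
have := cubic_k cH => k2 F szF.
have [|c [cc nc cF]] := cubic_betti_ge cH (F := z :: F).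
  by move: szF; case: (k) k2 => [|[|j]].
exists c; split=> // i im ci; have := cF i im ci; rewrite inE negb_or /=.
by case/andP=> -> ->.
Qed.

(** Avoiding two edges of the star forces the third, hence deleting three
    edges costs only 2 in the Betti number. *)
Lemma betti_ge_star w x y z : star_at w x y z ->
  betti_ge (Gm := pg H) (fun i => i \notin [:: x; y; z]) k.-2.
Proof.
case=> _ /and3P[xm ym _] _ _ cxyz F szF.
have [|c [cc nc cF]] := cubic_betti_ge cH (F := x :: y :: F).
  by move: szF; case: (k) => [|[|j]].
have c0 i : i \in pes (pg H) -> i \in x :: y :: F -> c i = 0.
  move=> im iF; apply/eqP/negPn/negP => ci; have := cF i im ci.
  by rewrite iF.
exists c; split=> // i im ci; have := cF i im ci; rewrite !inE !negb_or /=.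
case/and3P=> ix iy ->; rewrite ix iy andbT /=.
apply/eqP => iz; case/eqP: ci; rewrite iz -[RHS](cxyz c cc).
have cx : c x = 0 by apply: c0; rewrite ?in_iota0 // inE eqxx.
have cy : c y = 0 by apply: c0; rewrite ?in_iota0 // !inE eqxx orbT.
by rewrite cx cy !add0r.
Qed.

End Star.

(** * Growing a model by ears *)

Section Grow.
Variables (Gm : pgraph) (A : pred (pE Gm)) (b : nat).
Hypothesis bA : betti_ge A b.

(** The event that ends the growth by ears early; lower bounds for the weights
    of the two parts add up. *)
Definition split_off (k : nat) : Prop := exists U1 U2 : pred (pE Gm),
  [/\ betti_ge U1 k, betti_ge U2 (b - k),
      forall e, e \in pes Gm -> U1 e -> A e && ~~ U2 e &
      forall e, e \in pes Gm -> U2 e -> A e].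

(** A model whose image has no more independent cycles than the graph itself.
    Identifications between trails at common vertices would create further
    cycles; attaching ears one by one avoids this. *)
Definition full_model k H := exists h P, model A H h P /\
  determined (fun e => occ H P e != 0%N) k.

(** Suppose that no ear can be attached, and let [F] be [k] coordinates that
    determine the closed chains on the model. A closed chain that avoids [F]
    and [b - k - 1] further edges is nonzero outside the model, and a cycle in
    its support through an outside edge cannot touch the model, since it would
    contain an ear. So the edges outside the model have Betti number at least
    [b - k]. *)
Lemma grow_step k H : wf H -> betti_ge (Gm := pg H) predT k -> (k < b)%N ->
  full_model k H -> split_off k \/
  exists f g, [/\ (f <= g)%N, (g < size (le H))%N & full_model k.+1 (insert f g H)].
Proof.
move=> wH bH kb [h [P [M [F szF dF]]]].
case: (pselect (exists W p q, ear H h P W p q /\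
    forall e, e \in edges W -> e \in pes Gm /\ A e)) => [[W [p [q [eW inA]]]]|noear].
  right; have [f [g [fg gm [h' [P' [M' o']]]]]] := ear_insert M wH eW inA.
  exists f, g; split=> //; exists h', P'; split=> //.
  case: eW => [[W0 wW Zp Zq] uW sW inner _].
  case EW: W W0 => [//|d0 W'] _.
  exists (d0.1 :: F) => // c cc supp cF.
  have cW := ear_const wW Zq uW sW inner EW (fun e eW => (inA e eW).1) cc.
  have c0 e : e \in edges W -> c e = 0.
    apply: cW.
      move=> e' e'in ce' e'W; have := supp e' e'in ce'.
      by rewrite o' (count_memPn e'W) addn0 => /(@occ_on_model _ _ _ _ _ M (e', true)).
    apply: cF; last by rewrite inE eqxx.
    by case: (inA d0.1) => //; rewrite EW inE eqxx.
  apply: dF => // [e ein ce|e ein eF]; last by apply: cF => //; rewrite inE eF orbT.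
  have := supp e ein ce; rewrite o' (count_memPn _) ?addn0 //.
  by apply/negP => /c0 c0e; rewrite c0e eqxx in ce.
left; exists (fun e => occ H P e != 0%N), (fun e => A e && (occ H P e == 0%N)).
split; [exact: betti_ge_model M bH| | |by move=> e _ /andP[]]; last first.
  move=> e ein oe; rewrite (negPf oe) andbF andbT.
  have := model_occ M e; rewrite ein /=; move: oe.
  by case: (A e) => //; case: (occ H P e).
move=> F' szF'.
have [|c [cc [e1 e1in ce1] cF]] := bA (F := F ++ F'); first by rewrite size_cat; lia.
have [/hasP[e0 e0in /andP[ce0 /eqP oe0]]|/hasPn none] :=
    boolP (has (fun e => (c e != 0) && (occ H P e == 0%N)) (pes Gm)); last first.
  case/eqP: ce1; apply: dF => // [e ein ce|e ein eF].
    by have := none e ein; rewrite ce.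
  apply/eqP/negPn/negP => ce; have := cF e ein ce.
  by rewrite mem_cat eF andbF.
have [u [W [sW e0W inW]]] := cyc_through cc e0in ce0.
have sub : {subset edges W <= pes Gm} by move=> e /inW[].
have inA e : e \in edges W -> A e /\ e \notin F'.
  move=> /inW[ein ce]; have := cF e ein ce; rewrite mem_cat negb_or.
  by case/and3P.
case: (scw_ear M sW e0W oe0) => [disj|[Y [p [q [eY subY _]]]]]; last first.
  case: noear; exists Y, p, q; split=> // e /subY eW.
  by split; [apply: sub|case: (inA e eW)].
have [wc wE] := scw_wchain sW sub.
exists (wchain W); split=> //; first by exists e0; rewrite // wE e0W.
move=> e _; rewrite wE; case: (boolP (e \in edges W)) => // eW _.
by have [-> ->] := inA e eW; rewrite (disj e eW).
Qed.

Lemma full_loop1 : (0 < b)%N -> full_model 1 loop1.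
Proof.
move=> b0; have [|c [cc [e0 e0in ce0] cA]] := bA (F := [::]); first by [].
have [u [W [sW e0W inW]]] := cyc_through cc e0in ce0.
have sub : {subset edges W <= pes Gm} by move=> e /inW[].
have [/and4P[W0 wW sW' uW]] := sW.
have oE e : occ loop1 (fun=> W) e = count_mem e (edges W).
  by rewrite /occ /= big_seq1.
exists (fun=> u), (fun=> W); split.
  split=> [[|]//|e|c' _ [[|] // _ c'0]]; last by exists 0%N.
  rewrite oE count_uniq_mem //; case: (boolP (e \in edges W)) => // eW.
  have [ein ce] := inW e eW; have := cA e ein ce.
  by rewrite ein => /andP[->].
case EW: W W0 => [//|d0 W'] _; exists [:: d0.1] => // d dc supp d0F.
have Zin d1 : d1 \in behead W -> ~~ pred1 u (dstart d1).
  move=> d1W; move: sW' wW; rewrite EW /= => /andP[+ _] /andP[/eqP<- _].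
  apply: contra => /eqP<-; apply: map_f; by rewrite EW in d1W.
have cW e : e \in edges W -> d e = 0.
  apply: (ear_const wW (Z := pred1 u) _ uW sW' Zin EW sub dc) => //=.
    move=> e' e'in de' e'W; have := supp e' e'in de'.
    by rewrite -EW oE (count_memPn e'W).
  apply: d0F; rewrite ?inE ?eqxx //.
  by apply: sub; rewrite EW inE eqxx.
move=> e ein; have [//|de] := eqVneq (d e) 0.
apply: cW; have := supp e ein de; rewrite -EW oE -lt0n.
by rewrite count_mem_gt0.
Qed.

(** An ear at a cycle gives two parallel paths and a third one, but with a
    vertex of degree 2 left from the loop; the trail that passes through it
    replaces two edges. *)
Lemma full_theta : full_model 2 (insert 0 0 loop1) -> full_model 2 theta.
Proof.
move=> [h [P [M [F szF dF]]]].
pose hs := [:: 1; 2]%N.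
pose Ps := [:: [:: (1%N, true)]; [:: (3%N, true)]; [:: (0%N, false); (2%N, false)]].
have Mt : @model (pg (insert 0 0 loop1)) predT theta (nth 0%N hs) (nth [::] Ps).
  by apply: check_modelP.
have M' := model_comp M Mt; eexists; eexists; split; first exact: M'.
exists F => // c cc supp cF; apply: dF => // e ein ce.
have := supp e ein ce; apply: contra => /eqP oe.
rewrite /occ /= !big_cons big_nil !count_compose /=.
move: oe; rewrite /occ /= !big_cons !big_nil /=; lia.
Qed.

(** Start with a cycle and attach ears until the Betti number is [b] or no ear
    is left. *)
Lemma grow : (2 <= b)%N -> (exists k, (0 < k < b)%N /\ split_off k) \/
  exists H, reach b H /\ has_model A H.
Proof.
move=> b2.
have b1 : betti_ge (Gm := pg loop1) predT 1 by apply: betti_ge_euler.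
have [E|[f [g [fg gm fm]]]] := @grow_step 1 loop1 isT b1 b2 (full_loop1 (ltnW b2)).
  by left; exists 1%N.
have {f g fg gm fm} fth : full_model 2 theta.
  by move: gm fg fm; case: g => // _; case: f => // _; apply: full_theta.
have claim j : (2 + j <= b)%N -> (exists k, (0 < k < b)%N /\ split_off k) \/
    exists H, reach (2 + j) H /\ full_model (2 + j) H.
  elim: j => [_|j IH jb]; first by right; exists theta; split=> //; apply: reach_theta.
  have [|//|[H [rH fH]]] := IH; [by apply: ltnW; rewrite -addnS|by left|].
  have cH := reach_cubic rH; rewrite addnS in jb *.
  have [E|[f [g [fg gm fm]]]] := grow_step (cubic_wf cH) (cubic_betti_ge cH) jb fH.
    by left; exists (2 + j)%N.
  by right; exists (insert f g H); split=> //; apply: reach_insert.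
have [|E|[H [rH [h [P [M _]]]]]] := claim (b - 2)%N; first by rewrite subnKC.
  by left.
by right; exists H; rewrite subnKC // in rH; split=> //; exists h, P.
Qed.

End Grow.

(** * Fractional packings of cycles *)

Section Certificates.

Definition to_mask (m : nat) (c : seq nat) : seq bool :=
  mkseq (fun i => has (eqn i) c) m.

Definition ends_of (l : seq (nat * nat)) : seq nat :=
  foldr (fun e t => e.1 :: e.2 :: t) [::] l.

Definition even_mask (l : seq (nat * nat)) (t : seq bool) : bool :=
  let es := ends_of (mask t l) in
  (es != [::]) && all (fun v => ~~ odd (count (eqn v) es)) es.

(** A fractional packing: even subgraphs [cs], each edge used at most [D]
    times, with [size cs / D >= p / q]. An even subgraph is a closed chain,
    and it need not be a single cycle. *)
Definition check_cert (H : lgraph) (D : nat) (cs : seq (seq bool)) (p q : nat) : bool :=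
  [&& (0 < D)%N, all (even_mask (le H)) cs,
      all (fun i => count (fun t => nth false t i) cs <= D)%N (iota 0 (size (le H))) &
      (p * D <= q * size cs)%N].

Definition mchain (t : seq bool) (i : nat) : F2 := (nth false t i)%:R.

Lemma mchain_neq0 t i : (mchain t i != 0) = nth false t i.
Proof. by rewrite /mchain; case: (nth _ _ _). Qed.

Lemma sum_mask (T : Type) (x0 : T) (V : nmodType) (F : T -> V) t (l : seq T) :
  \sum_(i <- iota 0 (size l)) F (nth x0 l i) *+ nth false t i =
  \sum_(e <- mask t l) F e.
Proof.
elim: l t => [|e l IH] [|a t] /=.
- by rewrite !big_nil.
- by rewrite !big_nil.
- rewrite big1 ?big_nil // => i _; by rewrite nth_nil mulr0n.
rewrite big_cons -[iota 1 _]/(iota (1 + 0) _) iotaDl big_map /=.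
by case: a; rewrite /= ?big_cons -IH ?mulr0n ?add0r.
Qed.

Lemma sum_ends_of (l : seq (nat * nat)) x :
  \sum_(e <- l) ((e.1 == x) + (e.2 == x))%:R = (count (eqn x) (ends_of l))%:R :> F2.
Proof.
elim: l => [|e l IH] /=; first by rewrite big_nil.
by rewrite big_cons IH -natrD addnA !(eq_sym _ x).
Qed.

Lemma F2_natr k : (k%:R : F2) = (odd k)%:R.
Proof.
by rewrite -{1}(odd_double_half k) -addnn !natrD F2_dbl addr0.
Qed.

Lemma mask_nth t (l : seq (nat * nat)) : mask t l != [::] ->
  exists2 i, (i < size l)%N & nth false t i.
Proof.
elim: l t => [|e l IH] [|[] t] //= ne; first by exists 0%N.
by have [i il ti] := IH t ne; exists i.+1.
Qed.

Lemma even_mask_cyc H t : even_mask (le H) t ->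
  @cyc (pg H) (mchain t) /\ @nonzero (pg H) (mchain t).
Proof.
case/andP=> ne /allP ev; split=> [x|].
  have -> : \sum_(i <- pes (pg H)) mchain t i *+ @ends (pg H) i x =
      \sum_(e <- mask t (le H)) ((e.1 == x) + (e.2 == x))%:R.
    rewrite -(sum_mask (0, 0)%N (fun e => ((e.1 == x) + (e.2 == x))%:R)).
    by apply: eq_bigr => i _; rewrite /mchain -mulrnA mulnC mulrnA.
  rewrite sum_ends_of F2_natr.
  have [xin|xout] := boolP (x \in ends_of (mask t (le H))).
    by rewrite (negPf (ev x xin)).
  rewrite (_ : count _ _ = 0%N) //; apply/eqP; rewrite -leqn0 leqNgt -has_count.
  by apply/hasPn => y yin; apply: contra xout => /eqnP->.
have : mask t (le H) != [::] by apply: contra ne => /eqP->.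
case/mask_nth=> i im ti; exists i; first by rewrite in_iota0.
by rewrite mchain_neq0.
Qed.

(** Linear programming duality: add up the weights of the members of the
    packing. Each is at least [k], and each edge is counted at most [D] times. *)
Lemma check_certP (R : realFieldType) H D cs p q (w : nat -> R) k :
  check_cert H D cs p q -> @normed R (pg H) w k ->
  p%:R * k <= q%:R * @wt R (pg H) w predT.
Proof.
case/and4P=> D0 /allP ev /allP load pq [w0 k0 wk].
set W := @wt R (pg H) w predT.
have sk : k *+ size cs <= W *+ D.
  apply: (@le_trans _ _ (\sum_(t <- cs) @wt R (pg H) w (nth false t))).
    rewrite -sum1_size -sumrMnr big_seq [leRHS]big_seq; apply: ler_sum => t tin.
    have [ct nt] := even_mask_cyc (ev t tin); rewrite mulr1n.
    apply: le_trans (wk _ ct nt) _; apply: wt_le => // i _.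
    by rewrite mchain_neq0.
  under eq_bigr do rewrite wt_count.
  rewrite exchange_big /W /wt -sumrMnl /= big_seq [leRHS]big_seq; apply: ler_sum => i im.
  rewrite sumrMnr; apply: ler_wpMn2l => //; apply: leq_trans (load i im).
  rewrite -sum1_count [leqRHS]big_mkcond /=; apply: leq_sum => t _.
  by case: (nth false t i).
have D0' : 0 < D%:R :> R by rewrite ltr0n.
rewrite -(ler_pM2r D0').
have h1 : p%:R * D%:R * k <= q%:R * (size cs)%:R * k.
  by apply: ler_wpM2r => //; rewrite -!natrM ler_nat.
have h2 : q%:R * (k * (size cs)%:R) <= q%:R * (W * D%:R).
  by apply: ler_wpM2l => //; rewrite !mulr_natr.
apply: (@le_trans _ _ (p%:R * D%:R * k)); first by rewrite mulrAC.
by apply: le_trans h1 _; rewrite -!mulrA [_ * k]mulrC.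
Qed.

End Certificates.

(** * Insertions into a graph up to symmetry *)

(** The functions of this section look for a packing and are trusted in nothing:
    their results go through [check_cert]. Closed chains are bit masks over the edge
    list. Packings are half-integral, that is, every edge is used at most twice. *)
Section Search.
Local Open Scope nat_scope.

Definition mxor (a b : seq bool) : seq bool := [seq x.1 (+) x.2 | x <- zip a b].
Definition mand (a b : seq bool) : seq bool := [seq x.1 && x.2 | x <- zip a b].
Definition mor (a b : seq bool) : seq bool := [seq x.1 || x.2 | x <- zip a b].

Fixpoint mdisjoint (a b : seq bool) : bool :=
  match a, b with
  | true :: _, true :: _ => false
  | _ :: a', _ :: b' => mdisjoint a' b'
  | _, _ => true
  end.

Variable H : lgraph.
Notation m := (size (le H)).
Notation n := (nv H).

Definition extend_paths (tbl : seq (seq bool)) : seq (seq bool) :=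
  let find_path v := foldr (fun i acc =>
    let a := lsrc H i in let b := ltgt H i in
    let pa := nth [::] tbl a in let pb := nth [::] tbl b in
    if eqn b v && (pa != [::]) then mxor pa (to_mask m [:: i])
    else if eqn a v && (pb != [::]) then mxor pb (to_mask m [:: i])
    else acc) [::] (iota 0 m) in
  mkseq (fun v => let pv := nth [::] tbl v in
                  if pv is [::] then find_path v else pv) n.

(** Shortest paths from [v], by rounds of breadth-first search; the empty mask
    stands for a vertex that has not been reached. *)
Definition paths_from (v : nat) : seq (seq bool) :=
  iter n extend_paths (mkseq (fun x => if eqn x v then nseq m false else [::]) n).

(** Horton's candidates: an edge closed up by shortest paths from a common
    vertex to its ends. *)
Definition short_cycles (paths : seq (seq (seq bool))) (cut : nat) : seq (seq bool) :=
  undup [seq z <- [seq mxor (mxor (nth [::] t (lsrc H i)) (nth [::] t (ltgt H i)))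
                        (to_mask m [:: i]) | t <- paths, i <- iota 0 m]
        | (0 < count id z <= cut)%N].

(** A chain of [H] after the insertion: the second halves of the subdivided
    edges take over the values, and the new edge is not used. *)
Definition lift_mask (r : nat * nat) (t : seq bool) : seq bool :=
  t ++ [:: nth false t r.1; nth false t r.2; false].

(** The shortest cycles through the inserted edge. Outside of it such a cycle
    runs from one of the two halves of [f] to one of the two halves of [g]
    along a shortest path of [H]; for [f = g] there is a cycle of length 2. *)
Definition new_cycles (paths : seq (seq (seq bool))) (r : nat * nat) : seq (seq bool) :=
  let: (f, g) := r in
  if eqn f g then [:: to_mask (m + 3) [:: m; (m + 2)%N]]
  else [seq mxor (lift_mask r (nth [::] (nth [::] paths u.1) v.1))
             (to_mask (m + 3) [:: u.2; v.2; (m + 2)%N])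
       | u <- [:: (lsrc H f, f); (ltgt H f, m)],
         v <- [:: (lsrc H g, g); (ltgt H g, m.+1)]].

(** Depth-first search for [left] more members of total length at most
    [budget], from a list of candidates sorted by length; [half] and [full]
    are the edges used once and at least twice. A candidate stays available
    after its use, as it may be taken twice. Since the list is sorted, the
    search can be cut as soon as [left] copies of the next candidate exceed
    the budget. *)
Fixpoint pack_cycles (fuel : nat) (cs : seq (nat * seq bool)) (left budget : nat)
    (half full : seq bool) : option (seq (seq bool)) :=
  match left, fuel, cs with
  | left'.+1, k.+1, (sz, t) :: cs' =>
      if sz * left > budget then None
      else if mdisjoint t full then
        if pack_cycles k cs left' (budget - sz) (mxor half t)
             (mor full (mand half t)) is Some z then Some (t :: z)
        else pack_cycles k cs' left budget half full
      else pack_cycles k cs' left budget half full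
  | left'.+1, _, _ => None
  | 0, _, _ => Some [::]
  end.

(** The members of a packing share a total length of twice the number of
    edges, so that candidates much longer than the average can be dropped. The
    paths and short cycles of [H] are computed once and serve for all
    insertions. *)
Definition find_packing (p q : nat) : nat * nat -> seq (seq bool) :=
  let paths := map paths_from (iota 0 n) in
  let need := (2 * p + q.-1) %/ q in
  let cut := ((2 * (m + 3)) %/ need).+1 in
  let cycles := short_cycles paths cut in
  fun r =>
    let old := map (lift_mask r) cycles in
    let new := [seq z' | z <- new_cycles paths r, z' <- z :: map (mxor z) old] in
    let cs := undup [seq z <- old ++ new | (0 < count id z <= cut)%N] in
    let sorted := sort (fun a b => (a.1 <= b.1)%N) [seq (count id z, z) | z <- cs] in
    odflt [::] (pack_cycles (size sorted + need) sorted need (2 * (m + 3))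
                 (nseq (m + 3) false) (nseq (m + 3) false)).

End Search.

Section Steps.

Fixpoint pick_edge (a b : nat) (l acc : seq (nat * (nat * nat))) :
    option ((nat * bool) * seq (nat * (nat * nat))) :=
  if l is (i, (x, y)) :: l' then
    if eqn x a && eqn y b then Some ((i, true), catrev acc l')
    else if eqn x b && eqn y a then Some ((i, false), catrev acc l')
    else pick_edge a b l' ((i, (x, y)) :: acc)
  else None.

Fixpoint route (hs : seq nat) (r : seq (nat * nat)) (l : seq (nat * (nat * nat))) :
    seq (seq (nat * bool)) :=
  if r is e :: r' then
    if pick_edge (nth 0%N hs e.1) (nth 0%N hs e.2) l [::] is Some (d, l')
    then [:: d] :: route hs r' l' else [::]
  else [::].

(** Each edge of [H] goes to a single edge of [K], chosen greedily along the
    vertex map [hs]; [route] removes the chosen edges so that parallel edges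
    get different images. *)
Definition embeds (K H : lgraph) (hs : seq nat) : bool :=
  check_model K H hs (route hs (le H) (zip (iota 0 (size (le K))) (le K))).

Lemma embedsP K H hs (Gm : pgraph) (A : pred (pE Gm)) :
  embeds K H hs -> has_model A K -> has_model A H.
Proof. by move=> /check_modelP M MK; apply: has_model_comp MK _; eexists; eexists; exact: M. Qed.

Definition image_edge (H : lgraph) (s : seq nat) (f : nat) : nat :=
  let a := nth 0%N s (lsrc H f) in let b := nth 0%N s (ltgt H f) in
  find (fun e => eqn e.1 a && eqn e.2 b || eqn e.1 b && eqn e.2 a) (le H).

Definition image_pair (H : lgraph) (s : seq nat) (p : nat * nat) : nat * nat :=
  let f := image_edge H s p.1 in let g := image_edge H s p.2 in
  if (f <= g)%N then (f, g) else (g, f).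

Definition insert2 (p : nat * nat) (H : lgraph) := insert p.1 p.2 H.

(** The pair of edges that a symmetry [s] of [H] makes out of [p]. Instead of
    proving that [s] is a symmetry, the two insertions are compared directly,
    with [s] extended to the two new vertices in either order. *)
Definition next_pair (H : lgraph) (p : nat * nat) (seen : seq (nat * nat))
    (s : seq nat) : option (nat * nat) :=
  let p' := image_pair H s p in
  if has (fun r => eqn r.1 p'.1 && eqn r.2 p'.2) seen then None else
  let n := nv H in let K := insert2 p' H in let R := insert2 p H in
  if embeds K R (s ++ [:: n; n.+1]) || embeds K R (s ++ [:: n.+1; n])
  then Some p' else None.

(** The orbit of the queue under the symmetries. Should the fuel run out, some
    pairs are merely treated once more. *)
Fixpoint close (fuel : nat) (H : lgraph) (gens : seq (seq nat))
    (queue seen : seq (nat * nat)) : seq (nat * nat) :=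
  if fuel is k.+1 then
    if queue is p :: q then
      let new := pmap (next_pair H p seen) gens in
      close k H gens (q ++ new) (new ++ seen)
    else seen
  else seen.

(** The insertion is settled either by a packing given by the edge indices of
    its members, or by a copy of the [j]-th graph of the next list, given by
    the images of its vertices; the empty list stands for the identity. *)
Inductive verdict := Pack of nat & seq (seq nat) | Iso of nat & seq nat.

Definition check_rep (H : lgraph) (targets : seq lgraph) (p q : nat)
    (r : (nat * nat) * verdict) : bool :=
  let K := insert2 r.1 H in
  match r.2 with
  | Pack D cs => check_cert K D (map (to_mask (size (le K))) cs) p q
  | Iso j hs =>
      let T := nth loop1 targets j in
      (j < size targets)%N && embeds K T (if hs is [::] then iota 0 (nv T) else hs)
  end.

(** Only generators of the symmetry group are given, and only those pairs of
    edges that the search does not settle. *)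
Record step_data := StepData {
  parent : lgraph;
  symmetries : seq (seq nat);
  reps : seq ((nat * nat) * verdict) }.

Fixpoint cover (search : nat * nat -> seq (seq bool)) (p q : nat) (H : lgraph)
    (gens : seq (seq nat)) (pairs seen : seq (nat * nat)) : bool :=
  if pairs is r :: pairs' then
    if has (fun x => eqn x.1 r.1 && eqn x.2 r.2) seen
    then cover search p q H gens pairs' seen
    else check_cert (insert2 r H) 2 (search r) p q &&
      cover search p q H gens pairs'
        (close (size (le H) * size (le H))%N H gens [:: r] (r :: seen))
  else true.

Definition all_pairs (m : nat) : seq (nat * nat) :=
  flatten [seq [seq (f, g) | f <- iota 0 g.+1] | g <- iota 0 m].

Definition check_parent (targets : seq lgraph) (p q : nat) (d : step_data) : bool :=
  let H := parent d in let ps := map fst (reps d) in let m := size (le H) in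
  all (check_rep H targets p q) (reps d) &&
  cover (find_packing H p q) p q H (symmetries d) (all_pairs m)
    (close (m * m)%N H (symmetries d) ps ps).

Definition settled (targets : seq lgraph) (p q : nat) (K : lgraph) : Prop :=
  forall (R : realFieldType) (Gm : pgraph) (w : pE Gm -> R) (k : R) (A : pred (pE Gm)),
    normed w k -> has_model A K ->
    p%:R * k <= q%:R * wt w A \/ exists2 j, (j < size targets)%N & has_model A (nth loop1 targets j).

Lemma cert_bound K D cs p q (R : realFieldType) (Gm : pgraph) (w : pE Gm -> R) k
    (A : pred (pE Gm)) :
  check_cert K D cs p q -> normed w k -> has_model A K ->
  p%:R * k <= q%:R * wt w A.
Proof.
move=> cert wk [h [P M]]; apply: le_trans (check_certP cert (model_normed M wk)) _.
by apply: ler_wpM2l => //; case: wk => w0 _ _; apply: (wt_mu_le M).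
Qed.

Lemma check_rep_settled H targets p q r : check_rep H targets p q r ->
  settled targets p q (insert2 r.1 H).
Proof.
case: r => fg [D cs|j hs]; rewrite /check_rep /=.
  by move=> cert R Gm w k A wk MA; left; apply: cert_bound cert wk MA.
case/andP=> jT emb R Gm w k A wk MA; right.
by exists j => //; apply: embedsP emb MA.
Qed.

Definition all_settled (targets : seq lgraph) p q H (rs : seq (nat * nat)) :=
  forall r, r \in rs -> settled targets p q (insert2 r H).

(** The insertion at the image of a pair models the insertion at the pair
    itself, so whatever models the former models the latter. *)
Lemma close_settled targets p q H gens n qu se : all_settled targets p q H qu ->
  all_settled targets p q H se -> all_settled targets p q H (close n H gens qu se).
Proof.
elim: n qu se => [|n IH] [|r qu] se //= quP seP.
have newP x : x \in pmap (next_pair H r se) gens -> settled targets p q (insert2 x H).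
  rewrite mem_pmap => /mapP[sg _]; rewrite /next_pair; case: ifP => // _.
  case: ifP => // emb [->] R Gm w k A wk MA.
  have := quP r (mem_head _ _) R Gm w k A wk; apply.
  by case/orP: emb => emb; apply: embedsP emb MA.
apply: IH => x; rewrite mem_cat => /orP[] xin; [|exact: newP|exact: newP|exact: seP].
by apply: quP; rewrite inE xin orbT.
Qed.

Lemma cover_settled targets p q search H gens rs se :
  cover search p q H gens rs se -> all_settled targets p q H se ->
  all_settled targets p q H rs.
Proof.
elim: rs se => [|r rs IH] se //= ok seP.
suff [gr grs] : settled targets p q (insert2 r H) /\ all_settled targets p q H rs.
  by move=> x; rewrite inE => /predU1P[->|/grs].
case: ifP ok => [/hasP[x xin /andP[/eqnP E1 /eqnP E2]] ok|_ /andP[cert ok]].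
  by split; [rewrite /insert2 -E1 -E2; apply: seP|apply: IH ok seP].
have gr : settled targets p q (insert2 r H).
  by move=> R Gm w k A wk MA; left; apply: cert_bound cert wk MA.
split=> //; apply: IH ok _; apply: close_settled => x; rewrite inE.
  by move/eqP->.
by case/predU1P=> [->|/seP].
Qed.

Lemma check_parentP targets p q d f g : check_parent targets p q d ->
  (f <= g)%N -> (g < size (le (parent d)))%N ->
  settled targets p q (insert f g (parent d)).
Proof.
case/andP=> repsP ok fg gm; set H := parent d in ok gm *.
suff psP : all_settled targets p q H (map fst (reps d)).
  apply: (cover_settled ok _ (r := (f, g))); first exact: close_settled.
  apply/flattenP; exists [seq (f', g) | f' <- iota 0 g.+1].
    by apply/mapP; exists g; rewrite ?in_iota0.
  by apply/mapP; exists f; rewrite ?in_iota0.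
elim: (reps d) repsP => //= x rs IH /andP[/check_rep_settled gx /IH {}IH] r.
by rewrite inE => /predU1P[->|/IH].
Qed.

End Steps.

(** * The exceptional graphs *)

Local Open Scope nat_scope.

Definition L2 : seq lgraph := [:: theta].

(** Each list consists of cubic graphs of the Betti number in its name,
    written as insertions into members of the previous list. [L3] contains all
    insertions; [L4] to [L8] only those that violate the bounds [385/144],
    [35/12], [119/36], [7/2] and [23/6]. *)
Definition L3 : seq lgraph :=
  [:: insert 0 0 (nth loop1 L2 0);
      insert 0 1 (nth loop1 L2 0)].

Definition steps3 : seq step_data :=
  [:: StepData (nth loop1 L2 0)
   [::]
   [:: ((0, 0), Iso 0 [::]);
 ((0, 1), Iso 1 [::]);
 ((1, 1), Iso 0 [:: 0; 1; 2; 3]);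
 ((0, 2), Iso 1 [:: 0; 3; 1; 2]);
 ((1, 2), Iso 1 [:: 0; 3; 1; 2]);
 ((2, 2), Iso 0 [:: 0; 1; 2; 3])]].

Definition L4 : seq lgraph :=
  [:: insert 0 1 (nth loop1 L3 0);
      insert 1 1 (nth loop1 L3 0);
      insert 1 3 (nth loop1 L3 0);
      insert 1 3 (nth loop1 L3 1)].

Definition steps4 : seq step_data :=
  [:: StepData (nth loop1 L3 0)
   [:: [:: 3; 2; 1; 0]; [:: 1; 0; 3; 2]]
   [:: ((0, 1), Iso 0 [::]);
 ((1, 1), Iso 1 [::]);
 ((0, 2), Iso 0 [:: 0; 4; 3; 2; 1; 5]);
 ((1, 2), Iso 0 [:: 4; 1; 2; 3; 0; 5]);
 ((2, 2), Iso 1 [:: 0; 1; 2; 3; 4; 5]);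
 ((1, 3), Iso 2 [::]);
 ((2, 3), Iso 2 [:: 0; 4; 2; 5; 1; 3]);
 ((0, 4), Iso 1 [:: 4; 5; 0; 1; 2; 3]);
 ((2, 4), Iso 0 [:: 1; 5; 2; 3; 0; 4]);
 ((0, 5), Iso 0 [:: 2; 4; 1; 0; 3; 5]);
 ((1, 5), Iso 2 [:: 0; 4; 2; 5; 1; 3]);
 ((2, 5), Iso 2 [:: 0; 4; 2; 5; 1; 3]);
 ((3, 5), Iso 0 [:: 4; 3; 0; 1; 2; 5]);
 ((4, 5), Iso 0 [:: 3; 4; 0; 1; 2; 5]);
 ((5, 5), Iso 1 [:: 2; 3; 0; 1; 4; 5])];
  StepData (nth loop1 L3 1)
   [:: [:: 0; 3; 1; 2]; [:: 1; 3; 0; 2]]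
   [:: ((0, 0), Iso 0 [:: 1; 2; 4; 5; 0; 3]);
 ((0, 1), Iso 2 [:: 0; 5; 1; 3; 4; 2]);
 ((1, 3), Iso 3 [::])]].

Definition L5 : seq lgraph :=
  [:: insert 1 3 (nth loop1 L4 0);
      insert 2 3 (nth loop1 L4 2)].

Definition steps5 : seq step_data :=
  [:: StepData (nth loop1 L4 0)
   [:: [:: 0; 4; 3; 2; 1; 5]; [:: 5; 4; 3; 2; 1; 0]]
   [:: ((1, 3), Iso 0 [::]);
 ((1, 5), Iso 0 [:: 0; 6; 3; 7; 1; 5; 4; 2])];
  StepData (nth loop1 L4 1)
   [:: [:: 0; 1; 4; 5; 2; 3]; [:: 1; 0; 3; 2; 5; 4]]
   [::];
  StepData (nth loop1 L4 2)
   [:: [:: 3; 5; 1; 4; 2; 0]; [:: 0; 4; 2; 5; 1; 3]]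
   [:: ((1, 1), Pack 2 [:: [:: 9; 11]; [:: 9; 11]; [:: 3; 5; 7]; [:: 0; 2; 4; 5]; [:: 4; 6; 7;
       8]; [:: 0; 2; 3; 6; 8]]);
 ((2, 3), Iso 1 [::]);
 ((1, 4), Iso 0 [:: 1; 7; 2; 3; 0; 6; 4; 5])];
  StepData (nth loop1 L4 3)
   [:: [:: 1; 5; 0; 2; 3; 4]; [:: 5; 4; 1; 3; 2; 0]]
   [:: ((0, 1), Iso 0 [:: 3; 4; 0; 7; 1; 5; 2; 6]);
 ((1, 3), Iso 1 [:: 0; 7; 1; 5; 6; 4; 2; 3])]].

Definition L6 : seq lgraph :=
  [:: insert 0 1 (nth loop1 L5 0);
      insert 0 3 (nth loop1 L5 0);
      insert 2 3 (nth loop1 L5 0);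
      insert 3 3 (nth loop1 L5 0);
      insert 0 4 (nth loop1 L5 0);
      insert 2 4 (nth loop1 L5 0);
      insert 3 4 (nth loop1 L5 0);
      insert 3 5 (nth loop1 L5 0);
      insert 2 2 (nth loop1 L5 1);
      insert 3 6 (nth loop1 L5 1);
      insert 4 8 (nth loop1 L5 1)].

Definition steps6 : seq step_data :=
  [:: StepData (nth loop1 L5 0)
   [:: [:: 5; 6; 3; 7; 1; 0; 4; 2]; [:: 0; 4; 3; 2; 1; 5; 6; 7]]
   [:: ((0, 1), Iso 0 [::]);
 ((0, 3), Iso 1 [::]);
 ((2, 3), Iso 2 [::]);
 ((3, 3), Iso 3 [::]);
 ((0, 4), Iso 4 [::]);
 ((2, 4), Iso 5 [::]);
 ((3, 4), Iso 6 [::]);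
 ((3, 5), Iso 7 [::]);
 ((4, 5), Iso 7 [:: 0; 6; 8; 7; 1; 5; 4; 2; 9; 3]);
 ((4, 6), Iso 7 [:: 0; 4; 7; 9; 6; 5; 1; 8; 3; 2]);
 ((0, 7), Iso 4 [:: 8; 9; 7; 3; 6; 5; 4; 2; 0; 1]);
 ((2, 7), Iso 5 [:: 0; 9; 2; 3; 4; 5; 6; 7; 8; 1])];
  StepData (nth loop1 L5 1)
   [:: [:: 1; 5; 6; 7; 3; 2; 4; 0]; [:: 0; 7; 4; 5; 2; 3; 6; 1]]
   [:: ((0, 1), Iso 4 [:: 3; 5; 0; 9; 6; 7; 2; 8; 1; 4]);
 ((0, 2), Iso 4 [:: 3; 5; 9; 0; 6; 7; 2; 8; 1; 4]);
 ((2, 2), Iso 8 [::]);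
 ((1, 3), Iso 2 [:: 0; 7; 4; 5; 8; 9; 2; 3; 6; 1]);
 ((2, 3), Iso 1 [:: 1; 3; 9; 2; 7; 5; 4; 0; 6; 8]);
 ((0, 4), Iso 1 [:: 0; 4; 3; 5; 9; 1; 6; 7; 8; 2]);
 ((1, 4), Iso 1 [:: 1; 9; 2; 3; 0; 8; 4; 5; 6; 7]);
 ((3, 6), Iso 9 [::]);
 ((4, 8), Iso 10 [::])]].

Definition L7 : seq lgraph :=
  [:: insert 1 3 (nth loop1 L6 1);
      insert 2 3 (nth loop1 L6 1)].

Definition steps7 : seq step_data :=
  [:: StepData (nth loop1 L6 0)
   [:: [:: 2; 4; 9; 8; 6; 5; 1; 0; 7; 3]; [:: 0; 1; 7; 3; 6; 5; 4; 2; 9; 8]]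
   [:: ((2, 4), Pack 2 [:: [:: 0; 1; 14]; [:: 0; 1; 14]; [:: 3; 5; 10]; [:: 15; 16; 17]; [::
       15; 16; 17]; [:: 3; 6; 8; 9; 11]; [:: 5; 6; 8; 9; 10; 11]]);
 ((2, 7), Pack 2 [:: [:: 0; 1; 14]; [:: 0; 1; 14]; [:: 3; 5; 10]; [:: 15; 16; 17]; [:: 15; 16;
     17]; [:: 3; 6; 8; 9; 11]; [:: 5; 6; 8; 9; 10; 11]])];
  StepData (nth loop1 L6 1)
   [:: [:: 1; 0; 9; 8; 7; 6; 5; 4; 3; 2]; [:: 5; 6; 9; 7; 8; 0; 1; 3; 4; 2]]
   [:: ((0, 3), Pack 2 [:: [:: 1; 2; 7; 9]; [:: 14; 15; 16; 17]; [:: 1; 2; 4; 10; 11]; [:: 3;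
       5; 10; 13; 16]; [:: 3; 6; 12; 15; 17]; [:: 4; 5; 6; 7; 8]; [:: 8; 9; 11; 12; 13; 14]]);
 ((1, 3), Iso 0 [::]);
 ((2, 3), Iso 1 [::]);
 ((6, 13), Pack 4 [:: [:: 1; 2; 7; 9]; [:: 3; 13; 15; 17]; [:: 0; 1; 8; 9; 12]; [:: 0; 2; 7; 8;
     12]; [:: 1; 2; 4; 10; 11]; [:: 3; 5; 10; 13; 16]; [:: 3; 6; 12; 14; 15]; [:: 4; 7; 9; 10;
     11]; [:: 5; 10; 15; 16; 17]; [:: 6; 12; 13; 14; 17]; [:: 0; 1; 11; 13; 14; 16]; [:: 0; 2;
     3; 4; 5; 14]; [:: 4; 5; 6; 7; 8; 15]; [:: 6; 8; 9; 11; 16; 17]])];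
  StepData (nth loop1 L6 2)
   [:: [:: 3; 8; 6; 0; 7; 9; 2; 4; 1; 5]; [:: 5; 8; 2; 9; 4; 0; 6; 7; 1; 3]; [:: 0; 1; 7; 3; 6;
       5; 4; 2; 8; 9]]
   [:: ((1, 3), Iso 1 [:: 0; 1; 7; 3; 6; 5; 4; 2; 10; 11; 8; 9]);
 ((1, 5), Iso 0 [:: 1; 3; 2; 11; 9; 7; 6; 10; 8; 0; 5; 4]);
 ((6, 11), Pack 4 [:: [:: 0; 1; 8; 9]; [:: 3; 5; 10; 13]; [:: 0; 1; 6; 11; 17]; [:: 0; 2; 7; 8;
     12]; [:: 1; 2; 7; 9; 12]; [:: 3; 4; 5; 12; 14]; [:: 3; 13; 15; 16; 17]; [:: 4; 10; 12; 13;
     14]; [:: 5; 10; 15; 16; 17]; [:: 6; 8; 9; 11; 17]; [:: 0; 2; 3; 6; 14; 15]; [:: 1; 2; 11;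
     13; 14; 16]; [:: 4; 5; 6; 7; 8; 15]; [:: 4; 7; 9; 10; 11; 16]])];
  StepData (nth loop1 L6 3)
   [:: [:: 5; 1; 7; 3; 6; 0; 4; 2; 9; 8]; [:: 0; 1; 7; 3; 6; 5; 4; 2; 9; 8]]
   [::];
  StepData (nth loop1 L6 4)
   [:: [:: 1; 0; 2; 7; 4; 8; 9; 3; 5; 6]]
   [::];
  StepData (nth loop1 L6 5)
   [:: [:: 4; 7; 1; 9; 5; 6; 0; 8; 2; 3]; [:: 0; 1; 7; 3; 6; 5; 4; 2; 8; 9]]
   [::];
  StepData (nth loop1 L6 6)
   [:: [:: 3; 2; 6; 5; 7; 8; 9; 1; 0; 4]; [:: 0; 4; 9; 3; 1; 5; 6; 7; 8; 2]]
   [:: ((1, 3), Pack 2 [:: [:: 0; 2; 7; 8]; [:: 4; 10; 12; 14]; [:: 0; 1; 3; 6; 17]; [:: 1; 2;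
       7; 9; 15]; [:: 3; 4; 5; 14; 16]; [:: 11; 12; 15; 16; 17]; [:: 5; 6; 8; 9; 10; 11]])];
  StepData (nth loop1 L6 7)
   [:: [:: 5; 6; 2; 7; 4; 0; 1; 3; 9; 8]; [:: 0; 6; 2; 7; 4; 5; 1; 3; 9; 8]]
   [:: ((0, 14), Pack 4 [:: [:: 1; 2; 7; 9]; [:: 3; 5; 14; 16]; [:: 0; 1; 8; 9; 15]; [:: 0; 2;
       7; 8; 15]; [:: 1; 2; 4; 10; 11]; [:: 3; 5; 10; 12; 13]; [:: 3; 6; 14; 15; 17]; [:: 4; 7;
       9; 10; 11]; [:: 5; 6; 15; 16; 17]; [:: 10; 12; 13; 14; 16]; [:: 0; 1; 11; 12; 14; 17];
       [:: 0; 2; 4; 13; 16; 17]; [:: 3; 6; 8; 9; 11; 12]; [:: 4; 5; 6; 7; 8; 13]])];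
  StepData (nth loop1 L6 8)
   [:: [:: 6; 2; 1; 3; 7; 5; 0; 4; 9; 8]; [:: 0; 7; 4; 5; 2; 3; 6; 1; 8; 9]]
   [::];
  StepData (nth loop1 L6 9)
   [:: [:: 2; 9; 3; 1; 0; 6; 8; 7; 5; 4]; [:: 5; 2; 7; 8; 4; 9; 3; 1; 6; 0]]
   [:: ((0, 0), Pack 2 [:: [:: 15; 17]; [:: 15; 17]; [:: 1; 2; 6; 9; 13]; [:: 1; 2; 8; 10; 11];
       [:: 3; 4; 5; 13; 14]; [:: 4; 7; 9; 10; 11]; [:: 3; 5; 6; 7; 8; 14]]);
 ((1, 4), Iso 0 [:: 0; 10; 5; 4; 3; 11; 1; 9; 2; 8; 6; 7])];
  StepData (nth loop1 L6 10)
   [:: [:: 2; 6; 3; 8; 0; 9; 7; 5; 1; 4]; [:: 0; 7; 4; 9; 2; 8; 6; 1; 5; 3]]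
   [:: ((4, 8), Pack 2 [:: [:: 0; 2; 3; 11]; [:: 1; 2; 6; 9]; [:: 3; 5; 7; 10]; [:: 14; 15; 16;
       17]; [:: 4; 7; 13; 14; 15]; [:: 0; 1; 4; 5; 8; 17]; [:: 6; 8; 9; 10; 11; 13; 16]]);
 ((1, 9), Pack 2 [:: [:: 0; 2; 3; 11]; [:: 1; 2; 9; 17]; [:: 3; 5; 7; 10]; [:: 4; 7; 13; 14];
     [:: 6; 8; 12; 14]; [:: 6; 15; 16; 17]; [:: 0; 1; 4; 5; 8; 9; 10; 11; 12; 13; 15; 16]])]].

Definition L8 : seq lgraph :=
  [:: insert 0 3 (nth loop1 L7 0);
      insert 1 3 (nth loop1 L7 0);
      insert 2 3 (nth loop1 L7 0);
      insert 3 4 (nth loop1 L7 0);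
      insert 0 5 (nth loop1 L7 0);
      insert 1 5 (nth loop1 L7 0);
      insert 3 7 (nth loop1 L7 0);
      insert 2 8 (nth loop1 L7 0);
      insert 7 16 (nth loop1 L7 0);
      insert 3 4 (nth loop1 L7 1);
      insert 4 6 (nth loop1 L7 1)].

Definition steps8 : seq step_data :=
  [:: StepData (nth loop1 L7 0)
   [:: [:: 2; 11; 6; 10; 7; 9; 8; 0; 3; 1; 4; 5]; [:: 0; 1; 7; 3; 6; 5; 4; 2; 10; 11; 8; 9]]
   [:: ((0, 1), Pack 6 [:: [:: 0; 1; 20]; [:: 0; 1; 20]; [:: 0; 1; 20]; [:: 3; 5; 10; 13; 16];
       [:: 3; 6; 12; 14; 16]; [:: 3; 6; 12; 14; 16]; [:: 4; 5; 6; 7; 8]; [:: 4; 5; 6; 7; 8];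
       [:: 4; 7; 9; 10; 11]; [:: 11; 13; 15; 16; 17]; [:: 11; 13; 15; 16; 17]; [:: 0; 2; 7; 8;
       12; 18]; [:: 1; 2; 7; 9; 15; 19]; [:: 1; 2; 7; 9; 15; 19]; [:: 3; 5; 10; 11; 15; 17];
       [:: 5; 6; 8; 9; 10; 11]; [:: 8; 9; 11; 12; 13; 14]; [:: 14; 16; 17; 18; 19; 20]; [:: 0;
       2; 4; 10; 13; 14; 18]; [:: 0; 2; 4; 10; 13; 14; 18]; [:: 1; 2; 3; 4; 5; 17; 19]; [:: 3;
       6; 12; 17; 18; 19; 20]; [:: 8; 9; 12; 15; 18; 19; 20]]);
 ((0, 2), Pack 6 [:: [:: 0; 2; 20]; [:: 0; 2; 20]; [:: 0; 2; 20]; [:: 3; 5; 10; 13; 16]; [:: 3;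
     5; 10; 13; 16]; [:: 3; 6; 12; 14; 16]; [:: 4; 5; 6; 7; 8]; [:: 4; 7; 9; 10; 11]; [:: 4; 7;
     9; 10; 11]; [:: 11; 13; 15; 16; 17]; [:: 0; 1; 14; 16; 17; 18]; [:: 0; 1; 14; 16; 17; 18];
     [:: 1; 2; 7; 9; 15; 19]; [:: 3; 6; 8; 9; 15; 17]; [:: 3; 6; 8; 9; 15; 17]; [:: 5; 6; 10;
     12; 13; 14]; [:: 7; 8; 12; 18; 19; 20]; [:: 7; 8; 12; 18; 19; 20]; [:: 8; 9; 11; 12; 13;
     14]; [:: 0; 1; 11; 13; 14; 15; 18]; [:: 1; 2; 3; 4; 5; 17; 19]; [:: 1; 2; 4; 10; 11; 15;
     19]; [:: 4; 5; 6; 12; 18; 19; 20]]);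
 ((0, 3), Iso 0 [::]);
 ((1, 3), Iso 1 [::]);
 ((2, 3), Iso 2 [::]);
 ((2, 4), Pack 6 [:: [:: 18; 19; 20]; [:: 18; 19; 20]; [:: 18; 19; 20]; [:: 0; 1; 14; 16; 17];
     [:: 3; 5; 10; 13; 16]; [:: 3; 6; 12; 14; 16]; [:: 3; 6; 12; 14; 16]; [:: 11; 13; 15; 16;
     17]; [:: 11; 13; 15; 16; 17]; [:: 0; 1; 8; 9; 12; 15]; [:: 0; 1; 11; 13; 14; 15]; [:: 0;
     2; 7; 8; 12; 18]; [:: 0; 2; 7; 8; 12; 18]; [:: 1; 2; 7; 9; 15; 18]; [:: 3; 6; 8; 9; 15;
     17]; [:: 4; 5; 6; 7; 8; 19]; [:: 4; 7; 9; 10; 11; 19]; [:: 4; 7; 9; 10; 11; 19]; [:: 5; 6;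
     8; 9; 10; 11]; [:: 5; 6; 10; 12; 13; 14]; [:: 0; 2; 4; 10; 13; 14; 20]; [:: 1; 2; 3; 4; 5;
     17; 20]; [:: 1; 2; 3; 4; 5; 17; 20]]);
 ((3, 4), Iso 3 [::]);
 ((0, 5), Iso 4 [::]);
 ((1, 5), Iso 5 [::]);
 ((0, 6), Iso 3 [:: 6; 5; 12; 13; 0; 1; 3; 2; 10; 11; 7; 9; 8; 4]);
 ((4, 6), Pack 6 [:: [:: 4; 5; 19; 20]; [:: 4; 5; 19; 20]; [:: 4; 5; 19; 20]; [:: 0; 1; 14; 16;
     17]; [:: 0; 1; 14; 16; 17]; [:: 0; 2; 7; 8; 12]; [:: 1; 2; 7; 9; 15]; [:: 1; 2; 7; 9; 15];
     [:: 3; 5; 10; 13; 16]; [:: 3; 5; 10; 13; 16]; [:: 6; 7; 8; 18; 20]; [:: 6; 7; 8; 18; 20];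
     [:: 11; 13; 15; 16; 17]; [:: 0; 2; 6; 12; 18; 20]; [:: 3; 5; 10; 11; 15; 17]; [:: 3; 6;
     12; 14; 16; 19]; [:: 4; 7; 9; 10; 11; 18]; [:: 8; 9; 11; 12; 13; 14]; [:: 8; 9; 11; 12;
     13; 14]; [:: 0; 1; 3; 6; 12; 17; 19]; [:: 0; 2; 4; 10; 13; 14; 18]; [:: 1; 2; 4; 10; 11;
     15; 18]; [:: 3; 6; 8; 9; 15; 17; 19]]);
 ((0, 7), Iso 1 [:: 10; 11; 3; 2; 7; 9; 8; 4; 6; 5; 12; 13; 0; 1]);
 ((2, 7), Pack 6 [:: [:: 18; 19; 20]; [:: 18; 19; 20]; [:: 18; 19; 20]; [:: 0; 1; 14; 16; 17];
     [:: 0; 1; 14; 16; 17]; [:: 3; 5; 10; 13; 16]; [:: 3; 5; 10; 13; 16]; [:: 3; 6; 12; 14;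
     16]; [:: 11; 13; 15; 16; 17]; [:: 0; 1; 3; 6; 12; 17]; [:: 0; 2; 7; 8; 12; 20]; [:: 1; 2;
     7; 9; 15; 20]; [:: 1; 2; 7; 9; 15; 20]; [:: 3; 5; 10; 11; 15; 17]; [:: 3; 6; 8; 9; 15;
     17]; [:: 4; 5; 6; 7; 8; 19]; [:: 4; 5; 6; 7; 8; 19]; [:: 4; 7; 9; 10; 11; 19]; [:: 8; 9;
     11; 12; 13; 14]; [:: 8; 9; 11; 12; 13; 14]; [:: 0; 2; 4; 5; 6; 12; 18]; [:: 0; 2; 4; 10;
     13; 14; 18]; [:: 1; 2; 4; 10; 11; 15; 18]]);
 ((3, 7), Iso 6 [::]);
 ((2, 8), Iso 7 [::]);
 ((7, 16), Iso 8 [::])];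
  StepData (nth loop1 L7 1)
   [:: [:: 2; 8; 6; 0; 7; 9; 11; 10; 3; 1; 4; 5]; [:: 0; 11; 3; 2; 7; 9; 8; 4; 6; 5; 10; 1]]
   [:: ((0, 1), Pack 8 [:: [:: 0; 1; 20]; [:: 0; 1; 20]; [:: 0; 1; 20]; [:: 0; 1; 20]; [:: 3;
       4; 5; 15; 17]; [:: 3; 4; 5; 15; 17]; [:: 3; 5; 10; 13; 16]; [:: 3; 5; 10; 13; 16]; [::
       3; 6; 12; 14; 16]; [:: 3; 6; 12; 14; 16]; [:: 4; 5; 6; 7; 8]; [:: 4; 5; 6; 7; 8]; [:: 4;
       7; 9; 10; 11]; [:: 4; 7; 9; 10; 11]; [:: 0; 2; 14; 16; 17; 18]; [:: 0; 2; 14; 16; 17;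
       18]; [:: 1; 2; 7; 9; 15; 19]; [:: 1; 2; 7; 9; 15; 19]; [:: 3; 6; 7; 8; 15; 17]; [:: 4;
       10; 13; 15; 16; 17]; [:: 5; 6; 8; 9; 10; 11]; [:: 5; 6; 10; 12; 13; 14]; [:: 8; 9; 11;
       12; 13; 14]; [:: 8; 9; 12; 18; 19; 20]; [:: 8; 9; 12; 18; 19; 20]; [:: 11; 13; 14; 18;
       19; 20]; [:: 11; 13; 14; 18; 19; 20]; [:: 0; 2; 3; 6; 12; 17; 18]; [:: 0; 2; 7; 8; 12;
       15; 18]; [:: 1; 2; 4; 10; 11; 15; 19]; [:: 1; 2; 11; 13; 16; 17; 19]]);
 ((0, 2), Pack 8 [:: [:: 0; 2; 20]; [:: 0; 2; 20]; [:: 0; 2; 20]; [:: 0; 2; 20]; [:: 3; 4; 5;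
     15; 17]; [:: 3; 4; 5; 15; 17]; [:: 3; 5; 10; 13; 16]; [:: 3; 5; 10; 13; 16]; [:: 3; 6; 12;
     14; 16]; [:: 3; 6; 12; 14; 16]; [:: 4; 5; 6; 7; 8]; [:: 4; 5; 6; 7; 8]; [:: 4; 7; 9; 10;
     11]; [:: 4; 7; 9; 10; 11]; [:: 0; 1; 8; 9; 12; 18]; [:: 0; 1; 8; 9; 12; 18]; [:: 0; 1; 11;
     13; 14; 18]; [:: 0; 1; 11; 13; 14; 18]; [:: 1; 2; 7; 9; 15; 19]; [:: 1; 2; 7; 9; 15; 19];
     [:: 3; 6; 7; 8; 15; 17]; [:: 4; 10; 13; 15; 16; 17]; [:: 5; 6; 8; 9; 10; 11]; [:: 5; 6;
     10; 12; 13; 14]; [:: 8; 9; 11; 12; 13; 14]; [:: 14; 16; 17; 18; 19; 20]; [:: 14; 16; 17;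
     18; 19; 20]; [:: 1; 2; 4; 10; 11; 15; 19]; [:: 1; 2; 11; 13; 16; 17; 19]; [:: 3; 6; 12;
     17; 18; 19; 20]; [:: 7; 8; 12; 15; 18; 19; 20]]);
 ((0, 3), Iso 2 [:: 3; 13; 8; 12; 9; 11; 10; 0; 7; 6; 1; 5; 2; 4]);
 ((1, 3), Iso 6 [:: 2; 13; 0; 12; 8; 9; 7; 6; 4; 5; 3; 1; 10; 11]);
 ((2, 3), Iso 3 [:: 5; 1; 13; 11; 2; 3; 7; 9; 4; 8; 6; 0; 12; 10]);
 ((3, 4), Iso 9 [::]);
 ((2, 5), Iso 4 [:: 4; 8; 10; 9; 12; 0; 6; 7; 13; 3; 5; 1; 2; 11]);
 ((2, 6), Iso 0 [:: 9; 11; 12; 10; 13; 2; 3; 1; 4; 5; 7; 6; 8; 0]);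
 ((4, 6), Iso 10 [::]);
 ((2, 7), Pack 6 [:: [:: 15; 18; 19; 20]; [:: 15; 18; 19; 20]; [:: 15; 18; 19; 20]; [:: 0; 1;
     8; 9; 12]; [:: 0; 1; 11; 13; 14]; [:: 0; 1; 11; 13; 14]; [:: 1; 2; 7; 9; 20]; [:: 1; 2; 7;
     9; 20]; [:: 3; 4; 5; 15; 17]; [:: 3; 4; 5; 15; 17]; [:: 3; 5; 10; 13; 16]; [:: 3; 6; 12;
     14; 16]; [:: 3; 6; 12; 14; 16]; [:: 0; 2; 7; 8; 12; 20]; [:: 0; 2; 14; 16; 17; 18]; [:: 4;
     5; 6; 7; 8; 19]; [:: 4; 5; 6; 7; 8; 19]; [:: 4; 7; 9; 10; 11; 19]; [:: 4; 10; 13; 15; 16;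
     17]; [:: 5; 6; 8; 9; 10; 11]; [:: 8; 9; 11; 12; 13; 14]; [:: 0; 2; 3; 6; 12; 17; 18]; [::
     1; 2; 11; 13; 16; 17; 18]]);
 ((2, 8), Pack 6 [:: [:: 0; 1; 11; 13; 14]; [:: 0; 1; 11; 13; 14]; [:: 0; 2; 8; 12; 20]; [:: 0;
     2; 8; 12; 20]; [:: 1; 2; 9; 19; 20]; [:: 3; 4; 5; 15; 17]; [:: 3; 4; 5; 15; 17]; [:: 3; 5;
     10; 13; 16]; [:: 3; 6; 12; 14; 16]; [:: 3; 6; 12; 14; 16]; [:: 4; 7; 9; 10; 11]; [:: 4; 7;
     9; 10; 11]; [:: 7; 15; 18; 19; 20]; [:: 7; 15; 18; 19; 20]; [:: 0; 1; 8; 9; 12; 19]; [::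
     0; 2; 14; 16; 17; 18]; [:: 1; 2; 7; 9; 15; 18]; [:: 3; 6; 8; 17; 18; 20]; [:: 4; 5; 6; 7;
     8; 19]; [:: 4; 10; 13; 15; 16; 17]; [:: 5; 6; 10; 12; 13; 14]; [:: 1; 2; 11; 13; 16; 17;
     18]; [:: 5; 6; 8; 9; 10; 11; 19]]);
 ((6, 10), Iso 9 [:: 0; 1; 12; 13; 4; 5; 6; 7; 8; 9; 10; 11; 2; 3])]].

Definition steps9 : seq step_data :=
  [:: StepData (nth loop1 L8 0)
   [:: [:: 0; 12; 4; 8; 2; 13; 11; 9; 3; 7; 10; 6; 1; 5]]
   [::];
  StepData (nth loop1 L8 1)
   [::]
   [::];
  StepData (nth loop1 L8 2)
   [:: [:: 5; 10; 9; 11; 8; 0; 12; 13; 4; 2; 1; 3; 6; 7]; [:: 2; 11; 0; 10; 8; 9; 7; 6; 4; 5;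
       3; 1; 13; 12]]
   [::];
  StepData (nth loop1 L8 3)
   [:: [:: 10; 11; 3; 2; 7; 9; 8; 4; 6; 5; 0; 1; 13; 12]]
   [::];
  StepData (nth loop1 L8 4)
   [:: [:: 7; 6; 2; 10; 4; 5; 1; 0; 8; 12; 3; 13; 9; 11]; [:: 3; 1; 8; 0; 4; 5; 6; 10; 2; 11;
       7; 9; 13; 12]]
   [::];
  StepData (nth loop1 L8 5)
   [:: [:: 9; 11; 5; 2; 6; 10; 12; 13; 7; 3; 0; 1; 8; 4]; [:: 0; 1; 2; 5; 13; 3; 7; 6; 12; 10;
       9; 11; 8; 4]]
   [:: ((2, 3), Pack 2 [:: [:: 4; 7; 9; 10; 11]; [:: 11; 13; 15; 16; 17]; [:: 0; 2; 7; 8; 12;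
       21]; [:: 1; 2; 17; 18; 22; 23]; [:: 3; 4; 5; 19; 21; 23]; [:: 3; 6; 12; 14; 16; 22]; [::
       0; 1; 10; 13; 14; 19; 20]; [:: 5; 6; 8; 9; 15; 18; 20]]);
 ((3, 4), Pack 2 [:: [:: 0; 2; 7; 8; 12]; [:: 3; 4; 5; 19; 23]; [:: 11; 13; 15; 16; 17]; [:: 3;
     6; 12; 14; 16; 21]; [:: 4; 7; 9; 10; 11; 22]; [:: 0; 1; 10; 13; 14; 19; 20]; [:: 1; 2; 17;
     18; 21; 22; 23]; [:: 5; 6; 8; 9; 15; 18; 20]])];
  StepData (nth loop1 L8 6)
   [:: [:: 3; 7; 10; 6; 0; 8; 4; 5; 1; 13; 2; 12; 11; 9]; [:: 1; 0; 9; 8; 7; 6; 5; 4; 3; 2; 13;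
       12; 11; 10]]
   [::];
  StepData (nth loop1 L8 7)
   [:: [:: 3; 12; 10; 0; 6; 13; 4; 8; 7; 9; 2; 11; 1; 5]; [:: 4; 5; 10; 6; 0; 1; 3; 7; 8; 9; 2;
       11; 13; 12]]
   [::];
  StepData (nth loop1 L8 8)
   [:: [:: 2; 11; 9; 13; 8; 0; 1; 12; 4; 5; 3; 7; 10; 6]; [:: 11; 2; 5; 4; 12; 1; 0; 8; 13; 9;
       10; 6; 3; 7]]
   [::];
  StepData (nth loop1 L8 9)
   [:: [:: 0; 11; 3; 2; 7; 9; 8; 4; 6; 5; 10; 1; 13; 12]]
   [::];
  StepData (nth loop1 L8 10)
   [:: [:: 0; 11; 12; 13; 7; 9; 8; 4; 6; 5; 10; 1; 2; 3]]
   [::]].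

(** Packings for the graphs of [L2], [L6] and [L7], of values [3/2], [3] and
    [10/3]. Half-integral values jump from 3 to [7/2], which the graphs of
    [L7] do not reach, so that their packings have larger denominators. *)
Definition packs2 : seq (nat * seq (seq nat)) :=
  [:: (2, [:: [:: 0; 1]; [:: 0; 2]; [:: 1; 2]])].

Definition packs6 : seq (nat * seq (seq nat)) :=
  [:: (2, [:: [:: 0; 1; 14]; [:: 0; 1; 14]; [:: 3; 5; 10]; [:: 3; 6; 8; 9; 11]; [:: 4; 5; 6; 7;
      8]; [:: 4; 7; 9; 10; 11]]);
      (2, [:: [:: 1; 2; 7; 9]; [:: 3; 5; 10; 13]; [:: 3; 6; 12; 14]; [:: 0; 1; 8; 9; 12]; [::
          4; 5; 6; 7; 8]; [:: 0; 2; 4; 10; 13; 14]]);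
      (2, [:: [:: 0; 1; 8; 9]; [:: 3; 5; 10; 13]; [:: 0; 2; 3; 6; 14]; [:: 1; 2; 7; 9; 12]; [::
          4; 5; 6; 7; 8]; [:: 4; 10; 12; 13; 14]]);
      (2, [:: [:: 12; 14]; [:: 12; 14]; [:: 0; 1; 8; 9]; [:: 0; 2; 7; 8]; [:: 1; 2; 4; 10; 11];
          [:: 4; 7; 9; 10; 11]]);
      (2, [:: [:: 3; 5; 10]; [:: 3; 5; 10]; [:: 0; 2; 13; 14]; [:: 1; 2; 7; 9]; [:: 0; 1; 8; 9;
          12]; [:: 7; 8; 12; 13; 14]]);
      (1, [:: [:: 3; 5; 10]; [:: 12; 13; 14]; [:: 0; 1; 8; 9]]);
      (2, [:: [:: 0; 1; 8; 9]; [:: 0; 2; 7; 8]; [:: 1; 2; 7; 9]; [:: 3; 4; 5; 14]; [:: 3; 5;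
          10; 12]; [:: 4; 10; 12; 14]]);
      (2, [:: [:: 3; 5; 14]; [:: 3; 5; 14]; [:: 0; 1; 8; 9]; [:: 0; 2; 7; 8]; [:: 1; 2; 4; 10;
          11]; [:: 4; 7; 9; 10; 11]]);
      (2, [:: [:: 12; 14]; [:: 12; 14]; [:: 3; 5; 7; 10]; [:: 4; 6; 7; 8]; [:: 0; 1; 3; 8; 10];
          [:: 0; 1; 4; 5; 6]]);
      (2, [:: [:: 0; 1; 3; 6; 14]; [:: 0; 2; 4; 5; 9]; [:: 1; 2; 8; 10; 11]; [:: 3; 5; 7; 10;
          12]; [:: 4; 6; 7; 8; 13]; [:: 9; 11; 12; 13; 14]]);
      (2, [:: [:: 0; 2; 3; 11]; [:: 1; 2; 6; 9]; [:: 3; 5; 7; 10]; [:: 4; 7; 13; 14]; [:: 6; 8;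
          12; 14]; [:: 0; 1; 4; 5; 8; 9; 10; 11; 12; 13]])].

Definition packs7 : seq (nat * seq (seq nat)) :=
  [:: (6, [:: [:: 0; 1; 14; 16; 17]; [:: 0; 1; 14; 16; 17]; [:: 0; 2; 7; 8; 12]; [:: 1; 2; 7;
      9; 15]; [:: 1; 2; 7; 9; 15]; [:: 3; 5; 10; 13; 16]; [:: 3; 5; 10; 13; 16]; [:: 3; 6; 12;
      14; 16]; [:: 4; 5; 6; 7; 8]; [:: 4; 5; 6; 7; 8]; [:: 4; 7; 9; 10; 11]; [:: 11; 13; 15;
      16; 17]; [:: 0; 1; 3; 6; 12; 17]; [:: 0; 2; 4; 5; 6; 12]; [:: 0; 2; 4; 10; 13; 14]; [::
      1; 2; 4; 10; 11; 15]; [:: 3; 5; 10; 11; 15; 17]; [:: 3; 6; 8; 9; 15; 17]; [:: 8; 9; 11;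
      12; 13; 14]; [:: 8; 9; 11; 12; 13; 14]]);
      (8, [:: [:: 0; 1; 8; 9; 12]; [:: 0; 1; 8; 9; 12]; [:: 0; 1; 11; 13; 14]; [:: 0; 1; 11;
          13; 14]; [:: 0; 2; 14; 16; 17]; [:: 0; 2; 14; 16; 17]; [:: 1; 2; 7; 9; 15]; [:: 1; 2;
          7; 9; 15]; [:: 3; 4; 5; 15; 17]; [:: 3; 4; 5; 15; 17]; [:: 3; 5; 10; 13; 16]; [:: 3;
          5; 10; 13; 16]; [:: 3; 6; 12; 14; 16]; [:: 3; 6; 12; 14; 16]; [:: 4; 5; 6; 7; 8]; [::
          4; 5; 6; 7; 8]; [:: 4; 7; 9; 10; 11]; [:: 4; 7; 9; 10; 11]; [:: 0; 2; 3; 6; 12; 17];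
          [:: 0; 2; 7; 8; 12; 15]; [:: 1; 2; 4; 10; 11; 15]; [:: 1; 2; 11; 13; 16; 17]; [:: 3;
          6; 7; 8; 15; 17]; [:: 4; 10; 13; 15; 16; 17]; [:: 5; 6; 8; 9; 10; 11]; [:: 5; 6; 10;
          12; 13; 14]; [:: 8; 9; 11; 12; 13; 14]])].

Lemma ok3 : all (check_parent L3 3 1) steps3.
Proof. by vm_compute. Qed.

Lemma ok4 : all (check_parent L4 385 144) steps4.
Proof. by vm_compute. Qed.

Lemma ok5 : all (check_parent L5 35 12) steps5.
Proof. by vm_compute. Qed.

Lemma ok6 : all (check_parent L6 119 36) steps6.
Proof. by vm_compute. Qed.

Lemma ok7 : all (check_parent L7 7 2) steps7.
Proof. by vm_compute. Qed.

Lemma ok8 : all (check_parent L8 23 6) steps8.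
Proof. by vm_compute. Qed.

Lemma ok9 : all (check_parent [::] 4 1) steps9.
Proof. by vm_compute. Qed.

Local Open Scope ring_scope.

(** * Lower bounds for the weight *)

Lemma step_of (targets parents : seq lgraph) p q ds :
  all (check_parent targets p q) ds -> map parent ds = parents ->
  forall i f g, (i < size parents)%N -> (f <= g)%N ->
    (g < size (le (nth loop1 parents i)))%N ->
    settled targets p q (insert f g (nth loop1 parents i)).
Proof.
move=> ok <- i f g; rewrite size_map => im fg.
rewrite (nth_map (StepData loop1 [::] [::])) // => gm.
apply: check_parentP fg gm; move: im; have /(all_nthP (StepData loop1 [::] [::])) := ok.
by apply.
Qed.

Definition has_betti (k : nat) (H : lgraph) : bool :=
  [&& wf H, (0 < nv H)%N & (nv H + k <= (size (le H)).+1)%N].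

Section Bounds.
Variable R : realFieldType.

Definition bound (b : nat) (c : R) : Prop :=
  forall (Gm : pgraph) (w : pE Gm -> R) (k : R) (A : pred (pE Gm)),
    normed w k -> betti_ge A b -> c * k <= wt w A.

Definition bound_or (b : nat) (c : R) (T : seq lgraph) : Prop :=
  forall (Gm : pgraph) (w : pE Gm -> R) (k : R) (A : pred (pE Gm)),
    normed w k -> betti_ge A b -> c * k <= wt w A \/
    exists2 j, (j < size T)%N & has_model A (nth loop1 T j).

Lemma bound1 : bound 1 1.
Proof.
move=> Gm w k A [w0 k0 wk] bA; have [//|c [cc nc cA]] := bA [::].
rewrite mul1r; apply: le_trans (wk c cc nc) _.
by apply: wt_le => // e ein ce; case/andP: (cA e ein ce).
Qed.

Lemma split_bound (Gm : pgraph) (w : pE Gm -> R) k (A : pred (pE Gm)) b j c1 c2 :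
  normed w k -> split_off A b j -> bound j c1 -> bound (b - j) c2 ->
  (c1 + c2) * k <= wt w A.
Proof.
move=> wk [U1 [U2 [b1 b2 UA1 UA2]]] B1 B2; rewrite mulrDl.
apply: le_trans (lerD (B1 _ _ _ _ wk b1) (B2 _ _ _ _ wk b2)) _.
case: wk => w0 _ _; rewrite !wt_count -big_split /= big_seq [leRHS]big_seq.
apply: ler_sum => e ein; rewrite -mulrnDr; apply: ler_wpMn2l => //.
case: (boolP (U1 e)) => [/(UA1 _ ein)/andP[-> /negPf->]//|_].
by case: (boolP (U2 e)) => // /(UA2 _ ein)->.
Qed.

(** It suffices to treat the cubic graphs generated from theta, provided that
    [c] does not exceed the sum of the bounds of the two parts of any
    splitting. *)
Lemma grow_bound_or b c T : (2 <= b)%N ->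
  (forall j, (0 < j < b)%N -> exists c1 c2,
     [/\ bound j c1, bound (b - j) c2 & c <= c1 + c2]) ->
  (forall H w k, reach b H -> @normed R (pg H) w k ->
     c * k <= @wt R (pg H) w predT \/
     exists2 j, (j < size T)%N & @has_model (pg H) predT (nth loop1 T j)) ->
  bound_or b c T.
Proof.
move=> b2 stuck grown Gm w k A wk bA.
case: (grow bA b2) => [[j [jb /split_bound spl]]|[H [rH [h [P M]]]]].
  have [c1 [c2 [B1 B2 cc]]] := stuck j jb; left.
  apply: le_trans (spl _ _ _ _ wk B1 B2).
  by apply: ler_wpM2r => //; case: wk.
have [le|[j jT MT]] := grown H _ _ rH (model_normed M wk); [left|right].
  by apply: le_trans le _; apply: (wt_mu_le M); case: wk.
by exists j => //; apply: has_model_comp MT; exists h, P.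
Qed.

Lemma bound_or_nil b c : bound_or b c [::] -> bound b c.
Proof. by move=> B Gm w k A wk bA; case: (B Gm w k A wk bA) => // -[]. Qed.

(** Put one ear back onto a model of a listed graph: either a cycle disjoint
    from the model adds 1 to the bound of the model, or an insertion into the
    listed graph appears, and insertions have been settled. *)
Lemma one_ear (Gm : pgraph) (w : pE Gm -> R) k (A B : pred (pE Gm)) c e0
    (L T : seq lgraph) p q b c0 i :
  normed w k -> (forall e, e \in pes Gm -> B e -> A e) ->
  cyc c -> e0 \in pes Gm -> c e0 != 0 -> ~~ B e0 ->
  (forall e, e \in pes Gm -> c e != 0 -> A e) ->
  (forall i f g, (i < size L)%N -> (f <= g)%N ->
    (g < size (le (nth loop1 L i)))%N -> settled T p q (insert f g (nth loop1 L i))) ->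
  all (has_betti b) L -> bound b c0 ->
  (i < size L)%N -> has_model B (nth loop1 L i) ->
  [\/ p%:R * k <= q%:R * wt w A, (c0 + 1) * k <= wt w A |
      exists2 j, (j < size T)%N & has_model A (nth loop1 T j)].
Proof.
move=> wk BA cc e0in ce0 nB cA stepL bL B0 iL [h [P M]].
have /(all_nthP loop1)/(_ i iL)/and3P[wH n0 szH] := bL.
have bH := betti_ge_euler wH n0 szH.
case: (ear_step M wH BA wk cc e0in ce0 nB cA) => [le|[f [g [fg gm MA]]]].
  apply: Or32; apply: le_trans le; rewrite mulrDl mul1r lerD2r.
  exact: B0 (model_normed M wk) bH.
have [?|?] := stepL i f g iL fg gm R Gm w k A wk MA; [exact: Or31|exact: Or33].
Qed.

Section CubicGraph.
Variables (b : nat) (H : lgraph) (w : nat -> R) (k : R).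
Hypotheses (rH : reach b H) (wk : @normed R (pg H) w k).
Let cH := reach_cubic rH.
Notation W := (@wt R (pg H) w predT).

Lemma wt_drop z : (z < size (le H))%N -> W = @wt R (pg H) w (predC1 z) + w z.
Proof.
move=> zm; rewrite /wt (bigD1_seq z) /= ?in_iota0 ?iota_uniq // addrC.
by congr (_ + _); apply: eq_bigl.
Qed.

Variables (x y z : nat).
Hypothesis st : star_at b H w x y z.

Lemma wt_star : W = @wt R (pg H) w (fun i => i \notin [:: x; y; z]) + (w x + w y + w z).
Proof.
case: st => /and3P[xy xz yz] /and3P[xm ym zm] _ _ _.
have us : uniq [:: x; y; z] by rewrite /= !inE negb_or xy xz yz.
have sub : {subset [:: x; y; z] <= pes (pg H)}.
  by move=> i; rewrite in_iota0 !inE => /or3P[] /eqP->.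
have := sum_count (Gm := pg H) w (pes_uniq (pg H)) sub.
rewrite !big_cons big_nil addr0 addrA => <-.
rewrite !wt_count -big_split; apply: eq_bigr => i _.
by rewrite -[RHS]mulrnDr count_uniq_mem //; case: (i \in _).
Qed.

Lemma chain_z : exists2 c, @cyc (pg H) c & c z != 0.
Proof. by case: st => _ /and3P[_ _ zm] _ _ _; apply: (cubic_bridgeless cH). Qed.

(** There are cycles through [x] and through [y]; as closed chains sum to zero
    on the star, one of them or their sum avoids [z] and passes through [x]. *)
Lemma chain_xz : exists c, [/\ @cyc (pg H) c, c x != 0 & c z = 0].
Proof.
case: st => _ /and3P[xm ym zm] _ _ cyc0.
have [c1 cc1 c1x] := cubic_bridgeless cH xm.
have [c1z|c1z] := eqVneq (c1 z) 0; first by exists c1.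
have [c2 cc2 c2y] := cubic_bridgeless cH ym.
have [E1 E2] := (cyc0 _ cc1, cyc0 _ cc2).
have [c2z|c2z] := eqVneq (c2 z) 0.
  exists c2; split=> //; move: E2; rewrite c2z addr0 => /F2_addr0_eq ->; exact: c2y.
exists (fun e => c1 e + c2 e); split; first exact: cyc_add.
  move: E2; rewrite (F2_neq0 c2y) (F2_neq0 c2z) -addrA F2_dbl addr0 => ->.
  by rewrite addr0.
by rewrite (F2_neq0 c1z) (F2_neq0 c2z) F2_dbl.
Qed.

(** A model that avoids the star is extended twice: by an ear through the star
    that avoids its heaviest edge [z], and then by an ear through [z]. Leaving out
    the heaviest edge in the first step makes the weaker bound [p1 / q1] enough. *)
Lemma two_ears (L T1 T2 : seq lgraph) p1 q1 p2 q2 c0 c1 i :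
  (forall i f g, (i < size L)%N -> (f <= g)%N ->
    (g < size (le (nth loop1 L i)))%N -> settled T1 p1 q1 (insert f g (nth loop1 L i))) ->
  (forall i f g, (i < size T1)%N -> (f <= g)%N ->
    (g < size (le (nth loop1 T1 i)))%N -> settled T2 p2 q2 (insert f g (nth loop1 T1 i))) ->
  all (has_betti b.-2) L -> all (has_betti b.-1) T1 ->
  bound b.-2 c0 -> bound b.-1 c1 ->
  (i < size L)%N -> @has_model (pg H) (fun i => i \notin [:: x; y; z]) (nth loop1 L i) ->
  [\/ p1%:R * k <= q1%:R * @wt R (pg H) w (predC1 z),
      (c0 + 1) * k <= @wt R (pg H) w (predC1 z),
      p2%:R * k <= q2%:R * W \/ (c1 + 1) * k <= W |
      exists2 j, (j < size T2)%N & @has_model (pg H) predT (nth loop1 T2 j)].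
Proof.
move=> sL sT bL bT B0 B1 iL ML; case: (st) => _ /and3P[xm ym zm] _ _ _.
have [c [cc cx cz]] := chain_xz; have [d dc dz] := chain_z.
have xin : x \in pes (pg H) by rewrite in_iota0.
have zin : z \in pes (pg H) by rewrite in_iota0.
have BA e : e \in pes (pg H) -> e \notin [:: x; y; z] -> predC1 z e.
  by move=> _; rewrite !inE !negb_or => /and3P[].
have cA e : e \in pes (pg H) -> c e != 0 -> predC1 z e.
  by move=> _ ce; apply/eqP => ez; rewrite ez cz eqxx in ce.
have nx : x \notin [:: x; y; z] = false by rewrite inE eqxx.
case: (one_ear wk BA cc xin cx (negbT nx) cA sL bL B0 iL ML) => [?|?|[j jT MT]].
- exact: Or41.
- exact: Or42.
have nz : ~~ predC1 z z by rewrite /= eqxx.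
case: (one_ear wk (A := predT) (fun _ _ _ => isT) dc zin dz nz (fun _ _ _ => isT)
  sT bT B1 jT MT) => [?|?|?].
- by apply: Or43; left.
- by apply: Or43; right.
exact: Or44.
Qed.

End CubicGraph.
End Bounds.

(** * The nine constants *)

Definition check_packs (L : seq lgraph) (p q : nat)
    (vs : seq (nat * seq (seq nat))) : bool :=
  all (fun i => let H := nth loop1 L i in let: (D, cs) := nth (0, [::])%N vs i in
    check_cert H D (map (to_mask (size (le H))) cs) p q) (iota 0 (size L)).

Section Values.
Variable R : realFieldType.
Notation bound := (@bound R).
Notation bound_or := (@bound_or R).

Lemma packs_bound L p q vs (Gm : pgraph) (w : pE Gm -> R) k (A : pred (pE Gm)) j :
  check_packs L p q vs -> normed w k -> (j < size L)%N -> has_model A (nth loop1 L j) ->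
  p%:R * k <= q%:R * wt w A.
Proof.
move=> /allP ok wk jL [h [P M]]; have := ok j; rewrite mem_iota => /(_ jL).
case: (nth _ vs j) => D cs /check_certP/(_ (model_normed M wk)) le.
by apply: le_trans le _; apply: ler_wpM2l => //; apply: (wt_mu_le M); case: wk.
Qed.

Definition step3 := step_of ok3 (erefl : map parent steps3 = L2).
Definition step4 := step_of ok4 (erefl : map parent steps4 = L3).
Definition step5 := step_of ok5 (erefl : map parent steps5 = L4).
Definition step6 := step_of ok6 (erefl : map parent steps6 = L5).
Definition step7 := step_of ok7 (erefl : map parent steps7 = L6).
Definition step8 := step_of ok8 (erefl : map parent steps8 = L7).
Definition step9 := step_of ok9 (erefl : map parent steps9 = L8).

Lemma betti3 : all (has_betti 3) L3. Proof. by vm_compute. Qed.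

Lemma betti4 : all (has_betti 4) L4. Proof. by vm_compute. Qed.

Lemma betti5 : all (has_betti 5) L5. Proof. by vm_compute. Qed.

Lemma betti6 : all (has_betti 6) L6. Proof. by vm_compute. Qed.

Lemma betti7 : all (has_betti 7) L7. Proof. by vm_compute. Qed.

Lemma betti8 : all (has_betti 8) L8. Proof. by vm_compute. Qed.

Lemma ok_packs2 : check_packs L2 3 2 packs2. Proof. by vm_compute. Qed.

Lemma ok_packs6 : check_packs L6 3 1 packs6. Proof. by vm_compute. Qed.

Lemma ok_packs7 : check_packs L7 10 3 packs7. Proof. by vm_compute. Qed.

Lemma has_model_id H : @has_model (pg H) predT H.
Proof.
exists id, (fun i => [:: (i, true)]); split=> [i im|e|c cc [i]].
- by rewrite /= /dstart /dend /= !eqxx.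
- rewrite /occ /= andbT; have [em|me] := ltnP e (size (le H)).
    rewrite in_iota0 em (bigD1_seq e) ?in_iota0 ?iota_uniq //= eqxx big1 // => i.
    by move=> /negPf->.
  rewrite big_seq big1 // => i; rewrite in_iota0 => im /=.
  by rewrite (ltn_eqF (leq_trans im me)).
by rewrite in_iota0 => im ci; exists i.
Qed.

Lemma reach_star b H w k c : reach b H -> @normed R (pg H) w k -> bound b.-2 c ->
  exists x y z, [/\ star_at b H w x y z,
    c * k <= @wt R (pg H) w (fun i => i \notin [:: x; y; z]) &
    [/\ 0 <= k, w x <= w z, w y <= w z & (z < size (le H))%N]].
Proof.
move=> rH wk B; have cH := reach_cubic rH; case: (wk) => w0 k0 _.
have [x [y [z st]]] := star cH w0; exists x, y, z; split=> //.
  exact: B wk (betti_ge_star cH st).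
by case: st => _ /and3P[_ _ ->] /andP[-> ->] _ _.
Qed.

(** The inverses of the constants of the theorem. *)
Definition rho (b : nat) : R :=
  nth 0 [:: 0; 1; 3 / 2; 2; 9 / 4; 8 / 3; 3; 10 / 3; 7 / 2; 4] b.

Definition known (b : nat) := forall j, (0 < j < b)%N -> bound j (rho j).

Lemma knownS b : known b -> bound b (rho b) -> known b.+1.
Proof.
move=> kn B j /andP[j0]; rewrite ltnS leq_eqVlt => /orP[/eqP->//|jb].
by apply: kn; rewrite j0.
Qed.

(** Among all splittings the worst is to split off a single cycle, which shows
    that any bound up to [1 + rho (b - 1)] is safe against splitting. *)
Lemma rho_split b j : (b <= 9)%N -> (0 < j < b)%N ->
  1 + rho b.-1 <= rho j + rho (b - j).
Proof.
by case: b => [|[|[|[|[|[|[|[|[|[|]]]]]]]]]] //; rewrite ?andbF // => _;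
   case: j => [|[|[|[|[|[|[|[|[|]]]]]]]]] // _; rewrite /rho /=; lra.
Qed.

Lemma stuck_known b c : known b -> (b <= 9)%N -> c <= 1 + rho b.-1 ->
  forall j, (0 < j < b)%N -> exists c1 c2,
     [/\ bound j c1, bound (b - j) c2 & c <= c1 + c2].
Proof.
move=> kn b9 cb j jb; exists (rho j), (rho (b - j)); split.
- exact: kn.
- by apply: kn; rewrite subn_gt0 ltn_subrL; case/andP: jb => -> jb; rewrite jb (leq_ltn_trans _ jb).
- exact: le_trans cb (rho_split b9 jb).
Qed.

Lemma known2 : known 2.
Proof. by case=> [|[]] //; rewrite /rho /= => _; exact: bound1. Qed.

(** Delete a heavy star: at least the fraction [1 / (b - 1)] of the weight
    disappears and the Betti number drops by 2. *)
Lemma bound_star b c c' : (3 <= b)%N -> bound b.-2 c ->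
  c' * b.-2%:R <= c * b.-1%:R ->
  known b -> (b <= 9)%N -> c' <= 1 + rho b.-1 -> bound b c'.
Proof.
move=> b3 B cc kn b9 c1; apply: bound_or_nil.
apply: grow_bound_or (ltnW b3) (stuck_known kn b9 c1) _.
move=> H w k rH wk; left; have [x [y [z [st le [k0 _ _ _]]]]] := reach_star rH wk B.
have W1 := wt_star st; case: (st) => _ _ _ W2 _.
set W := wt _ _ in W1 W2 *; set A := wt _ _ in le W1; set t := _ + w z in W1 W2.
have Eb : b.-1%:R = b.-2%:R + 1 :> R.
  by case: (b) b3 => [|[|j]] // _; rewrite natr1.
have b2 : 0 < b.-2%:R :> R by rewrite ltr0n; case: (b) b3 => [|[|[]]].
rewrite -mulr_natr Eb in W2; rewrite Eb in cc.
rewrite -(ler_pM2r b2).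
have h1 : c' * b.-2%:R * k <= c * (b.-2%:R + 1) * k by apply: ler_wpM2r.
have h2 : (b.-2%:R + 1) * (c * k) <= (b.-2%:R + 1) * A by apply: ler_wpM2l => //; lra.
set r := b.-2%:R in b2 W2 cc h1 h2 *.
have h3 : W * (r + 1) = A * (r + 1) + t * (r + 1) by rewrite -mulrDl -W1.
lra.
Qed.

Lemma reach_inv k H : reach k H -> k = 2 /\ H = theta \/
  exists j K f g, [/\ k = j.+1, reach j K, (f <= g < size (le K))%N & H = insert f g K].
Proof. by case=> [|j K f g rK fg gm]; [left|right; exists j, K, f, g; rewrite fg gm]. Qed.

Lemma reach2 H : reach 2 H -> H = theta.
Proof.
case/reach_inv=> [[]//|[j [K [f [g [[<-] rK _ _]]]]]].
by have := cubic_k (reach_cubic rK).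
Qed.

Lemma known3 : known 3.
Proof.
apply: knownS known2 _; apply: bound_or_nil.
apply: grow_bound_or (stuck_known known2 _ _) _ => //; first by rewrite /rho /=; lra.
move=> H w k rH wk; left; have EH := reach2 rH.
subst H; have M := has_model_id theta.
have := packs_bound ok_packs2 wk (j := 0) isT M; rewrite /rho /=; lra.
Qed.

Lemma known4 : known 4.
Proof.
apply: knownS known3 _; apply: (@bound_star _ (rho 1)) => //; last 2 first.
- exact: known3.
- by rewrite /rho /=; lra.
- exact: bound1.
- by rewrite /rho /=; lra.
Qed.

Lemma known5 : known 5.
Proof.
apply: knownS known4 _; apply: (@bound_star _ (rho 2)) => //; last 2 first.
- exact: known4.
- by rewrite /rho /=; lra.
- exact: known3.
- by rewrite /rho /=; lra.
Qed.

Lemma known6 : known 6.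
Proof.
apply: knownS known5 _; apply: (@bound_star _ (rho 3)) => //; last 2 first.
- exact: known5.
- by rewrite /rho /=; lra.
- exact: known4.
- by rewrite /rho /=; lra.
Qed.

(** All generated graphs of Betti number 3 are in [L3]; only a splitting can
    lead elsewhere, and it guarantees 5/2. *)
Lemma reach3_models : bound_or 3 (5 / 2) L3.
Proof.
apply: grow_bound_or (stuck_known known3 _ _) _ => //; first by rewrite /rho /=; lra.
move=> H w k; case/reach_inv=> [[]//|[_ [K [f [g [[<-] rK /andP[fg gm] ->]]]]]] wk.
have EK := reach2 rK; subst K.
have M := has_model_id (insert f g theta).
have [le|?] := step3 (i := 0) isT fg gm wk M; [left|by right].
by case: wk => _ k0 _; lra.
Qed.

(** Delete the heavy star, of weight at least [1/4] of the total. If the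
    remainder reaches [5/2] then the total is at least [4/3 * 5/2]; if not, it
    models a graph of [L3]. Without its heaviest edge [z] the graph keeps at
    most [11/12] of the weight, so that [385/144] is enough before [z] is put
    back. *)
Lemma models5 : bound_or 5 (35 / 12) L5.
Proof.
apply: grow_bound_or (stuck_known known5 _ _) _ => //; first by rewrite /rho /=; lra.
move=> H w k rH wk; have cH := reach_cubic rH; have [w0 k0 _] := wk.
have [x [y [z st]]] := star cH w0.
have W1 := wt_star st; have bz := betti_ge_star cH st.
case: (st) => _ /and3P[_ _ zm] /andP[wxz wyz] W2 _.
have W3 := wt_drop w zm; rewrite -mulr_natr /= in W2.
have [le|[j jL MA]] := reach3_models wk bz.
  left; lra.
have := two_ears rH wk st step4 step5 betti3 betti4 (known5 (j := 3) isT)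
  (known5 (j := 4) isT) jL MA.
rewrite /rho /= => -[?|?|[?|?]|?]; [left; lra|left; lra|left; lra|left; lra|by right].
Qed.
(** For Betti number 6 the heaviest edge [z] alone is deleted: if the
    remainder, at most [14/15] of the weight, reaches [35/12], the total
    exceeds 3. Otherwise it models a graph of [L5], and one ear through [z] is
    put back. *)
Lemma known7 : known 7.
Proof.
apply: knownS known6 _; apply: bound_or_nil.
apply: grow_bound_or (stuck_known known6 _ _) _ => //; first by rewrite /rho /=; lra.
move=> H w k rH wk; left; have cH := reach_cubic rH; have [w0 k0 _] := wk.
have [x [y [z st]]] := star cH w0; have [d dc dz] := chain_z rH st.
have W1 := wt_star st.
case: (st) => _ /and3P[_ _ zm] /andP[wxz wyz] W2 _.
have W3 := wt_drop w zm; rewrite -mulr_natr /= in W2.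
have xyz0 : 0 <= @wt R (pg H) w (fun i => i \notin [:: x; y; z]) by apply: wt_ge0.
have [le|[j jL MA]] := models5 wk (betti_ge_drop cH z); first by rewrite /rho /=; lra.
have zin : z \in pes (pg H) by rewrite in_iota0.
have nz : ~~ predC1 z z by rewrite /= eqxx.
have [||[j' jL' MA']] := one_ear wk (A := predT) (fun _ _ _ => isT) dc zin dz nz
  (fun _ _ _ => isT) step6 betti5 (known6 (j := 5) isT) jL MA.
- by rewrite /rho /=; lra.
- by rewrite /rho /=; lra.
by have := packs_bound ok_packs6 wk jL' MA'; rewrite /rho /=; lra.
Qed.

(** As in [models5]: the star has [1/6] of the weight, [6/5 * 35/12 = 7/2],
    and at most [17/18] of the weight is left without [z]. *)
Lemma models7 : bound_or 7 (7 / 2) L7.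
Proof.
apply: grow_bound_or (stuck_known known7 _ _) _ => //; first by rewrite /rho /=; lra.
move=> H w k rH wk; have cH := reach_cubic rH; have [w0 k0 _] := wk.
have [x [y [z st]]] := star cH w0.
have W1 := wt_star st; have bz := betti_ge_star cH st.
case: (st) => _ /and3P[_ _ zm] /andP[wxz wyz] W2 _.
have W3 := wt_drop w zm; rewrite -mulr_natr /= in W2.
have [le|[j jL MA]] := models5 wk bz.
  by left; lra.
have := two_ears rH wk st step6 step7 betti5 betti6 (known7 (j := 5) isT)
  (known7 (j := 6) isT) jL MA.
rewrite /rho /= => -[?|?|[?|?]|?]; [left; lra|left; lra|left; lra|left; lra|by right].
Qed.

Lemma known8 : known 8.
Proof.
apply: knownS known7 _ => Gm w k A wk bA; have [_ k0 _] := wk.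
have [le|[j jL MA]] := models7 wk bA; first by rewrite /rho /=; lra.
by have := packs_bound ok_packs7 wk jL MA; rewrite /rho /=; lra.
Qed.

Lemma known9 : known 9.
Proof.
apply: knownS known8 _; apply: (@bound_star _ (rho 6)) => //; last 2 first.
- exact: known8.
- by rewrite /rho /=; lra.
- exact: known8.
- by rewrite /rho /=; lra.
Qed.

(** Once more the same argument, with [1/8] of the weight in the star, [8/7 *
    7/2 = 4], and [23/24] left without [z]. This time no insertion violates
    the bound, so no exceptional graph is left. *)
Lemma known10 : known 10.
Proof.
apply: knownS known9 _; apply: bound_or_nil.
apply: grow_bound_or (stuck_known known9 _ _) _ => //; first by rewrite /rho /=; lra.
move=> H w k rH wk; left; have cH := reach_cubic rH; have [w0 k0 _] := wk.
have [x [y [z st]]] := star cH w0.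
have W1 := wt_star st; have bz := betti_ge_star cH st.
case: (st) => _ /and3P[_ _ zm] /andP[wxz wyz] W2 _.
have W3 := wt_drop w zm; rewrite -mulr_natr /= in W2.
have [le|[j jL MA]] := models7 wk bz.
  by rewrite /rho /=; lra.
have := two_ears rH wk st step8 step9 betti7 betti8 (known9 (j := 7) isT)
  (known9 (j := 8) isT) jL MA.
by rewrite /rho /= => -[?|?|[?|?]|[]//]; lra.
Qed.

End Values.

(** * Simple cycles and integral homology *)

Section Multigraphs.
Variable G : multigraph.

Definition pgraph_of : pgraph := PGraph (@src G) (@tgt G) (enum_uniq (edge G)).
Notation PG := pgraph_of.

Lemma in_pes (e : edge G) : e \in pes PG.
Proof. exact: mem_enum. Qed.

Lemma sum_pes (V : nmodType) (S : pred (edge G)) (F : edge G -> V) :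
  \sum_(e <- pes PG | S e) F e = \sum_(e | S e) F e.
Proof. by rewrite big_enum_cond. Qed.

Lemma walk_path u (d : dart G) p v : @walk PG u (d :: p) v =
  (dart_start d == u) &&
  (path (fun d d' => dart_end d == dart_start d') d p && (dart_end (last d p) == v)).
Proof.
elim: p u d => [|d' p IH] u d /=; first by [].
congr andb; rewrite -[LHS]/(@walk PG (dart_end d) (d' :: p) v) IH.
by rewrite [dart_start d' == _]eq_sym andbA.
Qed.

Lemma scw_simple (w : seq (dart G)) :
  (exists u, @scw PG u w) <-> simple_closed_walk w.
Proof.
split=> [[u /and4P[w0 wu us ue]]|/and4P[w0 wu us ue]]; case: w w0 wu us ue => // d p _.
  rewrite walk_path => /and3P[/eqP du pd /eqP lu] us ue.
  apply/and4P; split=> //; rewrite /= rcons_path pd /=.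
  by rewrite lu -du.
rewrite /= rcons_path => /andP[pd ld] us ue; exists (dart_start d).
by apply/and4P; split=> //; rewrite walk_path eqxx pd ld.
Qed.

Lemma cycle_chain (C : {set edge G}) : is_cycle C ->
  @cyc PG (fun e => (e \in C)%:R) /\ exists e, e \in C.
Proof.
case=> w /scw_simple[u sw] ->.
have sub : {subset @edges PG w <= pes PG} by move=> e _; apply: in_pes.
have [wc wE] := scw_wchain sw sub; split.
  by move=> x; rewrite -[RHS](wc x); apply: eq_bigr => e _; rewrite wE inE.
case/and4P: sw; case: (w) => // d p _ _ _ _.
by exists d.1; rewrite inE mem_head.
Qed.

Lemma chain_cycle (c : edge G -> F2) e0 : @cyc PG c -> c e0 != 0 ->
  exists C : {set edge G}, [/\ is_cycle C, e0 \in C & forall e, e \in C -> c e != 0].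
Proof.
move=> cc ce; have [u [w [sw ew inw]]] := cyc_through cc (in_pes e0) ce.
exists [set e | e \in @edges PG w]; split; last by move=> e; rewrite inE => /inw[].
  by exists w => //; apply/scw_simple; exists u.
by rewrite inE.
Qed.

Lemma boundaryE (c : {ffun edge G -> int}) v : boundary c v =
  \sum_e c e * ((tgt e == v)%:R - (src e == v)%:R).
Proof.
rewrite ffunE big_mkcond [X in _ - X]big_mkcond -sumrB; apply: eq_bigr => e _.
by rewrite mulrBr; case: (tgt e == v); case: (src e == v); rewrite /= ?mulr1 ?mulr0.
Qed.

(** The support of an integral cycle has no leaf, for the boundary would not vanish
    there. *)
Lemma H1_scw (c : {ffun edge G -> int}) : c \in @H1 G -> c != 0 ->
  exists u (w : seq (pdart PG)), @scw PG u w /\ forall e, e \in edges w -> c e != 0.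
Proof.
rewrite inE => /eqP bc c0.
have [e0 ce0] : exists e0, c e0 != 0.
  apply/existsP; rewrite -negb_forall; apply: contra c0 => /forallP c0.
  by apply/eqP/ffunP => e; rewrite ffunE; apply/eqP; apply: c0.
have [|u [w [sw inw]]] :=
    @leafless_cycle PG (fun e => c e != 0) e0 (in_pes e0) ce0; last first.
  by exists u, w; split=> // e /inw[].
move=> x e _ ce ex.
have [/existsP[e' /and3P[H1 H2 H3]]|/existsPn none] := boolP [exists e',
    [&& c e' != 0, e' != e & @ends PG e' x != 0%N]].
  by exists e'; rewrite ?in_pes ?H1 ?H2.
have : boundary c x = 0 by rewrite bc ffunE.
rewrite boundaryE (bigD1 e) //= big1 ?addr0 => [/eqP|e' ne].
  rewrite mulf_eq0 (negPf ce) /=; move: ex; rewrite /ends /=.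
  by case: (src e == x); case: (tgt e == x).
have := none e'; rewrite ne !negb_and !negbK /= => /orP[/eqP->|]; first by rewrite mul0r.
rewrite /ends /=; case: (src e' == x); case: (tgt e' == x) => //.
by rewrite subr0 mulr0.
Qed.

End Multigraphs.

(** Solve over the rationals and clear denominators. *)
Lemma int_relation r n (M : 'M[int]_(r, n)) : (n < r)%N ->
  exists2 a : 'I_r -> int, (exists i, a i != 0) & forall j, \sum_i a i * M i j = 0.
Proof.
move=> nr; pose Mq : 'M[rat]_(r, n) := map_mx intr M.
have : kermx Mq != 0.
  rewrite kermx_eq0 /row_free neq_ltn; apply/orP; left.
  exact: leq_ltn_trans (rank_leq_col _) nr.
case/rowV0Pn=> u /sub_kermxP uM u0.
pose D := \prod_j denq (u 0 j).
pose a i := numq (u 0 i) * \prod_(j | j != i) denq (u 0 j).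
have aE i : (a i)%:~R = u 0 i * D%:~R.
  rewrite /a /D [in RHS](bigD1 i) //= !intrM mulrA; congr (_ * _).
  by rewrite -{2}(divq_num_den (u 0 i)) mulfVK // intr_eq0 denq_neq0.
have D0 : D != 0 by apply/prodf_neq0 => j _; apply: denq_neq0.
exists a.
  have /rV0Pn[i ui] := u0; exists i.
  by rewrite -(intr_eq0 rat) aE mulf_neq0 // intr_eq0.
move=> j; apply/eqP; rewrite -(intr_eq0 rat) rmorph_sum /=.
under eq_bigr do rewrite intrM aE mulrAC.
rewrite -mulr_suml; apply/eqP.
have /matrixP/(_ 0 j) := uM; rewrite !mxE => e0.
have -> : \sum_i u 0 i * (M i j)%:~R = 0.
  by apply: etrans e0; apply: eq_bigr => i _; rewrite mxE.
by rewrite mul0r.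
Qed.

Section Betti.
Variable G : multigraph.
Notation PG := (pgraph_of G).

Lemma Z_independent_relation r (x : 'I_r -> {ffun edge G -> int}) (F : seq (edge G)) :
  (forall i, x i \in @H1 G) -> Z_independent x -> (size F < r)%N ->
  exists2 c, (c \in @H1 G) && (c != 0) & forall e, e \in F -> c e = 0.
Proof.
move=> xH xi szF.
pose M : 'M[int]_(r, size F) := \matrix_(i, j) x i (tnth (in_tuple F) j).
have [a [i0 ai0] aM] := int_relation M szF.
pose c : {ffun edge G -> int} := \sum_i x i *~ a i.
have cE e : c e = \sum_i a i * x i e.
  rewrite /c sum_ffunE; apply: eq_bigr => i _.
  by rewrite ffunMzE -mulrzl intz.
exists c; last first.
  move=> e eF; rewrite cE; have jF : (index e F < size F)%N by rewrite index_mem.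
  rewrite -[RHS](aM (Ordinal jF)); apply: eq_bigr => i _.
  by rewrite mxE (tnth_nth e) /= nth_index.
apply/andP; split; last first.
  by apply/eqP => c0; case/eqP: ai0; apply: xi c0 i0.
rewrite inE; apply/eqP/ffunP => v; rewrite boundaryE ffunE.
under eq_bigr do rewrite cE mulr_suml.
rewrite exchange_big big1 // => i _.
have := xH i; rewrite inE => /eqP/ffunP/(_ v); rewrite boundaryE ffunE => bx.
under eq_bigr do rewrite -mulrA.
by rewrite -mulr_sumr bx mulr0.
Qed.

(** Of [b] independent integral cycles some nonzero combination vanishes on
    fewer than [b] given edges, and a simple cycle in its support is a closed
    chain modulo 2. This is how rank over the integers is compared with chains
    modulo 2 without reduction of coefficients. *)
Lemma first_betti_ge b : first_betti G b -> betti_ge (Gm := PG) predT b.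
Proof.
case=> [[x [xH xi]] _] F szF.
have [c /andP[cH c0] cF] := Z_independent_relation xH xi szF.
have [u [w [sw inw]]] := H1_scw cH c0.
have sub : {subset @edges PG w <= pes PG} by move=> e _; apply: in_pes.
have [wc wE] := scw_wchain sw sub.
exists (wchain w); split=> //.
  case/and4P: sw; case: (w) wE => // d p wE _ _ _ _.
  by exists d.1; rewrite ?in_pes // wE mem_head.
move=> e _; rewrite wE; case: (boolP (e \in edges w)) => // ew _ /=.
by apply/negP => eF; have := inw e ew; rewrite cF ?eqxx.
Qed.

End Betti.

(** * The systole and the Betti number of a multigraph *)

Lemma systole_ge0 (R : realType) (G : weighted_graph R) : 0 <= systole G.
Proof.
rewrite /systole; apply: (big_ind (fun x => 0 <= x)) => [|x y x0 y0|C _]; first exact: ler01.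
  by rewrite le_min x0.
apply: divr_ge0; last exact: ltW (total_weight_gt0 G).
by apply: sumr_ge0 => e _; apply: weight_ge0.
Qed.

Lemma systole_normed (R : realType) (G : weighted_graph R) :
  @normed R (pgraph_of G) (@weight R G) (systole G * total_weight [set: edge G]).
Proof.
have T0 := total_weight_gt0 G; split; first exact: weight_ge0.
  by rewrite mulr_ge0 ?systole_ge0 // ltW.
move=> c cc [e0 _ ce0]; have [C [cC _ Cc]] := chain_cycle cc ce0.
have := systole_le cC; rewrite ler_pdivlMr // => /le_trans; apply.
rewrite /wt sum_pes /total_weight [leLHS]big_mkcond [leRHS]big_mkcond /=.
apply: ler_sum => e _; case: (boolP (e \in C)) => [/Cc->//|_].
by case: (c e != 0); rewrite ?weight_ge0.
Qed.

(** The systole, scaled by the total weight, is a lower bound for all closed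
    chains, since each contains a simple cycle. *)
Lemma systole_upper (R : realType) (G : weighted_graph R) b :
  (1 <= b <= 9)%N -> first_betti G b -> systole G <= s R b.
Proof.
move=> b9 /first_betti_ge bG; have T0 := total_weight_gt0 G.
have := @known10 R b; rewrite ltnS => /(_ b9) B.
have := B _ _ _ _ (systole_normed G) bG.
rewrite /wt sum_pes.
have -> : \sum_(e | xpredT e) @weight R G e = total_weight [set: edge G].
  by rewrite /total_weight; apply: eq_bigl => e; rewrite inE.
rewrite mulrA -{2}[total_weight _]mul1r ler_pM2r //.
by case: b b9 {B bG} => [|[|[|[|[|[|[|[|[|[|]]]]]]]]]] // _; rewrite /rho /s /=; lra.
Qed.

Section BettiOf.
Variable G : multigraph.
Notation PG := (pgraph_of G).

Definition signed (w : seq (pdart PG)) : {ffun edge G -> int} :=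
  [ffun e => \sum_(d <- w) (if d.2 then 1 else - 1 : int) *+ (d.1 == e)].

Lemma signed_H1 u w : @walk PG u w u -> signed w \in @H1 G.
Proof.
move=> wu; rewrite inE; apply/eqP/ffunP => x; rewrite boundaryE [RHS]ffunE.
have -> : \sum_e signed w e * ((tgt e == x)%:R - (src e == x)%:R) =
    \sum_(d <- w) ((@dend PG d == x)%:R - (@dstart PG d == x)%:R).
  under eq_bigr do rewrite ffunE mulr_suml.
  rewrite exchange_big; apply: eq_bigr => d _.
  rewrite (bigD1 d.1) //= eqxx mulr1n big1 ?addr0 => [|e]; last first.
    by rewrite eq_sym => /negPf->; rewrite mulr0n mul0r.
  by case: d => e []; rewrite /dend /dstart /= ?mul1r // mulN1r opprB.
suff tel v : @walk PG v w u ->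
    \sum_(d <- w) ((@dend PG d == x)%:R - (@dstart PG d == x)%:R) =
    (u == x)%:R - (v == x)%:R :> int.
  by rewrite (tel u wu) subrr.
elim: w v {wu} => [|d w IH] v /=.
  by move/eqP->; rewrite big_nil subrr.
by case/andP=> /eqP<- /IH wd; rewrite big_cons wd addrC addrA subrK.
Qed.

Lemma signed_out w e : e \notin @edges PG w -> signed w e = 0.
Proof.
move=> ew; rewrite ffunE big_seq big1 // => d dw.
by case: eqP => // de; case/negP: ew; rewrite -de; apply: map_f.
Qed.

Lemma signed_in w e : uniq (@edges PG w) -> e \in @edges PG w -> signed w e != 0.
Proof.
move=> uw /mapP[d dw ->]; rewrite ffunE (bigD1_seq d) ?(map_uniq uw) //= eqxx.
rewrite big_seq_cond big1 ?addr0 => [|d' /andP[d'w ne]]; first by case: (d.2).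
by case: eqP => // dd; case/eqP: ne; apply: (uniq_map_inj uw).
Qed.

(** Take a determining set [F] of exactly [b] edges. For each edge of [F]
    there is a simple cycle that meets [F] in this edge only, and the [b]
    integral cycles so obtained are independent. With more independent cycles,
    some nonzero combination would vanish on [F], and so would a simple cycle
    in its support. *)
Lemma first_betti_of b : betti_ge (Gm := PG) predT b ->
  determined (Gm := PG) predT b -> first_betti G b.
Proof.
move=> bG [F0 szF0 dF0]; pose F := undup F0.
have dF c : @cyc PG c -> (forall e, e \in F -> c e = 0) -> forall e, c e = 0.
  move=> cc cF e; apply: (dF0 c) => //; last exact: in_pes.
  by move=> f _ fF; apply: cF; rewrite mem_undup.
have szF : size F = b.
  apply/eqP; rewrite eqn_leq (leq_trans (size_undup _) szF0) leqNgt /=.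
  apply/negP => /bG[c [cc [e _ ce] cF]]; case/eqP: ce; apply: dF => // f fF.
  by apply/eqP/negPn/negP => /(cF f (in_pes f)); rewrite fF.
have uF : uniq F by apply: undup_uniq.
have w_ex (j : 'I_b) : exists w : seq (pdart PG), [/\ exists u, walk u w u,
    uniq (edges w) & forall e, e \in F -> (e \in edges w) = (e == nth e F j)].
  case: b j bG szF {szF0 dF0} => [[]//|b'] j bG szF.
  have [f0 _] : exists f0 : edge G, f0 \in F.
    by case: (F) szF => // f0 F' _; exists f0; rewrite mem_head.
  pose f := nth f0 F j.
  have jF : (j < size F)%N by rewrite szF.
  have fF : f \in F by apply: mem_nth.
  have [|c [cc [e _ ce] cF]] := bG (rem f F); first by rewrite size_rem // szF.
  have [u [w [sw _ inw]]] := cyc_through cc (in_pes e) ce.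
  have sub : {subset @edges PG w <= pes PG} by move=> e' _; apply: in_pes.
  have [wc wE] := scw_wchain sw sub.
  have out e' : e' \in F -> e' != f -> e' \notin edges w.
    move=> e'F ne; apply/negP => /inw[e'in ce'].
    by have := cF e' e'in ce'; rewrite rem_filter // mem_filter /= ne e'F.
  have fw : f \in edges w.
    apply/negPn/negP => fw.
    have w0 : forall e', wchain w e' = 0.
      apply: dF => // e' e'F; rewrite wE.
      have [->|ne] := eqVneq e' f; first by rewrite (negPf fw).
      by rewrite (negPf (out e' e'F ne)).
    case/and4P: sw; case: (w) w0 wE => // d p w0 wE _ _ _ _.
    by have := w0 d.1; rewrite wE mem_head => /eqP.
  exists w; case/and4P: sw => _ wu _ ue; split=> //; first by exists u.
  move=> e' e'F; rewrite (set_nth_default f0) // -/f.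
  by have [->|ne] := eqVneq e' f; [|rewrite (negPf (out e' e'F ne))].
split.
  have [W HW] := choice w_ex; exists (fun j => signed (W j)); split.
    by move=> j; have [[u wu] _ _] := HW j; apply: signed_H1 wu.
  move=> a sum0 j.
  have jF : (j < size F)%N by rewrite szF.
  have [f0 _] : exists f0 : edge G, f0 \in F.
    by case: (F) jF => // f0 F' _; exists f0; rewrite mem_head.
  pose f := nth f0 F j; have fF : f \in F by apply: mem_nth.
  have := congr1 (fun g : {ffun edge G -> int} => g f) sum0.
  rewrite sum_ffunE ffunE (bigD1 j) //= big1 ?addr0 => [|i ne].
    rewrite ffunMzE -mulrzl intz => /eqP; rewrite mulf_eq0 => /orP[/eqP//|].
    have [_ uw wF] := HW j; rewrite (negPf (signed_in uw _)) // wF //.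
    by rewrite (set_nth_default f0).
  rewrite ffunMzE signed_out ?mul0rz //; have [_ _ wF] := HW i.
  rewrite wF // (set_nth_default f0) ?szF // /f nth_uniq ?szF //.
  by rewrite eq_sym.
move=> k x xH xi; rewrite leqNgt; apply/negP => bk.
have [|c /andP[cH c0] cF] := Z_independent_relation (F := F) xH xi; first by rewrite szF.
have [u [w [sw inw]]] := H1_scw cH c0.
have sub : {subset @edges PG w <= pes PG} by move=> e' _; apply: in_pes.
have [wc wE] := scw_wchain sw sub.
have w0 : forall e', wchain w e' = 0.
  apply: dF => // e' e'F; rewrite wE.
  by case: (boolP (e' \in edges w)) => // /inw; rewrite cF ?eqxx.
case/and4P: sw; case: (w) w0 wE => // d p w0 wE _ _ _ _.
by have := w0 d.1; rewrite wE mem_head => /eqP.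
Qed.

End BettiOf.

(** * Graphs with a prescribed systole *)

(** Graphs are given with a spanning tree in front: for [k < n] the edge [k] joins
    the vertex [k + 1] to a smaller one. *)
Section Examples.
Variables (n : nat) (l : seq (nat * nat)).
Notation m := (size l).
Let H := LGraph n.+1 l.

Definition tree_form : bool :=
  [&& wf H, (n <= m)%N &
      all (fun k => (lsrc H k <= k)%N && (ltgt H k == k.+1)) (iota 0 n)].

Definition graph_of_list : multigraph := @Multigraph 'I_n.+1 'I_m
  (fun i => inord (lsrc H i)) (fun i => inord (ltgt H i)).

Hypothesis tH : tree_form.
Notation PG := (pgraph_of graph_of_list).

Let wH : wf H. Proof. by case/and3P: tH. Qed.
Let nm : (n <= m)%N. Proof. by case/and3P: tH. Qed.

Lemma ends_list (i : 'I_m) v : (v <= n)%N ->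
  @ends PG i (inord v) = @ends (pg H) i v.
Proof.
move=> vn; have [ai bi] := wf_lt wH (ltn_ord i).
by rewrite /ends /= -!val_eqE /= !inordK.
Qed.

Lemma sum_list (V : nmodType) (F : nat -> V) :
  \sum_(i <- pes (pg H)) F i = \sum_(i : 'I_m) F i.
Proof. exact: big_iota_ord. Qed.

Lemma cyc_of_list (c : nat -> F2) : @cyc (pg H) c -> @cyc PG (fun i => c (val i)).
Proof.
move=> cc x; rewrite sum_pes -[RHS](cc x) sum_list; apply: eq_bigr => i _.
by rewrite -[x]inord_val ends_list ?inord_val // -ltnS.
Qed.

Definition to_list (c : 'I_m -> F2) (i : nat) : F2 :=
  if insub i is Some j then c j else 0.

Lemma to_listE c (i : 'I_m) : to_list c i = c i.
Proof. by rewrite /to_list valK. Qed.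

Lemma cyc_to_list c : @cyc PG c -> @cyc (pg H) (to_list c).
Proof.
move=> cc x; rewrite sum_list; have [xn|nx] := leqP x n.
  rewrite -[RHS](cc (inord x)) sum_pes; apply: eq_bigr => i _.
  by rewrite to_listE ends_list.
rewrite big1 // => i _; have [ai bi] := wf_lt wH (ltn_ord i).
by rewrite /ends /= !ltn_eqF ?mulr0n //; apply: leq_trans nx.
Qed.

(** At the vertex [k + 1] the edge [k] is the only tree edge that leads to a smaller
    vertex, so the boundary condition there expresses its coefficient by those of
    later edges. *)
Lemma tree_step c k : @cyc (pg H) c -> (k < n)%N ->
  c k = \sum_(i <- iota k.+1 (m - k.+1)) c i *+ @ends (pg H) i k.+1.
Proof.
move=> cc kn; have km : (k < m)%N by apply: leq_trans nm.
have tree i : (i < n)%N -> (lsrc H i <= i)%N /\ ltgt H i = i.+1.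
  move=> i_n; have /and3P[_ _ /allP/(_ i)] := tH.
  by rewrite mem_iota => /(_ i_n)/andP[-> /eqP].
apply: F2_addr0_eq; rewrite -[RHS](cc k.+1) /=.
have -> : iota 0 m = iota 0 k ++ k :: iota k.+1 (m - k.+1).
  by rewrite -[in LHS](subnKC (ltnW km)) iotaD -subnSK.
rewrite big_cat big_cons /=; have [ak bk] := tree k kn.
rewrite [X in _ = X + _]big_seq [X in _ = X + _]big1 ?add0r => [|i]; last first.
  rewrite in_iota0 => ik; have [ai bi] := tree i (ltn_trans ik kn).
  by rewrite /ends /= bi !ltn_eqF ?mulr0n //; apply: leq_ltn_trans ai (ltnW _).
congr (_ + _); rewrite /ends /= bk eqxx.
by rewrite (ltn_eqF (leq_ltn_trans ak (ltnSn k))).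
Qed.

Lemma betti_list b : m = (n + b)%N -> first_betti graph_of_list b.
Proof.
move=> mE; apply: first_betti_of.
  have bH : betti_ge (Gm := pg H) predT b by apply: betti_ge_euler => //=; rewrite mE addSn.
  move=> F szF; have [|c [cc [i im ci] cF]] := bH (map val F); first by rewrite size_map.
  exists (fun i => c (val i)); split; first exact: cyc_of_list.
    rewrite in_iota0 in im; exists (Ordinal im) => //; exact: in_pes.
  move=> e _ ce; have := cF e; rewrite in_iota0 => /(_ (ltn_ord e) ce) /=.
  by apply: contra => eF; apply: map_f.
exists [seq i : 'I_m <- enum 'I_m | (n <= i)%N].
  rewrite -(size_map val) -(filter_map val (fun i => n <= i)%N) val_enum_ord mE iotaD.
  rewrite filter_cat size_cat add0n (eq_in_filter (a2 := pred0)) => [|i].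
    by rewrite filter_pred0 (leq_trans (size_subseq (filter_subseq _ _))) ?size_iota.
  by rewrite in_iota0 /= ltnNge => /negPf.
move=> c /cyc_to_list cc _ cF.
suff c0 j i : (j <= n)%N -> (n - j <= i < m)%N -> to_list c i = 0.
  by move=> e _; rewrite -(to_listE c e) (c0 n) ?subnn ?ltn_ord.
elim: j i => [|j IH] i jn /andP[ji im].
  rewrite subn0 in ji; rewrite (to_listE c (Ordinal im)).
  by apply: cF; [apply: in_pes|rewrite mem_filter ji mem_enum].
move: ji; rewrite leq_eqVlt => /orP[/eqP ij|ij]; last first.
  by apply: IH; [apply: ltnW|rewrite im andbT -subSn ?subSS in ij * => //; lia].
have i_n : (i < n)%N by rewrite -ij; lia.
rewrite (tree_step cc i_n) big_seq big1 // => i'; rewrite mem_iota => /andP[ii' i'm].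
by rewrite (IH i') ?mul0rn //; [apply: ltnW|lia].
Qed.

(** Recover a closed chain from its values on the edges from [k] on, by the
    boundary conditions at the vertices [k], [k - 1] and so on. *)
Fixpoint complete (k : nat) (t : seq bool) : seq bool :=
  if k is j.+1 then
    complete j (odd (count (eqn k) (ends_of (mask t (drop k l)))) :: t)
  else t.

Lemma completeP c k : @cyc (pg H) c -> (k <= n)%N ->
  complete k [seq c i != 0 | i <- iota k (m - k)] = [seq c i != 0 | i <- iota 0 m].
Proof.
move=> cc; elim: k => [|k IH] kn; first by rewrite subn0.
rewrite -(IH (ltnW kn)) /=; congr (complete k _).
have km : (k < m)%N by apply: leq_trans nm.
rewrite -[(m - k)%N]prednK ?subn_gt0 // -subnS /=; congr (_ :: _).
rewrite (tree_step cc kn); set t := [seq _ | _ <- _].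
have -> : \sum_(i <- iota k.+1 (m - k.+1)) c i *+ @ends (pg H) i k.+1 =
    \sum_(e <- mask t (drop k.+1 l)) ((e.1 == k.+1) + (e.2 == k.+1))%:R.
  rewrite -(sum_mask (0, 0)%N (fun e => ((e.1 == k.+1) + (e.2 == k.+1))%:R)).
  rewrite size_drop -{1}[k.+1]addn0 iotaDl big_map; apply: eq_big_seq => i.
  rewrite in_iota0 => im.
  rewrite nth_drop (nth_map 0%N) ?size_iota // nth_iota //.
  have [->|/F2_neq0->] := eqVneq (c (k.+1 + i)%N) 0; first by rewrite mul0rn mulr0n.
  by rewrite mulr1n.
by rewrite sum_ends_of F2_natr; case: (odd _).
Qed.

Fixpoint bitlists (b : nat) : seq (seq bool) :=
  if b is k.+1 then
    let r := bitlists k in map (cons true) r ++ map (cons false) r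
  else [:: [::]].

Lemma mem_bitlists b t : size t = b -> t \in bitlists b.
Proof.
elim: b t => [|b IH] [|a t] //= [/IH tb]; rewrite mem_cat.
by case: a; rewrite map_f ?orbT.
Qed.

Definition check_weights (ws : seq nat) (p q : nat) : bool :=
  [&& size ws == m, (0 < sumn ws)%N &
      all (fun t => let f := complete n t in
             has id f ==> (p * sumn ws <= q * sumn (mask f ws))%N)
          (bitlists (m - n))].

Lemma sumn_mask (t : seq bool) (ws : seq nat) :
  sumn (mask t ws) = (\sum_(i <- iota 0 (size ws)) nth 0 ws i * nth false t i)%N.
Proof.
rewrite sumnE -(sum_mask 0%N (V := nat) id); apply: eq_bigr => i _.
by rewrite -mulr_natr natn.
Qed.

(** A cycle is a closed chain, hence one of the [2 ^ b] chains that are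
    completed and weighed. *)
Lemma example (R : realType) ws p q b : check_weights ws p q -> m = (n + b)%N ->
  (0 < b)%N -> (0 < q)%N ->
  exists G : weighted_graph R, first_betti G b /\ p%:R / q%:R <= systole G.
Proof.
case/and3P=> /eqP szw tot /allP ok mE b0 q0.
pose wt0 (e : edge graph_of_list) : R := (nth 0%N ws e)%:R.
have wt_ge e : 0 <= wt0 e by apply: ler0n.
have sumE (S : pred 'I_m) : \sum_(e | S e) wt0 e = (\sum_(e : 'I_m | S e) nth 0%N ws e)%:R.
  by rewrite natr_sum.
have totE : sumn ws = \sum_(e : 'I_m) nth 0%N ws e.
  by rewrite sumnE (big_nth 0%N) szw big_mkord.
have wt_neq : exists e, wt0 e != 0.
  apply/existsP; rewrite -negb_forall; apply: contraL tot => /forallP w0.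
  rewrite totE big1 // => e _; apply/eqP.
  by have := w0 e; rewrite /wt0 pnatr_eq0.
pose G := @WeightedGraph R graph_of_list wt0 wt_ge wt_neq.
have bG : first_betti G b by apply: betti_list.
exists G; split=> //.
have [C0 cC0] : exists C, @is_cycle G C.
  have [|c [cc [e _ ce] _]] := first_betti_ge bG (F := [::]); first by [].
  by have [C [cC _ _]] := chain_cycle cc ce; exists C.
have [C cC ->] := systole_attained (ex_intro _ C0 cC0).
rewrite ler_pdivlMr ?total_weight_gt0 // mulrAC ler_pdivrMr ?ltr0n //.
have -> : total_weight [set: edge G] = (sumn ws)%:R.
  rewrite totE -(sumE xpredT); apply: eq_bigl => e; by rewrite inE.
rewrite /total_weight (sumE (mem C)) -!natrM ler_nat.
have [cyc0 [e eC]] := cycle_chain cC.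
have cc := cyc_to_list cyc0; set c := to_list _ in cc.
pose f := [seq c i != 0 | i <- iota 0 m].
have := ok [seq c i != 0 | i <- iota n (m - n)].
rewrite mem_bitlists ?size_map ?size_iota // => /(_ isT).
rewrite (completeP cc (leqnn n)) -/f => /implyP.
have -> : has id f.
  apply/hasP; exists (c e != 0) => //; first by apply: map_f; rewrite in_iota0.
  by rewrite /c to_listE eC.
move=> /(_ isT); rewrite sumn_mask szw big_iota_ord => le1.
rewrite [X in (_ <= X)%N]mulnC in le1.
apply: leq_trans le1 _; rewrite leq_mul2r; apply/orP; right.
rewrite [leqRHS]big_mkcond; apply: leq_sum => i _.
rewrite (nth_map 0%N) ?size_iota // nth_iota // add0n /c to_listE.
have -> : mem C i = (i \in C) by [].
by case: (i \in C); rewrite ?eqxx ?oner_eq0 ?muln0 ?muln1.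
Qed.

End Examples.

Definition check_example (n b : nat) (l : seq (nat * nat)) (ws : seq nat) (p q : nat) :=
  [&& tree_form n l, check_weights n l ws p q, size l == (n + b)%N, (0 < b)%N & (0 < q)%N].

Lemma exampleP (R : realType) n b l ws p q : check_example n b l ws p q ->
  exists G : weighted_graph R, first_betti G b /\ p%:R / q%:R <= systole G.
Proof. by case/and5P=> tH ok /eqP mE b0 q0; apply: example tH _ _ _ _ _ ok mE b0 q0. Qed.

(** * The extremal graphs *)

Local Open Scope nat_scope.

Lemma loop_example : check_example 0 1 [:: (0, 0)] [:: 1] 1 1.
Proof. by vm_compute. Qed.

Lemma theta_example : check_example 1 2 [:: (0, 1); (0, 1); (0, 1)] [:: 1; 1; 1] 2 3.
Proof. by vm_compute. Qed.

Lemma K4_example : check_example 3 3 [:: (0, 1); (0, 2); (0, 3); (1, 2); (1, 3);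
  (2, 3)] (nseq 6 1) 1 2.
Proof. by vm_compute. Qed.

Lemma K33_example : check_example 5 4 [:: (0, 1); (0, 2); (0, 3); (1, 4); (1, 5);
  (4, 2); (4, 3); (5, 2); (5, 3)] (nseq 9 1) 4 9.
Proof. by vm_compute. Qed.

Lemma weighted8_example : check_example 7 5 [:: (0, 1); (0, 2); (0, 3); (1, 4); (1, 5);
  (2, 6); (3, 7); (6, 3); (4, 7); (6, 4); (5, 7); (2, 5)] [:: 1; 2; 1; 1; 2; 1;
  1; 2; 2; 1; 1; 1] 3 8.
Proof. by vm_compute. Qed.

Lemma petersen_example : check_example 9 6 [:: (0, 1); (0, 2); (0, 3); (1, 4); (1, 5);
  (2, 6); (2, 7); (3, 8); (3, 9); (4, 6); (4, 8); (6, 9); (5, 9); (8, 7); (7,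
  5)] (nseq 15 1) 1 3.
Proof. by vm_compute. Qed.

Lemma weighted12_example : check_example 11 7 [:: (0, 1); (0, 2); (0, 3); (1, 4); (1, 5);
  (2, 6); (2, 7); (3, 8); (3, 9); (4, 10); (5, 11); (10, 7); (10, 8); (4, 9);
  (6, 9); (11, 8); (6, 11); (7, 5)] [:: 1; 1; 1; 1; 1; 1; 1; 1; 2; 1; 1; 1; 1;
  1; 1; 1; 1; 2] 3 10.
Proof. by vm_compute. Qed.

Lemma heawood_example : check_example 13 8 [:: (0, 1); (0, 2); (0, 3); (1, 4); (1, 5);
  (2, 6); (2, 7); (3, 8); (3, 9); (4, 10); (4, 11); (5, 12); (5, 13); (10, 8);
  (9, 11); (11, 7); (7, 12); (13, 6); (8, 12); (9, 13); (6, 10)] (nseq 21 1) 2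
  7.
Proof. by vm_compute. Qed.

Lemma moebius_kantor_example : check_example 15 9 [:: (0, 1); (0, 2); (0, 3); (1, 4); (1, 5);
  (2, 6); (2, 7); (3, 8); (3, 9); (4, 10); (4, 11); (5, 12); (5, 13); (7, 14);
  (11, 15); (10, 8); (9, 11); (15, 14); (7, 12); (13, 6); (8, 14); (9, 12); (15,
  13); (6, 10)] (nseq 24 1) 1 4.
Proof. by vm_compute. Qed.

Local Open Scope ring_scope.

Lemma optimal (R : realType) (b : nat) : (1 <= b <= 9)%N ->
  exists G : weighted_graph R, first_betti G b /\ s R b <= systole G.
Proof.
case: b => [|[|[|[|[|[|[|[|[|[|]]]]]]]]]] // _; rewrite /s.
- by have := exampleP R loop_example; rewrite divr1.
- exact: exampleP theta_example.
- exact: exampleP K4_example.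
- exact: exampleP K33_example.
- exact: exampleP weighted8_example.
- exact: exampleP petersen_example.
- exact: exampleP weighted12_example.
- exact: exampleP heawood_example.
- exact: exampleP moebius_kantor_example.
Qed.

Theorem theorem2 (R : realType) (b : nat) (hb : (1 <= b <= 9)%N) :
  (forall G : weighted_graph R, first_betti G b -> systole G <= s R b) /\
  (exists G : weighted_graph R, first_betti G b /\ systole G = s R b).
Proof.
have upper (G : weighted_graph R) : first_betti G b -> systole G <= s R b.
  exact: systole_upper.
split=> //; have [G [bG le]] := optimal R hb.
by exists G; split=> //; apply/eqP; rewrite eq_le le upper.
Qed.
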